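(* Let $X$ be a compact Hausdorff space, $A$ a uniform algebra in $C(X)$, and $\varphi$ a multiplicative linear functional in the maximal ideal space of $A$. Suppose that the set $M_\varphi$ of representing measures for $\varphi$ is finite dimensional and that $m$ is a core measure for $\varphi$. Let $0<p<q\le\infty$. Then there is a one-to-one correspondence between closed invariant subspaces $\mathcal{M}_p$ of $L^p(dm)$ and closed (weak-star closed if $q=\infty$) invariant subspaces $\mathcal{M}_q$ of $L^q(dm)$, such that $\mathcal{M}_q=\mathcal{M}_p\cap L^q(dm)$ and $\mathcal{M}_p$ is the closure of $\mathcal{M}_q$ in $L^p(dm)$.
   Context: A uniform algebra in $C(X)$ (the algebra of complex-valued continuous functions on $X$ with the sup norm) is a closed subalgebra of $C(X)$ that contains the constants and separates the points of $X$. A representing measure for $\varphi$ is a positive measure $m$ on $X$ with $\varphi(f)=\int f\,dm$ for all $f\in A$; $M_\varphi$ is the (convex) set of all representing measures for $\varphi$. ''$M_\varphi$ is finite dimensional'' means that this convex set spans a finite-dimensional affine space. If $W$ is a convex subset of a real vector space $V$, an element $x\in W$ is a core point of $W$ if whenever $y\in V$ satisfies $x+y\in W$, then $x-\epsilon y\in W$ for every sufficiently small $\epsilon>0$. A core measure for $\varphi$ is a core point of $M_\varphi$ (regarded in the space of real measures on $X$). For $0<p<\infty$, $L^p(dm)$ is the space of functions whose $p$-th power in absolute value is $m$-integrable, with its usual (quasi-)norm topology; $L^\infty(dm)$ is the space of $m$-essentially bounded functions, with weak-star topology as the dual of $L^1(dm)$. A subspace $\mathcal{M}$ of $L^p(dm)$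 is invariant if $A\mathcal{M}\subseteq\mathcal{M}$. *)

(* Defs.v *)
From HB Require Import structures.
From mathcomp Require Import all_boot all_order all_algebra.
From mathcomp Require Import all_classical all_reals all_analysis.
From mathcomp Require Import complex.

Set Implicit Arguments.
Unset Strict Implicit.
Unset Printing Implicit Defensive.

Import Order.TTheory GRing.Theory Num.Theory.
Import numFieldNormedType.Exports.

Local Open Scope classical_set_scope.
Local Open Scope ring_scope.
Local Open Scope complex_scope.

Section ConvexSets.
Context (R : realType) (V : lmodType R).
Implicit Types (W : set V) (x y : V).

Definition affine_span W : set V :=
  [set x | exists n (w : 'I_n -> V) (c : 'I_n -> R),
    [/\ forall i, W (w i), \sum_i c i = 1 & x = \sum_i c i *: w i]].

(* The affine space spanned by W is affinely generated by finitely many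
   points. *)
Definition finite_dimensional W :=
  exists n (w : 'I_n -> V), affine_span W = affine_span (range w).

Definition core_point W x :=
  W x /\ forall y, W (x + y) -> \forall e \near 0^'+, W (x - e *: y).

End ConvexSets.

Notation Borel X := (g_sigma_algebraType (@open X)).

Section RepresentingMeasures.
Context (R : realType) (X : ptopologicalType).
Local Notation borel := (Borel X).

(* A set function defined on all subsets of X is made canonical by letting it
   vanish off the Borel sets. *)
Definition borel_part (nu : set borel -> \bar R) (B : set borel) : R :=
  if `[< measurable B >] then fine (nu B) else 0.

Definition is_real_measure : {pred set borel -> R} :=
  fun v => `[< exists nu : {charge set borel -> \bar R}, v = borel_part nu >].

Lemma is_real_measure_submod : submod_closed is_real_measure.
Proof.
split.
  apply/asboolP; exists czero; apply/funext => B.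
  by rewrite /borel_part; case: asboolP.
move=> a u v /asboolP[mu ->] /asboolP[nu ->]; apply/asboolP.
exists (cadd (cscale a mu) nu); apply/funext => B.
rewrite -[LHS]/(a * borel_part mu B + borel_part nu B) /borel_part.
case: asboolP => mB; last by rewrite mulr0 addr0.
by rewrite /cadd /cscale /= fineD ?fineM ?fin_numM ?fin_num_measure.
Qed.

HB.instance Definition _ :=
  GRing.isSubmodClosed.Build R (set borel -> R) is_real_measure
    is_real_measure_submod.

(* The real vector space of real (finite signed Borel) measures. *)
Record real_measure := RealMeasure {
  real_measure_val :> set borel -> R;
  _ : real_measure_val \in is_real_measure }.

HB.instance Definition _ := [isSub for real_measure_val].
HB.instance Definition _ := [Choice of real_measure by <:].
HB.instance Definition _ := [SubChoice_isSubLmodule of real_measure by <:].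

Lemma is_real_measure_finite (m : {finite_measure set borel -> \bar R}) :
  borel_part m \in is_real_measure.
Proof. by apply/asboolP; exists (charge_of_finite_measure m). Qed.

Definition real_measure_of (m : {finite_measure set borel -> \bar R}) :=
  RealMeasure (is_real_measure_finite m).

Definition regular_measure (m : {measure set borel -> \bar R}) :=
  forall B : set borel, measurable B -> forall e : R, 0 < e ->
  exists K U : set X, [/\ compact K, open U, K `<=` B, B `<=` U &
    (m (U `\` K) < e%:E)%E].

(* R[i]^o is R[i] with the topology of its modulus. *)
Definition uniform_algebra (A : set (X -> R[i])) :=
  [/\ A `<=` [set f | continuous (f : X -> R[i]^o)],
      closed (A : set {uniform X -> R[i]^o}),
      forall c, A (cst c),
      [/\ forall f g, A f -> A g -> A (f \+ g),
          forall c f, A f -> A (c \*o f) &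
          forall f g, A f -> A g -> A (f \* g)] &
      forall x y, x != y -> exists2 f, A f & f x != f y].

(* Elements of the maximal ideal space of A; only the values of phi on A are
   relevant. *)
Definition multiplicative_functional (A : set (X -> R[i]))
    (phi : (X -> R[i]) -> R[i]) :=
  [/\ exists2 f, A f & phi f != 0,
      forall f g, A f -> A g -> phi (f \+ g) = phi f + phi g,
      forall c f, A f -> phi (c \*o f) = c * phi f &
      forall f g, A f -> A g -> phi (f \* g) = phi f * phi g].

Definition Cintegral (m : {measure set borel -> \bar R}) (f : X -> R[i]) :
    R[i] :=
  (\int[m]_x complex.Re (f x)) +i* (\int[m]_x complex.Im (f x)).

Definition representing (A : set (X -> R[i])) (phi : (X -> R[i]) -> R[i])
    (m : {finite_measure set borel -> \bar R}) :=
  regular_measure m /\ forall f, A f -> phi f = Cintegral m f.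

Definition representing_measures A phi : set real_measure :=
  real_measure_of @` representing A phi.

Definition core_measure A phi (m : {finite_measure set borel -> \bar R}) :=
  core_point (representing_measures A phi) (real_measure_of m).

End RepresentingMeasures.

Section Lp.
Context (R : realType) (X : ptopologicalType).
Variable m : {measure set (Borel X) -> \bar R}.
Implicit Types (p : \bar R) (f g : X -> R[i]) (M : set (X -> R[i])).

Definition CLnorm p f : \bar R :=
  ('N[m]_p[(fun x => (Normc.normc (f x))%:E)])%E.

(* Elements of L^p are represented by Borel functions: the sets closed for
   Lclosure below are saturated for equality m-almost everywhere, hence
   correspond to the closed sets of the quotient. *)
Definition CLspace p : set (X -> R[i]) :=
  [set f | [/\ measurable_fun [set: Borel X] (fun x : Borel X => complex.Re (f x)),
               measurable_fun [set: Borel X] (fun x : Borel X => complex.Im (f x)) &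
               (CLnorm p f < +oo)%E]].

Definition norm_closure p M : set (X -> R[i]) :=
  [set f | CLspace p f /\
    forall e : R, 0 < e -> exists2 g, M g & (CLnorm p (f \- g)%R < e%:E)%E].

(* Closure for the weak-star topology of L^oo as the dual of L^1. *)
Definition weak_star_closure M : set (X -> R[i]) :=
  [set f | CLspace +oo f /\
    forall n (h : 'I_n -> X -> R[i]) (e : R),
      (forall i, CLspace 1 (h i)) -> 0 < e ->
      exists2 g, M g &
        forall i, Normc.normc (Cintegral m ((f \- g) \* h i)) < e].

Definition Lclosure p M : set (X -> R[i]) :=
  if p == +oo%E then weak_star_closure M else norm_closure p M.

Definition closed_invariant_subspace (A : set (X -> R[i])) p M :=
  [/\ M `<=` CLspace p,
      [/\ M (cst 0), forall f g, M f -> M g -> M (f \+ g) &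
          forall c f, M f -> M (c \*o f)],
      forall a f, A a -> M f -> M (a \* f) &
      Lclosure p M `<=` M].

End Lp.

(* Main.v *)
(* Every representing measure is dominated by C m: each one is a combination of
   finitely many, each of those is dominated by a multiple of the core measure
   m, and the coefficients are controlled by the values of the measure on
   finitely many sets.

   Hahn-Banach turns this domination into a duality: for bounded Borel g >= 0
   there are b in A and r >= 0 with g <= Re b + r, phi(b) <= C int g dm + e,
   and r small in an exponential Orlicz norm with respect to an arbitrary
   weight om in L^1(m).  Because of the Orlicz term the extremal functional is
   absolutely continuous with respect to m, so that it is a measure without
   any appeal to the Riesz representation theorem.

   Multiplying approximations of exp(-b) gives, for every S >= 0 with ln(1 + S)
   integrable, functions a_n in A converging almost everywhere to some h which
   is close to 1 in L^1(m) and satisfies |h| <= 1 and |h| S <= c, with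
   |a_n|^s om dominated by an integrable function.  With S = |f|, the function
   h f is a bounded element of any closed invariant subspace of L^p containing
   f and it is close to f; hence bounded elements are dense.  With S a majorant
   of all |f_n - f|, where f_n -> f in L^p, the products a_n f_k approximate f
   in L^q, or weak-star if q = oo, as soon as f belongs to L^q.  Finally, a
   function in the weak-star closure of a subspace of L^oo lies in its L^2
   closure, by orthogonal projection. *)
Require Import Defs.
From HB Require Import structures.
From mathcomp Require Import all_boot all_order all_algebra.
From mathcomp Require Import all_classical all_reals all_analysis.
From mathcomp Require Import measurable_realfun ess_sup_inf complex ring lra.

Set Implicit Arguments.
Unset Strict Implicit.
Unset Printing Implicit Defensive.

Import Order.TTheory GRing.Theory Num.Theory.
Import numFieldNormedType.Exports.

Local Open Scope classical_set_scope.
Local Open Scope ring_scope.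

(** The obstacle is that [A] need not be closed under almost everywhere limits and that [g <= Re b]
    can be had only up to an error [r]. If it held exactly, exp(-b) would have modulus at most
    exp(-g) and integral exp(-phi(b)) >= 1 - phi(b): a function of modulus at most 1 with mean near
    1, hence near 1 in L^2. The error can be carried through infinitely many factors because each
    new factor pays for the error left by its predecessors, and because smallness in the exponential
    norm makes every fixed power of exp(r) integrable against the weight. Integrability of ln(1 + S)
    is what the construction asks for: cutting ln(1 + S) at height k costs only the constant exp(k)
    in the bound for |h| S, while the tail above k has an integral as small as desired, so that h
    can stay close to 1. Exponents below 1 rule out duality and the triangle inequality in L^p.
    Estimates there use integrals of powers, almost everywhere limits of fast sequences, and
    dominated convergence. *)

Local Notation Re := complex.Re.
Local Notation Im := complex.Im.
Local Notation nrm := Normc.normc.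

(** * The Hahn-Banach theorem *)

Section HahnBanach.
Context (R : realType) (V : lmodType R) (S : set V).
Hypothesis SD : forall u v, S u -> S v -> S (u + v).
Hypothesis SZ : forall (a : R) u, S u -> S (a *: u).

Definition sublinear (P : V -> R) :=
  (forall u v, S u -> S v -> P (u + v) <= P u + P v) /\
  (forall t u, 0 <= t -> S u -> P (t *: u) = t * P u).

Let SN u : S u -> S (- u). Proof. by rewrite -scaleN1r; exact: SZ. Qed.

Let SB u v : S u -> S v -> S (u - v). Proof. by move=> Su Sv; apply/SD/SN. Qed.

Lemma sublinear0 P u : sublinear P -> S u -> P 0 = 0.
Proof. by move=> [_ PZ] Su; rewrite -(scale0r u) PZ// mul0r. Qed.

Lemma sublinear_geN P u : sublinear P -> S u -> - P (- u) <= P u.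
Proof.
move=> PP Su; have := PP.1 _ _ Su (SN Su).
by rewrite subrr (sublinear0 PP Su); lra.
Qed.

(** For sublinear [q], the largest sublinear functional below [q] whose value at [- v] is at most
    [- q v]. A linear functional below it therefore takes exactly the value [q v] at [v]. *)
Definition tilt (q : V -> R) (v u : V) : R :=
  inf [set q (u + t *: v) - t * q v | t in [set t : R | 0 <= t]].

Section tilt.
Variables (q : V -> R) (v : V).
Hypotheses (sq : sublinear q) (Sv : S v).

Let lb u : S u ->
  lbound [set q (u + t *: v) - t * q v | t in [set t : R | 0 <= t]] (- q (- u)).
Proof.
move=> Su _ [t /= t0 <-]; rewrite -sq.2//.
have := sq.1 _ _ (SD Su (SZ t Sv)) (SN Su).
by rewrite addrAC subrr add0r; lra.
Qed.

Lemma tilt_le u t : S u -> 0 <= t -> tilt q v u <= q (u + t *: v) - t * q v.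
Proof.
move=> Su t0; apply: ge_inf; last by exists t.
by exists (- q (- u)); exact: lb.
Qed.

Lemma tilt_leq u : S u -> tilt q v u <= q u.
Proof.
by move=> Su; have := tilt_le Su (lexx 0); rewrite scale0r addr0 mul0r subr0.
Qed.

Lemma le_tilt u x : S u ->
  (forall t, 0 <= t -> x <= q (u + t *: v) - t * q v) -> x <= tilt q v u.
Proof.
move=> Su H; apply: lb_le_inf; first by exists (q (u + 0 *: v) - 0 * q v), 0 => /=.
by move=> _ [t /= t0 <-]; exact: H.
Qed.

Lemma sublinear_tilt : sublinear (tilt q v).
Proof.
split=> [u1 u2 Su1 Su2|t u t0 Su].
  rewrite -lerBlDr; apply: le_tilt => // s s0; rewrite lerBlDl -lerBlDr.
  apply: le_tilt => // t t0; rewrite lerBlDr.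
  apply: (le_trans (tilt_le (SD Su1 Su2) (addr_ge0 s0 t0))).
  have -> : u1 + u2 + (s + t) *: v = (u1 + s *: v) + (u2 + t *: v).
    by rewrite scalerDl addrACA.
  have := sq.1 _ _ (SD Su1 (SZ s Sv)) (SD Su2 (SZ t Sv)); lra.
have [->|tn0] := eqVneq t 0.
  rewrite scale0r mul0r; have S0 : S 0 by rewrite -(scale0r v); exact: SZ.
  apply/eqP; rewrite eq_le; apply/andP; split.
    by rewrite -(sublinear0 sq Sv); exact: tilt_leq.
  by apply: le_tilt => // s s0; rewrite add0r sq.2// subrr.
have tgt0 : 0 < t by rewrite lt_neqAle eq_sym tn0.
apply/eqP; rewrite eq_le; apply/andP; split.
  rewrite mulrC -ler_pdivrMr//; apply: le_tilt => // s s0.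
  rewrite ler_pdivrMr// mulrC; apply: (le_trans (tilt_le (SZ t Su) (mulr_ge0 t0 s0))).
  have Sus := SD Su (SZ s Sv).
  by rewrite -scalerA -scalerDr sq.2// mulrBr mulrA.
apply: le_tilt => [|s s0]; first exact: SZ.
have := tilt_le Su (divr_ge0 s0 t0); rewrite -(ler_pM2l tgt0) => /le_trans; apply.
have Sus := SD Su (SZ (s / t) Sv); rewrite mulrBr -(sq.2 t)//.
have E : t * (s / t) = s by rewrite mulrC divfK.
by rewrite scalerDr scalerA [t * (_ * q v)]mulrA E.
Qed.

Lemma tiltN : tilt q v (- v) <= - q v.
Proof.
have := tilt_le (SN Sv) ler01.
by rewrite scale1r addNr (sublinear0 sq Sv) mul1r sub0r.
Qed.

End tilt.

(* A minimal sublinear functional is unchanged by tilt, hence linear. *)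
Lemma minimal_sublinear P : sublinear P -> exists q, [/\ sublinear q,
  forall u, S u -> q u <= P u &
  forall q', sublinear q' -> (forall u, S u -> q' u <= q u) ->
    forall u, S u -> q' u = q u].
Proof.
move=> sP.
pose T := {q : V -> R | sublinear q /\ forall u, S u -> q u <= P u}.
(* The order is reversed, so that the maximal element given by Zorn's lemma is a minimal
   functional. *)
pose le (q1 q2 : T) := `[< forall u, S u -> sval q2 u <= sval q1 u >].
have PT : sublinear P /\ forall u, S u -> P u <= P u by [].
have [||C Ctot|[q [sq qP]] qmin] := @ZL_preorder T (exist _ P PT) le.
- by move=> q; apply/asboolP.
- move=> q1 q2 q3 /asboolP h /asboolP k; apply/asboolP => u Su.
  exact: (le_trans (k u Su) (h u Su)).
- have [->|/set0P[q0 Cq0]] := eqVneq C set0; first by exists (exist _ P PT).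
  pose I u := [set sval q u | q in C].
  have Ilb u : S u -> has_lbound (I u).
    move=> Su; exists (- P (- u)) => _ [[q [sq qP]] _ <-] /=.
    apply: le_trans (sublinear_geN sq Su); rewrite lerN2; exact/qP/SN.
  have Ine u : I u !=set0 by exists (sval q0 u), q0.
  have Ile u q : S u -> C q -> inf (I u) <= sval q u.
    by move=> Su Cq; apply: ge_inf; [exact: Ilb|exists q].
  have sI : sublinear (fun u => inf (I u)).
    split=> [u v Su Sv|t u t0 Su].
      rewrite -lerBlDr; apply: lb_le_inf => // _ [q1 Cq1 <-].
      rewrite lerBlDl -lerBlDr; apply: lb_le_inf => // _ [q2 Cq2 <-].
      (* Totality of the chain: the smaller of [q1] and [q2] serves both [u] and [v]. *)
      rewrite lerBlDr; have [q [Cq h1 h2]] : exists q, [/\ C q,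
          sval q u <= sval q1 u & sval q v <= sval q2 v].
        by have [/asboolP h|/asboolP h] := Ctot _ _ Cq1 Cq2; [exists q2|exists q1];
          split => //; exact: h.
      apply: le_trans (Ile _ _ (SD Su Sv) Cq) _.
      by apply: le_trans ((svalP q).1.1 _ _ Su Sv) _; rewrite addrC lerD.
    have [->|tn0] := eqVneq t 0.
      rewrite mul0r scale0r; have -> : I 0 = [set 0].
        rewrite eqEsubset; split => [_ [q Cq <-]|_ ->] /=.
          by rewrite (sublinear0 (svalP q).1 Su).
        by exists q0 => //; rewrite (sublinear0 (svalP q0).1 Su).
      by rewrite inf1.
    have tgt0 : 0 < t by rewrite lt_neqAle eq_sym tn0.
    apply/eqP; rewrite eq_le; apply/andP; split.
      rewrite mulrC -ler_pdivrMr//; apply: lb_le_inf => // _ [q Cq <-].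
      rewrite ler_pdivrMr// mulrC -(svalP q).1.2//; exact/Ile/Cq/SZ.
    apply: lb_le_inf => // _ [q Cq <-].
    by rewrite (svalP q).1.2// ler_pM2l//; exact: Ile.
  have IP u : S u -> inf (I u) <= P u.
    by move=> Su; apply: le_trans (Ile _ _ Su Cq0) ((svalP q0).2 _ Su).
  exists (exist _ (fun u => inf (I u)) (conj sI IP)) => q Cq.
  by apply/asboolP => u Su /=; exact: Ile.
exists q; split => // q' sq' q'q u Su.
have q'P v : S v -> q' v <= P v by move=> Sv; apply: le_trans (q'q _ Sv) (qP _ Sv).
have /asboolP h := qmin (exist _ q' (conj sq' q'P)) (introT (asboolP _) q'q).
by apply/eqP; rewrite eq_le q'q// h.
Qed.

Theorem hahn_banach P g : sublinear P -> S g ->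
  exists L : V -> R, [/\ forall u, S u -> L u <= P u,
    forall u v, S u -> S v -> L (u + v) = L u + L v,
    forall a u, S u -> L (a *: u) = a * L u & L g = P g].
Proof.
move=> sP Sg.
(* Minimising below the tilt along [g], rather than below [P], is what gives [L g = P g] at the
   end. *)
have [L [sL LP Lmin]] := minimal_sublinear (sublinear_tilt sP Sg).
have LD u v : S u -> S v -> L (u + v) = L u + L v.
  move=> Su Sv; apply/eqP; rewrite eq_le sL.1//= -lerBrDr.
  have {1}<- := Lmin _ (sublinear_tilt sL Sv) (tilt_leq sL Sv) u Su.
  by have := tilt_le sL Sv Su ler01; rewrite scale1r mul1r.
have LN u : S u -> L (- u) = - L u.
  move=> Su; apply/eqP; rewrite -addr_eq0 addrC -LD//; last exact: SN.
  by rewrite subrr (sublinear0 sL Su).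
have LPg u : S u -> L u <= P u.
  by move=> Su; apply: le_trans (LP u Su) (tilt_leq sP Sg Su).
exists L; split => // [a u Su|].
  have [a0|a0] := leP 0 a; first exact: sL.2.
  rewrite -[a]opprK scaleNr LN; last exact: SZ.
  by rewrite sL.2// ?mulNr// oppr_ge0 ltW.
apply/eqP; rewrite eq_le LPg//= -lerN2 -LN//.
exact: le_trans (LP _ (SN Sg)) (tiltN sP Sg).
Qed.

End HahnBanach.

(** * Recovering a linear combination from finitely many values *)

Section Interpolation.
Context (R : fieldType) (S : Type) (n : nat) (w : 'I_n -> S -> R).

(* Take the points [t j] so that the matrix of the [w i (t j)] has maximal rank. *)
Lemma interpolation : exists k (t : 'I_k -> S) (P : 'I_n -> 'I_k -> R),
  forall (c : 'I_n -> R) s,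
  \sum_i c i * w i s = \sum_j (\sum_i w i s * P i j) * \sum_i c i * w i (t j).
Proof.
pose V s : 'rV[R]_n := \row_i w i s.
pose M k (t : 'I_k -> S) : 'M[R]_(k, n) := \matrix_j V (t j).
pose rk (r : nat) := `[< exists k (t : 'I_k -> S), \rank (M k t) = r >].
have ex : exists r, rk r.
  have f0 : 'I_0 -> S by case.
  by exists (\rank (M 0 f0)); apply/asboolP; exists 0, f0.
have ub r : rk r -> (r <= n)%N.
  by move=> /asboolP[k [t <-]]; exact: rank_leq_col.
case: (ex_maxnP ex ub) => r /asboolP[k [t rt]] rmax.
(* A row added for [s] cannot raise the maximal rank, so it lies in the span of the sampled rows;
   the pseudo-inverse then gives coefficients that are linear in the [w i s]. *)
have VM s : (V s <= M k t)%MS.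
  pose t' (j : 'I_(1 + k)) := match fintype.split j with inl _ => s | inr i => t i end.
  have M' : M _ t' = col_mx (V s) (M k t).
    apply/matrixP => i j; rewrite !mxE /t' /=.
    by case: (fintype.split i) => a; rewrite !mxE.
  have : (\rank (M _ t') <= r)%N by apply: rmax; apply/asboolP; exists (1 + k)%N, t'.
  rewrite M' -rt -addsmxE => h.
  have := mxrank_leqif_sup (addsmxSr (V s) (M k t)).
  move=> [h1 h2]; have : \rank (M k t) == \rank (V s + M k t)%MS.
    by rewrite eqn_leq h1 h.
  by rewrite h2 => /(submx_trans (addsmxSl _ _)).
pose P := pinvmx (M k t).
exists k, t, (fun i j => P i j) => c s.
pose cv : 'cV[R]_n := \col_i c i.
have E s' : \sum_i c i * w i s' = (V s' *m cv) 0 0.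
  by rewrite mxE; apply: eq_bigr => i _; rewrite !mxE mulrC.
rewrite E -(mulmxKpV (VM s)) -mulmxA mxE; apply: eq_bigr => j _; congr (_ * _).
  by rewrite mxE; apply: eq_bigr => i _; rewrite mxE.
by rewrite E !mxE; apply: eq_bigr => i _; rewrite !mxE.
Qed.

End Interpolation.

(** * Measures from positive functionals *)

Section BoundedMeasurable.
Context d (T : measurableType d) (R : realType).
Implicit Types (u v : T -> R) (B : set T).

Definition bmeas : set (T -> R) :=
  [set u : T -> R | measurable_fun setT u /\ exists c, forall x, `|u x| <= c].

Lemma bmeasD u v : bmeas u -> bmeas v -> bmeas (u + v).
Proof.
move=> [mu [c uc]] [mv [c' vc']]; split; first exact: measurable_funD.
by exists (c + c') => x; rewrite (le_trans (ler_normD _ _))// lerD.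
Qed.

Lemma bmeasZ (a : R) u : bmeas u -> bmeas (a *: u).
Proof.
move=> [mu [c uc]]; split; first exact: measurable_funM.
by exists (`|a| * c) => x; rewrite normrM ler_wpM2l.
Qed.

Lemma bmeas_cst (a : R) : bmeas (cst a).
Proof. by split => //; exists `|a|. Qed.

Lemma bmeas_indic B : measurable B -> bmeas \1_B.
Proof.
move=> mB; split; first exact: measurable_indic.
by exists 1 => x; rewrite indicE ger0_norm// lern1 leq_b1.
Qed.

Lemma bmeasB u v : bmeas u -> bmeas v -> bmeas (u - v).
Proof. by move=> bu bv; rewrite -scaleN1r; apply: bmeasD => //; exact: bmeasZ. Qed.

Lemma bmeas_sum n (u : nat -> T -> R) :
  (forall i, bmeas (u i)) -> bmeas (\sum_(i < n) u i).
Proof.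
move=> bu; elim: n => [|n ih]; last by rewrite big_ord_recr; exact: bmeasD.
by rewrite big_ord0; exact: bmeas_cst.
Qed.

Lemma bmeas_integrable (mu : {finite_measure set T -> \bar R}) u :
  bmeas u -> mu.-integrable setT (EFin \o u).
Proof.
move=> [mu_ [c uc]]; apply: measurable_bounded_integrable => //.
  by rewrite -ge0_fin_numE// fin_num_measure.
exists c; split; first exact: num_real.
by move=> y cy x _; apply: le_trans (uc x) (ltW cy).
Qed.

Record positive_functional (L : (T -> R) -> R) : Prop := {
  pfunD : forall u v, bmeas u -> bmeas v -> L (u + v) = L u + L v;
  pfunZ : forall a u, bmeas u -> L (a *: u) = a * L u;
  pfun_ge0 : forall u, bmeas u -> (forall x, 0 <= u x) -> 0 <= L u }.

Lemma pfunB L u v : positive_functional L -> bmeas u -> bmeas v ->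
  L (u - v) = L u - L v.
Proof.
move=> LP bu bv; rewrite -scaleN1r (pfunD LP)//; last exact: bmeasZ.
by rewrite (pfunZ LP)// mulN1r.
Qed.

Lemma pfun_le L u v : positive_functional L -> bmeas u -> bmeas v ->
  (forall x, u x <= v x) -> L u <= L v.
Proof.
move=> LP bu bv uv; rewrite -subr_ge0 -pfunB//; apply: (pfun_ge0 LP) => [|x].
  exact: bmeasB.
by rewrite subr_ge0.
Qed.

Lemma pfun_sum L n (u : nat -> T -> R) : positive_functional L ->
  (forall i, bmeas (u i)) -> L (\sum_(i < n) u i) = \sum_(i < n) L (u i).
Proof.
move=> LP bu; elim: n => [|n ih].
  by rewrite !big_ord0 -(scale0r (cst 0)) (pfunZ LP) ?mul0r//; exact: bmeas_cst.
by rewrite !big_ord_recr /= (pfunD LP) ?ih//; exact: bmeas_sum.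
Qed.

Lemma positive_functional_integral (mu : {finite_measure set T -> \bar R}) :
  positive_functional (fun u => \int[mu]_x u x).
Proof.
split.
- by move=> u v bu bv; rewrite -RintegralD//; exact: bmeas_integrable.
- by move=> a u bu; rewrite -RintegralZl//; exact: bmeas_integrable.
- by move=> u bu u0; exact: Rintegral_ge0.
Qed.

(** The sum counts the positive multiples of 1/N that are at most [u x], so it rounds [u x] down to
    the grid of step 1/N. *)
Lemma layer_approx u (N : nat) c : (0 < N)%N -> (forall x, 0 <= u x <= c) ->
  exists K, forall x, let s := N%:R^-1 * \sum_(k < K)
    \1_[set y | k.+1%:R / N%:R <= u y] x in s <= u x <= s + N%:R^-1.
Proof.
move=> N0 uc; have N0' : 0 < N%:R :> R by rewrite ltr0n.
have count (y : R) K : 0 <= y ->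
    let s := \sum_(k < K) (k.+1%:R <= y)%R%:R in
    s <= y /\ (y < s + 1 \/ s = K%:R).
  move=> y0; elim: K => [|K [ih1 ih2]] /=; first by rewrite big_ord0; split => //; right.
  rewrite big_ord_recr /=; have [Ky|Ky] := leP K.+1%:R y.
    have E : \sum_(k < K) (k.+1%:R <= y)%R%:R = K%:R :> R.
      rewrite -[RHS]mulr1 mulr_natl -[in RHS](card_ord K) -sumr_const.
      apply: eq_bigr => k _; suff -> : k.+1%:R <= y by [].
      by apply: le_trans Ky; rewrite ler_nat ltnS ltnW.
    by rewrite E natr1; split => //; right.
  rewrite addr0; split => //; case: ih2 => [|h]; first by left.
  by left; rewrite h natr1.
(* Above [N * c], so that no level of [u] is left uncounted. *)
pose K := (Num.truncn (N%:R * c)).+1.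
exists K => x /=; set y := N%:R * u x.
have y0 : 0 <= y by apply: mulr_ge0 => //; have /andP[] := uc x.
have -> : \sum_(k < K) \1_[set y | k.+1%:R / N%:R <= u y] x
        = \sum_(k < K) (k.+1%:R <= y)%R%:R :> R.
  apply: eq_bigr => k _; rewrite indicE; congr ((_ : bool)%:R).
  apply/idP/idP; rewrite inE/=; first by rewrite ler_pdivrMr// mulrC.
  by rewrite ler_pdivrMr// mulrC.
have [h1 h2] := count y K y0.
have -> : u x = N%:R^-1 * y by rewrite /y mulrA mulVf ?mul1r// gt_eqF.
rewrite ler_pM2l ?invr_gt0// h1/= -{3}[N%:R^-1]mulr1 -mulrDr ler_pM2l ?invr_gt0//.
case: h2 => [/ltW//|->].
have yK : y < K%:R.
  apply: le_lt_trans (truncnS_gt _); rewrite ler_pM2l//.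
  by have /andP[] := uc x.
by rewrite (le_trans (ltW yK))// lerDl.
Qed.

(** Only positivity and finite additivity are available, so the passage from sets to functions is by
    uniform approximation: the layer sums are within 1/N of [u], which costs [L1 (cst 1)] divided by
    N. *)
Lemma pfun_le_indic L1 L2 : positive_functional L1 -> positive_functional L2 ->
  (forall B, measurable B -> L1 \1_B <= L2 \1_B) ->
  forall u, bmeas u -> (forall x, 0 <= u x) -> L1 u <= L2 u.
Proof.
move=> P1 P2 L12 u bu u0; have [mu [c uc0]] := bu.
have uc x : 0 <= u x <= c by rewrite u0 (le_trans (ler_norm _)).
have close N : (0 < N)%N -> L1 u - L2 u <= N%:R^-1 * L1 (cst 1).
  move=> N0; have [K HK] := layer_approx N0 uc.
  pose B k := [set y | k.+1%:R / N%:R <= u y].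
  have mB k : measurable (B k).
    rewrite -[B k]setTI; have -> : B k = u @^-1` `[k.+1%:R / N%:R, +oo[.
      by apply/seteqP; split => y /=; rewrite in_itv /= andbT.
    exact: mu.
  have bB k : bmeas (\1_(B k) : T -> R) by exact: bmeas_indic.
  pose s := N%:R^-1 *: \sum_(k < K) (\1_(B k) : T -> R).
  have bs0 : bmeas (\sum_(k < K) (\1_(B k) : T -> R)) by exact: (bmeas_sum K bB).
  have bs : bmeas s by exact: bmeasZ.
  have Ls : L1 s <= L2 s.
    rewrite (pfunZ P1)// (pfunZ P2)// ler_wpM2l//.
    rewrite (pfun_sum K P1 bB) (pfun_sum K P2 bB).
    by apply: ler_sum => k _; exact: L12.
  have su x : s x <= u x <= s x + N%:R^-1.
    by have := HK x; rewrite /s fctE fct_sumE.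
  have bNs : bmeas (s + cst N%:R^-1) by apply: bmeasD => //; exact: bmeas_cst.
  have cstN : cst N%:R^-1 = N%:R^-1 *: cst 1 :> (T -> R).
    by apply/funext => x; rewrite -[RHS]/(_ * 1) mulr1.
  have h2 : L2 s <= L2 u by apply: pfun_le => // x; have /andP[] := su x.
  have h1 : L1 u <= L1 s + N%:R^-1 * L1 (cst 1).
    rewrite -(pfunZ P1) -?cstN -?(pfunD P1)//; try exact: bmeas_cst.
    by apply: pfun_le => // x; have /andP[] := su x.
  by rewrite lerBlDr (le_trans h1)// addrC lerD2l (le_trans Ls).
rewrite -subr_le0; apply/ler_addgt0Pl => e e0; rewrite addr0.
pose N := (Num.truncn (L1 (cst 1) / e)).+1.
apply: le_trans (close N isT) _; rewrite mulrC ler_pdivrMr ?ltr0n//.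
rewrite mulrC -ler_pdivrMr//; exact/ltW/truncnS_gt.
Qed.

Lemma pfun_unique L1 L2 : positive_functional L1 -> positive_functional L2 ->
  (forall B, measurable B -> L1 \1_B = L2 \1_B) -> forall u, bmeas u -> L1 u = L2 u.
Proof.
move=> P1 P2 L12 u bu; have [mu [c uc]] := bu.
have L12pos v : bmeas v -> (forall x, 0 <= v x) -> L1 v = L2 v.
  by move=> bv v0; apply/eqP; rewrite eq_le !pfun_le_indic// => B mB; rewrite L12.
have bc : bmeas (cst (`|c|)) by exact: bmeas_cst.
have : L1 (u + cst `|c|) = L2 (u + cst `|c|).
  apply: L12pos => [|x]; first exact: bmeasD.
  have := uc x; rewrite ler_norml fctE /= => /andP[h _].
  by have := ler_norm c; lra.
by rewrite (pfunD P1)// (pfunD P2)// (L12pos (cst `|c|))//; exact: addIr.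
Qed.

End BoundedMeasurable.
Arguments bmeas {d T R}.

Section MeasureOfFunctional.
Context d (T : measurableType d) (R : realType).
Variables (mu : {finite_measure set T -> \bar R}) (L : (T -> R) -> R).
Hypothesis LP : positive_functional L.
Hypothesis Lac : forall e : R, 0 < e -> exists2 dlt : R, 0 < dlt &
  forall B, measurable B -> (mu B < dlt%:E)%E -> L \1_B <= e.

(* [isMeasure] asks for positivity on all sets, whence the value 0 off the
   measurable ones. *)
Definition set_functional (B : set T) : \bar R :=
  if `[< measurable B >] then (L \1_B)%:E else 0%E.

Let sfE B : measurable B -> set_functional B = (L \1_B)%:E.
Proof. by rewrite /set_functional; case: asboolP. Qed.

Let sf0 : set_functional set0 = 0%E.
Proof.
have -> : set_functional set0 = (L (0 *: cst 0))%:E.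
  by rewrite sfE// indic0; congr (L _)%:E; apply/funext => x; rewrite -[RHS]/(0 * 0) mul0r.
by rewrite (pfunZ LP) ?mul0r//; exact: bmeas_cst.
Qed.

Let sf_ge0 B : (0 <= set_functional B)%E.
Proof.
rewrite /set_functional; case: asboolP => // mB.
by rewrite lee_fin (pfun_ge0 LP)//; exact: bmeas_indic.
Qed.

Let LU A B : measurable A -> measurable B -> A `&` B = set0 ->
  L \1_(A `|` B) = L \1_A + L \1_B.
Proof.
move=> mA mB AB; rewrite -(pfunD LP); try exact: bmeas_indic.
congr L; apply/funext => x; rewrite fctE !indicE in_setU.
have [xA|xA] := boolP (x \in A); have [xB|xB] := boolP (x \in B) => //=; rewrite ?addr0 ?add0r//.
by have : set0 x; [rewrite -AB; split; exact: set_mem|].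
Qed.

(** Countable additivity comes from [Lac]: the union minus its first [n] pieces has [mu]-measure
    tending to 0, hence so does the value of [L] on it. *)
Let sf_sigma : semi_sigma_additive set_functional.
Proof.
move=> F mF tF mUF.
pose U n := \big[setU/set0]_(i < n) F i.
have mU n : measurable (U n) by apply: bigsetU_measurable => i _.
have FU n : F n `&` U n = set0.
  rewrite -subset0 => x [Fx]; rewrite /U -bigcup_mkord => -[k /= kn Fk].
  have := tF n k I I (ex_intro _ x (conj Fx Fk)) => nk.
  by rewrite nk ltnn in kn.
have US n : U n.+1 = U n `|` F n by rewrite /U big_ord_recr.
have sumU n : (\sum_(0 <= i < n) set_functional (F i))%E = (L \1_(U n))%:E.
  rewrite big_mkord; elim: n => [|n ih].
    by rewrite big_ord0 /U big_ord0 -sfE// sf0.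
  rewrite big_ord_recr /= ih sfE// -EFinD US LU//.
  by rewrite setIC; exact: FU.
rewrite (_ : (fun n => _) = EFin \o (fun n => L \1_(U n))); last exact/funext.
rewrite sfE//; apply: cvg_EFin; first exact: nearW.
have UT n : U n `<=` \bigcup_k F k.
  by rewrite /U -bigcup_mkord => x [k _ Fk]; exists k.
have LD n : L \1_(\bigcup_k F k) = L \1_(U n) + L \1_(\bigcup_k F k `\` U n).
  rewrite -LU//; first by rewrite setDUK//.
    exact: measurableD.
  by rewrite setDIK.
apply/cvgrPdist_le => e e0.
have [dlt dlt0 Hdlt] := Lac e0.
have : (\sum_(0 <= i < n) mu (F i))%E @[n --> \oo] --> (fine (mu (\bigcup_k F k)))%:E.
  rewrite fineK ?fin_num_measure//.
  exact: (@measure_semi_sigma_additive _ _ _ mu F mF tF mUF).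
move=> /fine_cvgP[_] /cvgrPdist_lt/(_ _ dlt0); apply: filterS => n /= h.
rewrite (LD n) addrAC subrr add0r ger0_norm; last first.
  apply: (pfun_ge0 LP) => [|x]; last by rewrite indicE.
  by apply: bmeas_indic; exact: measurableD.
apply: Hdlt; first exact: measurableD.
have muU : (\sum_(0 <= i < n) mu (F i))%E = mu (U n).
  by rewrite big_mkord /U measure_bigsetU.
rewrite measureD//; last by rewrite -ge0_fin_numE// fin_num_measure.
rewrite setIidr//.
move: h; rewrite /comp muU => /(le_lt_trans (ler_norm _)).
by rewrite -lte_fin EFinB !fineK ?fin_num_measure.
Qed.

HB.instance Definition _ := isMeasure.Build d T R set_functional sf0 sf_ge0 sf_sigma.

Let sf_fin : fin_num_fun set_functional.
Proof. by move=> B mB; rewrite sfE. Qed.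

HB.instance Definition _ := Measure_isFinite.Build d T R set_functional sf_fin.

Lemma measure_of_functional : exists nu : {finite_measure set T -> \bar R},
  (forall B, measurable B -> nu B = (L \1_B)%:E) /\
  (forall u, bmeas u -> \int[nu]_x u x = L u).
Proof.
exists set_functional; split; first exact: sfE.
apply: pfun_unique => //; first exact: positive_functional_integral.
move=> B mB; rewrite /Rintegral integral_indic// setIT.
by rewrite -[X in fine X]/(set_functional B) sfE.
Qed.

End MeasureOfFunctional.

(** * Integration lemmas *)

Section FiniteMeasureIntegrals.
Context d (T : measurableType d) (R : realType).
Variable mu : {finite_measure set T -> \bar R}.
Implicit Types (f g : T -> R).

Local Notation Int f := (\int[mu]_x (f x)%:E)%E.
Local Notation mfun f := (measurable_fun [set: T] f).

Lemma int_le f g : mfun f -> mfun g -> (forall x, 0 <= f x) ->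
  (forall x, f x <= g x) -> (Int f <= Int g)%E.
Proof.
move=> mf mg f0 fg; apply: ge0_le_integral => //.
- by move=> x _; rewrite lee_fin.
- exact/measurable_EFinP.
- exact/measurable_EFinP.
- by move=> x _; rewrite lee_fin.
Qed.

Lemma int_ae_le f g : mfun f -> mfun g -> (forall x, 0 <= f x) ->
  (forall x, 0 <= g x) -> {ae mu, forall x, f x <= g x} -> (Int f <= Int g)%E.
Proof.
move=> mf mg f0 g0 fg; apply: ae_ge0_le_integral => //.
- by move=> x _; rewrite lee_fin.
- exact/measurable_EFinP.
- by move=> x _; rewrite lee_fin.
- exact/measurable_EFinP.
- by apply: filterS fg => x h _; rewrite lee_fin.
Qed.

Lemma intD f g : mfun f -> mfun g -> (forall x, 0 <= f x) ->
  (forall x, 0 <= g x) -> (\int[mu]_x (f x + g x)%:E = Int f + Int g)%E.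
Proof.
move=> mf mg f0 g0; under eq_integral do rewrite EFinD.
apply: ge0_integralD => //.
- by move=> x _; rewrite lee_fin.
- exact/measurable_EFinP.
- by move=> x _; rewrite lee_fin.
- exact/measurable_EFinP.
Qed.

Lemma intZ (a : R) f : mfun f -> (forall x, 0 <= f x) -> 0 <= a ->
  (\int[mu]_x (a * f x)%:E = a%:E * Int f)%E.
Proof.
move=> mf f0 a0; under eq_integral do rewrite EFinM.
apply: ge0_integralZl_EFin => //.
- by move=> x _; rewrite lee_fin.
- exact/measurable_EFinP.
Qed.

Lemma int_integrable f : mfun f -> (forall x, 0 <= f x) -> (Int f < +oo)%E ->
  mu.-integrable setT (EFin \o f).
Proof.
move=> mf f0 fy; apply/integrableP; split; first exact/measurable_EFinP.
by under eq_integral do rewrite /= ger0_norm//.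
Qed.

Lemma intE f : mfun f -> (forall x, 0 <= f x) -> (Int f < +oo)%E ->
  Int f = (\int[mu]_x f x)%:E.
Proof.
move=> mf f0 fy; rewrite fineK//; apply: integrable_fin_num => //.
exact: int_integrable.
Qed.

Lemma int_ge0 f : (forall x, 0 <= f x) -> (0 <= Int f)%E.
Proof. by move=> f0; apply: integral_ge0 => x _; rewrite lee_fin. Qed.

Lemma int_cst (a : R) : (\int[mu]_x a%:E = a%:E * mu setT)%E.
Proof. by rewrite (@integral_cst _ _ _ mu setT measurableT a%:E). Qed.

(** Dominated convergence, cut down to the form in which it is applied below: one index with a small
    integral. *)
Lemma int_cvg0 (f : nat -> T -> R) (G : T -> R) (e : R) : 0 < e ->
  (forall n, mfun (f n)) -> mfun G -> (forall n x, 0 <= f n x) ->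
  (forall x, 0 <= G x) -> (Int G < +oo)%E ->
  {ae mu, forall x, forall n, f n x <= G x} ->
  {ae mu, forall x, f ^~ x @ \oo --> (0 : R)} ->
  exists n, (Int (f n) < e%:E)%E.
Proof.
move=> e0 mf mG f0 G0 Gy fG fc.
have fG' : {ae mu, forall x n, setT x -> (`|(EFin \o f n) x| <= (EFin \o G) x)%E}.
  by apply: filterS fG => x h n _; rewrite /= lee_fin ger0_norm.
have fc' : {ae mu, forall x, setT x -> (fun n => (EFin \o f n) x) @ \oo --> (0 : \bar R)}.
  by apply: filterS fc => x h _; apply: cvg_EFin => //; exact: nearW.
have [_ _] := @dominated_convergence _ _ _ mu setT measurableT
  (fun n => EFin \o f n) (cst 0%E) (EFin \o G)
  (fun n => (measurable_EFinP _ _).2 (mf n)) (measurable_cst _) fc'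
  (int_integrable mG G0 Gy) fG'.
rewrite integral0 => /fine_cvgP[hfin /cvgr0Pnorm_lt/(_ _ e0) h].
have [n [h1 h2]] := filter_ex (filterI hfin h); exists n.
rewrite -(@fineK _ (Int (f n)))//.
by rewrite lte_fin (le_lt_trans (ler_norm _)).
Qed.

Lemma int_trunc_small f : mfun f -> (forall x, 0 <= f x) -> (Int f < +oo)%E ->
  forall e : R, 0 < e -> exists n : nat,
    (\int[mu]_x (f x - Num.min (f x) n%:R)%:E < e%:E)%E.
Proof.
move=> mf f0 fy e e0.
apply: (@int_cvg0 (fun n x => f x - Num.min (f x) n%:R) f) => // [n|n x||].
- by apply: measurable_funB => //; exact: measurable_minr.
- by rewrite subr_ge0 ge_min lexx.
- by apply: nearW => x n; rewrite gerBl le_min f0 ler0n.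
- apply: nearW => x; apply: cvg_near_cst; near=> n.
  apply/eqP; rewrite subr_eq0 eq_sym; apply/eqP/min_idPl.
  by near: n; exact: nbhs_infty_ger.
Unshelve. all: by end_near.
Qed.

Lemma int_abs_continuous f : mfun f -> (forall x, 0 <= f x) -> (Int f < +oo)%E ->
  forall e : R, 0 < e -> exists2 dlt : R, 0 < dlt & forall B, measurable B ->
    (mu B < dlt%:E)%E -> (\int[mu]_x (f x * \1_B x)%:E <= e%:E)%E.
Proof.
move=> mf f0 fy e e0; have e20 : 0 < e / 2 by rewrite divr_gt0.
have [n hn] := int_trunc_small mf f0 fy e20.
(* [n.+1] instead of [n] gives a positive bound for the truncated part, so that one can divide by
   it. *)
have n10 : 0 < n.+1%:R :> R by rewrite ltr0n.
exists (e / 2 / n.+1%:R) => [|B mB muB]; first by rewrite divr_gt0.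
have m1 : mfun (\1_B : T -> R) by exact: measurable_indic.
have mt : mfun (fun x => f x - Num.min (f x) n%:R).
  by apply: measurable_funB => //; exact: measurable_minr.
apply: (@le_trans _ _ (\int[mu]_x (f x - Num.min (f x) n%:R + n.+1%:R * \1_B x)%:E)%E).
  apply: int_le => // [||x|x].
  - exact: measurable_funM.
  - by apply: measurable_funD => //; exact: measurable_funM.
  - by rewrite mulr_ge0.
  - rewrite indicE; case: (x \in B); rewrite /= ?mulr1 ?mulr0 ?addr0.
      rewrite -addrA lerDl addrC subr_ge0 ge_min; apply/orP; right.
      by rewrite ler_nat.
    by rewrite subr_ge0 ge_min lexx.
rewrite intD//; last 2 first.
- exact: measurable_funM.
- by move=> x; rewrite subr_ge0 ge_min lexx.
rewrite intZ// integral_indic// setIT.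
rewrite [in leRHS](splitr e) EFinD leeD//; first exact: ltW.
apply: (@le_trans _ _ (n.+1%:R%:E * (e / 2 / n.+1%:R)%:E)%E).
  by rewrite lee_pmul2l ?lte_fin//; exact: ltW.
by rewrite -EFinM lee_fin mulrC divfK// gt_eqF.
Qed.

(** Monotone convergence: the sum has integral at most [C], hence is finite almost everywhere.
    [fine] turns it into a real function, so the majorisation holds only almost everywhere. *)
Lemma int_series (u : nat -> T -> R) (c : nat -> R) (C : R) :
  (forall n, mfun (u n)) -> (forall n x, 0 <= u n x) ->
  (forall n, (Int (u n) <= (c n)%:E)%E) -> (forall n, \sum_(i < n) c i <= C) ->
  exists S : T -> R, [/\ mfun S, forall x, 0 <= S x, (Int S <= C%:E)%E &
    {ae mu, forall x, forall n, \sum_(i < n) u i x <= S x}].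
Proof.
move=> mu_ u0 uc cC.
pose S' x := (\sum_(n <oo) (u n x)%:E)%E.
have mS' : measurable_fun setT S'.
  apply: ge0_emeasurable_sum => [n x _ _|n _]; first by rewrite lee_fin.
  exact/measurable_EFinP.
have S'0 x : (0 <= S' x)%E by apply: nneseries_ge0 => n _ _; rewrite lee_fin.
have IS' : (\int[mu]_x S' x <= C%:E)%E.
  rewrite integral_nneseries//.
  - apply: lime_le.
      by apply: is_cvg_nneseries => n _ _; exact: int_ge0.
    apply: nearW => n; apply: (@le_trans _ _ (\sum_(0 <= i < n) (c i)%:E)%E).
      by apply: lee_sum => i _; exact: uc.
    by rewrite big_mkord sumEFin lee_fin.
  - by move=> n; exact/measurable_EFinP.
  - by move=> n x _; rewrite lee_fin.
have iS' : mu.-integrable setT S'.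
  apply/integrableP; split => //.
  under eq_integral do rewrite gee0_abs//.
  exact: le_lt_trans IS' (ltry _).
exists (fine \o S'); split.
- exact: measurableT_comp.
- by move=> x /=; rewrite fine_ge0.
- apply: le_trans IS'; apply: ae_ge0_le_integral => //.
  + by move=> x _; rewrite lee_fin fine_ge0.
  + by apply/measurable_EFinP; exact: measurableT_comp.
  + have := integrable_ae measurableT iS'.
    by apply: filterS => x /(_ I) h _ /=; rewrite fineK.
- have := integrable_ae measurableT iS'.
  apply: filterS => x /(_ I) h n /=; rewrite -lee_fin fineK// -sumEFin.
  rewrite -(big_mkord xpredT (fun i => (u i x)%:E)).
  by apply: nneseries_lim_ge => i _ _; rewrite lee_fin.
Qed.

(** The increments are absolutely summable off a null set [N]. Multiplying by the indicator of its
    complement makes the sequence converge everywhere, so that the limit is measurable. *)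
Lemma ae_cvg_of_series (v : nat -> T -> R) (S : T -> R) :
  (forall n, mfun (v n)) ->
  {ae mu, forall x, forall n, \sum_(i < n) `|v i.+1 x - v i x| <= S x} ->
  exists2 w : T -> R, mfun w & {ae mu, forall x, v ^~ x @ \oo --> w x}.
Proof.
move=> mv [N [mN N0 vS]].
have vcvg x : ~ N x -> cvgn (v ^~ x).
  move=> Nx; have {}vS : forall n, \sum_(i < n) `|v i.+1 x - v i x| <= S x.
    by apply: contrapT => h; apply: Nx; apply: vS.
  have : cvgn (series (fun n => v n.+1 x - v n x)).
    apply: normed_cvg; apply: nondecreasing_is_cvgn.
      by apply: (@nondecreasing_series R (fun n => `|v n.+1 x - v n x|) xpredT 0) => n _ _; exact: normr_ge0.
    by exists (S x) => _ [n _ <-]; have := vS n; rewrite -(big_mkord xpredT (fun i => `|v i.+1 x - v i x|)).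
  have -> : series (fun n => v n.+1 x - v n x) = fun n => v n x - v 0%N x.
    by apply/funext => n; rewrite /series/= telescope_sumr.
  move=> /cvg_ex[l hl]; apply/cvg_ex; exists (l + v 0%N x).
  rewrite (_ : v ^~ x = fun n => (v n x - v 0%N x) + v 0%N x); last first.
    by apply/funext => n; rewrite subrK.
  by apply: cvgD => //; exact: cvg_cst.
pose w x := limn (fun n => v n x * \1_(~` N) x).
have mNC : measurable (~` N) by exact: measurableC.
have wc x : (fun n => v n x * \1_(~` N) x) @ \oo --> w x.
  have [Nx|Nx] := pselect (N x).
    rewrite /w (_ : (fun n => v n x * _) = cst 0); last first.
      by apply/funext => n; rewrite indicE memNset ?mulr0//=; exact.
    by rewrite lim_cst//; exact: cvg_cst.
  apply: cvgP; apply: is_cvgM; first exact: vcvg.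
  exact: is_cvg_cst.
exists w.
  apply: (@measurable_fun_cvg _ _ _ _ (fun n x => v n x * \1_(~` N) x)).
    by move=> n; apply: measurable_funM => //; exact: measurable_indic.
  by move=> x _; exact: wc.
exists N; split => // x /=; apply: contra_notP => Nx.
have := wc x; rewrite indicE mem_set//=.
by under eq_fun do rewrite mulr1.
Qed.

End FiniteMeasureIntegrals.

(** * Duality *)

Lemma expR_convex (R : realType) (l a b : R) : 0 <= l <= 1 ->
  expR (l * a + (1 - l) * b) <= l * expR a + (1 - l) * expR b.
Proof.
move=> /andP[l0 l1]; set c := l * a + (1 - l) * b.
have tangent y : expR c * (1 + (y - c)) <= expR y.
  have -> : expR y = expR c * expR (y - c) by rewrite -expRD addrC subrK.
  by rewrite ler_pM2l ?expR_gt0// expR_ge1Dx.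
have := ler_wpM2l l0 (tangent a).
have l1' : 0 <= 1 - l by rewrite subr_ge0.
have := ler_wpM2l l1' (tangent b).
have -> : (1 - l) * (expR c * (1 + (b - c))) =
  expR c * ((1 - l) * (1 + (b - c))) by ring.
have -> : l * (expR c * (1 + (a - c))) = expR c * (l * (1 + (a - c))) by ring.
move=> h1 h2; apply: le_trans (lerD h2 h1); rewrite -mulrDr.
have -> : l * (1 + (a - c)) + (1 - l) * (1 + (b - c)) = 1 by rewrite /c; ring.
by rewrite mulr1.
Qed.

Section Duality.
Context d (T : measurableType d) (R : realType).
Variables (mu : {finite_measure set T -> \bar R}) (H : set (T -> R)) (C : R).
Hypothesis mu1 : mu setT = 1%E.
Hypothesis H_bmeas : H `<=` bmeas.
Hypothesis H_cst : forall c : R, H (cst c).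
Hypothesis HD : forall u v, H u -> H v -> H (u + v).
Hypothesis HZ : forall (a : R) u, H u -> H (a *: u).
Hypothesis dom : forall nu : {finite_measure set T -> \bar R},
  (forall e : R, 0 < e -> exists2 dlt : R, 0 < dlt & forall B, measurable B ->
    (mu B < dlt%:E)%E -> (nu B <= e%:E)%E) ->
  (forall h, H h -> \int[nu]_x h x = \int[mu]_x h x) ->
  forall B, measurable B -> fine (nu B) <= C * fine (mu B).

Variable om : T -> R.
Hypothesis mom : measurable_fun setT om.
Hypothesis om1 : forall x, 1 <= om x.
Hypothesis om_fin : (\int[mu]_x (om x)%:E < +oo)%E.

Local Notation mfun f := (measurable_fun [set: T] f).

Let om0 x : 0 <= om x. Proof. exact: le_trans (om1 x). Qed.

Definition exp_bound := \int[mu]_x om x + 1.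

(* The convex set that stands for the unit ball of the exponential Orlicz norm. *)
Definition exp_bounded : set (T -> R) := [set w : T -> R | [/\ mfun w, forall x, 0 <= w x &
  (\int[mu]_x (expR (w x) * om x)%:E <= exp_bound%:E)%E]].

Let m_exp w : mfun w -> mfun (fun x => expR (w x) * om x).
Proof.
by move=> mw; apply: measurable_funM => //; exact: measurableT_comp.
Qed.

Lemma exp_bounded_convex l w1 w2 : 0 <= l <= 1 -> exp_bounded w1 ->
  exp_bounded w2 -> exp_bounded (l *: w1 + (1 - l) *: w2).
Proof.
move=> l01 [mw1 w10 I1] [mw2 w20 I2]; have /andP[l0 l1] := l01.
have l1' : 0 <= 1 - l by rewrite subr_ge0.
have mw : mfun (l *: w1 + (1 - l) *: w2).
  by apply: measurable_funD; exact: measurable_funM.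
split; [exact: mw|by move=> x; rewrite addr_ge0// mulr_ge0|].
apply: (@le_trans _ _ (\int[mu]_x (l * (expR (w1 x) * om x)
    + (1 - l) * (expR (w2 x) * om x))%:E)%E).
  apply: int_le => [||x|x].
  - exact: m_exp.
  - by apply: measurable_funD; apply: measurable_funM => //; exact: m_exp.
  - by rewrite mulr_ge0// expR_ge0.
  - by rewrite !mulrA -mulrDl ler_wpM2r//; exact: expR_convex.
have e0 w x : 0 <= expR (w x) * om x by rewrite mulr_ge0// expR_ge0.
rewrite intD; [|by apply: measurable_funM => //; exact: m_exp
  |by apply: measurable_funM => //; exact: m_exp
  |by move=> x; rewrite mulr_ge0|by move=> x; rewrite mulr_ge0].
rewrite !intZ//; [|exact: m_exp|exact: m_exp].
apply: (@le_trans _ _ (l%:E * exp_bound%:E + (1 - l)%:E * exp_bound%:E)%E).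
  by apply: leeD; apply: lee_wpmul2l; rewrite ?lee_fin.
by rewrite -!EFinM -EFinD lee_fin -mulrDl addrC subrK mul1r.
Qed.

Lemma exp_bounded0 : exp_bounded (cst 0).
Proof.
split => //; under eq_integral do rewrite expR0 mul1r.
by rewrite intE// lee_fin lerDl.
Qed.

Lemma exp_bounded_int w : exp_bounded w ->
  mu.-integrable setT (EFin \o w) /\ \int[mu]_x w x <= exp_bound.
Proof.
move=> [mw w0 Iw].
have h : (\int[mu]_x (w x)%:E <= exp_bound%:E)%E.
  apply: le_trans Iw; apply: int_le => // [|x]; first exact: m_exp.
  apply: (@le_trans _ _ (expR (w x))).
    by apply: le_trans (expR_ge1Dx _); rewrite lerDr.
  by rewrite ler_peMr// expR_ge0.
have fy := le_lt_trans h (ltry _).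
by split; [exact: int_integrable|rewrite -lee_fin -intE].
Qed.

(** The [+ 1] in [exp_bound] is the room used here: a very large multiple of an indicator is
    admissible as soon as the set carries little of the weight. This is the source of the absolute
    continuity of the dual functional. *)
Lemma exp_bounded_indic (t : R) B : 0 < t -> measurable B ->
  ((expR t^-1 - 1)%:E * \int[mu]_x (om x * \1_B x)%:E <= 1)%E ->
  exp_bounded (t^-1 *: \1_B).
Proof.
move=> t0 mB hB.
have m1 : mfun (\1_B : T -> R) by exact: measurable_indic.
have et : 0 <= expR t^-1 - 1 by rewrite subr_ge0 ltW// expR_gt1 invr_gt0.
split => [|x|].
- exact: measurable_funM.
- by rewrite mulr_ge0// invr_ge0 ltW.
- rewrite (_ : (fun x => _) = fun x =>
      (om x + (expR t^-1 - 1) * (om x * \1_B x))%:E); last first.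
    apply/funext => x; congr EFin; rewrite -[(_ *: _) x]/(_ * _) indicE.
    by case: (x \in B); rewrite /= ?mulr1 ?mulr0 ?expR0; ring.
  have mo1 : mfun (fun x => om x * \1_B x) by exact: measurable_funM.
  have o10 x : 0 <= om x * \1_B x by rewrite mulr_ge0.
  rewrite intD//; [|exact: measurable_funM|by move=> x; rewrite mulr_ge0].
  by rewrite intZ// [X in (X + _)%E]intE// /exp_bound [in leRHS]EFinD leeD2l.
Qed.

(** Its infimum is the least cost of majorising [u] by some [h] in [H], paid by its integral, plus
    an error, paid at the rate [K] per unit of its gauge with respect to [exp_bounded]. *)
Definition dual_set (K : R) (u : T -> R) : set R := [set s | exists h t w,
  [/\ H h, 0 <= t, exp_bounded w, (forall x, u x <= h x + t * w x) &
      s = \int[mu]_x h x + K * t]].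

Definition dual_norm K u := inf (dual_set K u).

Variable K : R.
Hypothesis KD : exp_bound <= K.

Let bint u : bmeas u -> mu.-integrable setT (EFin \o u).
Proof. exact: bmeas_integrable. Qed.

(** A rate [K] of at least [exp_bound] makes the penalty [K * t] no less than the integral of
    [t * w], so cheap errors cannot drive the infimum to minus infinity. *)
Lemma dual_set_lb u s : bmeas u -> dual_set K u s -> \int[mu]_x u x <= s.
Proof.
move=> bu [h [t [w [Hh t0 Ew uhw ->]]]].
have [iw Dw] := exp_bounded_int Ew.
have itw : mu.-integrable setT (EFin \o (fun x => t * w x)).
  by have := integrableZl measurableT t iw.
apply: (@le_trans _ _ (\int[mu]_x (h x + t * w x))).
  apply: le_Rintegral => //; first exact: bint.
  by have := integrableD measurableT (bint (H_bmeas Hh)) itw.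
rewrite RintegralD//; last exact/bint/H_bmeas.
rewrite lerD2l RintegralZl// mulrC ler_wpM2r//.
exact: le_trans KD.
Qed.

Let lb u : bmeas u -> has_lbound (dual_set K u).
Proof. by move=> bu; exists (\int[mu]_x u x) => s; exact: dual_set_lb. Qed.

Let int_cst' (c : R) : \int[mu]_x c = c.
Proof. by rewrite Rintegral_cst// -[X in fine X]/(mu setT) mu1 mulr1. Qed.

Let ne u : bmeas u -> dual_set K u !=set0.
Proof.
move=> [_ [c uc]]; exists c, (cst c), 0, (cst 0); split => //.
- exact: exp_bounded0.
- by move=> x; rewrite mul0r addr0 (le_trans (ler_norm _)).
- by rewrite int_cst' mulr0 addr0.
Qed.

Let K0 : 0 < K.
Proof.
apply: lt_le_trans KD; rewrite ltr_wpDl//.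
by apply: Rintegral_ge0.
Qed.

Lemma dual_norm_le u s : bmeas u -> dual_set K u s -> dual_norm K u <= s.
Proof. by move=> bu us; apply: ge_inf => //; exact: lb. Qed.

Lemma dual_setD u v s s' : dual_set K u s -> dual_set K v s' ->
  dual_set K (u + v) (s + s').
Proof.
move=> [h [t [w [Hh t0 Ew uhw ->]]]] [h' [t' [w' [Hh' t'0 Ew' uhw' ->]]]].
have intH : \int[mu]_x (h + h') x = \int[mu]_x h x + \int[mu]_x h' x.
  by rewrite -RintegralD//; exact/bint/H_bmeas.
have [tt0|tt0] := eqVneq (t + t') 0.
  have [tE t'E] : t = 0 /\ t' = 0 by split; lra.
  exists (h + h'), 0, w; split => //; first exact: HD.
    move=> x; have := uhw x; have := uhw' x.
    by rewrite tE t'E !fctE !mul0r !addr0 => *; exact: lerD.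
  by rewrite intH tE t'E !mulr0 !addr0.
have ttgt0 : 0 < t + t' by rewrite lt_neqAle eq_sym tt0 addr_ge0.
(* With this weight, t w + t' w' is t + t' times a convex combination of [w] and [w'], which is
   again in [exp_bounded]. *)
pose l := t / (t + t').
exists (h + h'), (t + t'), (l *: w + (1 - l) *: w'); split.
- exact: HD.
- exact: addr_ge0.
- apply: (exp_bounded_convex _ Ew Ew'); rewrite divr_ge0 ?addr_ge0//=.
  by rewrite ler_pdivrMr// mul1r lerDl.
- move=> x; rewrite -[(l *: w + _) x]/(l * w x + (1 - l) * w' x).
  have -> : (t + t') * (l * w x + (1 - l) * w' x) = t * w x + t' * w' x.
    by rewrite /l; field.
  by rewrite -[(h + h') x]/(h x + h' x) addrACA lerD.
- by rewrite intH; ring.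
Qed.

Lemma dual_setZ u s a : 0 < a -> dual_set K u s -> dual_set K (a *: u) (a * s).
Proof.
move=> a0 [h [t [w [Hh t0 Ew uhw ->]]]].
exists (a *: h), (a * t), w; split => //.
- exact: HZ.
- by rewrite mulr_ge0// ltW.
- by move=> x; rewrite -mulrA -mulrDr ler_pM2l.
- rewrite (@RintegralZl _ _ _ mu _ h)//; last exact/bint/H_bmeas.
  by ring.
Qed.

Lemma sublinear_dual_norm : sublinear bmeas (dual_norm K).
Proof.
split=> [u v bu bv|].
  rewrite -lerBlDr; apply: lb_le_inf => [|s us]; first exact: ne.
  rewrite lerBlDl -lerBlDr; apply: lb_le_inf => [|s' vs']; first exact: ne.
  rewrite lerBlDr addrC; apply: dual_norm_le; [exact: bmeasD|exact: dual_setD].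
have posZ t u : 0 < t -> bmeas u -> dual_norm K (t *: u) <= t * dual_norm K u.
  move=> t0 bu; rewrite mulrC -ler_pdivrMr//.
  apply: lb_le_inf => [|s us]; first exact: ne.
  rewrite ler_pdivrMr// mulrC; apply: dual_norm_le; first exact: bmeasZ.
  exact: dual_setZ.
move=> t u t0 bu; have [->|tn0] := eqVneq t 0.
  rewrite mul0r; apply/eqP; rewrite eq_le scale0r; apply/andP; split.
    apply: dual_norm_le; first exact: bmeas_cst.
    exists (cst 0), 0, (cst 0); split => //.
    + exact: exp_bounded0.
    + by move=> x; rewrite mul0r addr0.
    + by rewrite int_cst' mulr0 addr0.
  apply: lb_le_inf => [|s us]; first exact/ne/bmeas_cst.
  have := dual_set_lb (bmeas_cst _ 0) us.
  by rewrite int_cst'.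
have tgt0 : 0 < t by rewrite lt_neqAle eq_sym tn0.
apply/eqP; rewrite eq_le posZ//= -ler_pdivlMl//.
rewrite -{1}[u](scalerK tn0); apply: posZ; first by rewrite invr_gt0.
exact: bmeasZ.
Qed.

Let int_abs : forall e : R, 0 < e -> exists2 dlt : R, 0 < dlt & forall B,
  measurable B -> (mu B < dlt%:E)%E -> (\int[mu]_x (om x * \1_B x)%:E <= e%:E)%E.
Proof. exact: int_abs_continuous. Qed.

(** The Hahn-Banach functional attaining the least cost at [g] is positive, since nonpositive
    functions cost at most 0, and agrees with integration on [H], since [h] and [- h] majorise
    themselves without error. Once it is known to be a measure, [dom] bounds its value at [g] by C
    times the integral of [g]. *)
Theorem duality g (e : R) : bmeas g -> (forall x, 0 <= g x) -> 0 < e ->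
  exists h t w, [/\ H h, 0 <= t, exp_bounded w, forall x, g x <= h x + t * w x &
    \int[mu]_x h x + K * t < C * \int[mu]_x g x + e].
Proof.
move=> bg g0 e0.
suff Pg : dual_norm K g <= C * \int[mu]_x g x.
  have := inf_lt (ne bg).
  have : dual_norm K g < C * \int[mu]_x g x + e by rewrite (le_lt_trans Pg)// ltrDl.
  move=> lt_ /(_ _ lt_) [_ [h [t [w [Hh t0 Ew gw ->]]]] lt2].
  by exists h, t, w.
have [L [LP LD LZ Lg]] := hahn_banach (@bmeasD _ T R) (@bmeasZ _ T R) sublinear_dual_norm bg.
have LPf : positive_functional L.
  split => // u bu u0; have bNu : bmeas (-1 *: u) by exact: bmeasZ.
  have : L (-1 *: u) <= 0.
    apply: le_trans (LP _ bNu) _; apply: dual_norm_le => //.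
    exists (cst 0), 0, (cst 0); split => //.
    + exact: exp_bounded0.
    + by move=> x; rewrite mul0r addr0 -[(_ *: _) x]/(_ * _) mulN1r oppr_le0.
    + by rewrite int_cst' mulr0 addr0.
  by rewrite LZ// mulN1r oppr_le0.
have LH h : H h -> L h = \int[mu]_x h x.
  have LHle h' : H h' -> L h' <= \int[mu]_x h' x.
    move=> Hh'; have bh' := H_bmeas Hh'; apply: le_trans (LP _ bh') _.
    apply: dual_norm_le => //; exists h', 0, (cst 0); split => //.
    + exact: exp_bounded0.
    + by move=> x; rewrite mul0r addr0.
    + by rewrite mulr0 addr0.
  move=> Hh; have bh := H_bmeas Hh; apply/eqP; rewrite eq_le LHle//=.
  have := LHle _ (HZ (-1) Hh); rewrite LZ// mulN1r.
  by rewrite (@RintegralZl _ _ _ mu _ h)// ?mulN1r ?lerN2//; exact: bint.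
have Lac (e' : R) : 0 < e' -> exists2 dlt : R, 0 < dlt &
    forall B, measurable B -> (mu B < dlt%:E)%E -> L \1_B <= e'.
  (* An error of size [t] costs [K * t], which is exactly [e']. *)
  move=> e'0; pose t := e' / K; have t0 : 0 < t by rewrite divr_gt0.
  have et : 0 < expR t^-1 - 1 by rewrite subr_gt0 expR_gt1 invr_gt0.
  have [dlt dlt0 Hdlt] := int_abs (divr_gt0 ltr01 et).
  exists dlt => // B mB muB; have b1 := bmeas_indic R mB.
  apply: le_trans (LP _ b1) _; apply: dual_norm_le => //.
  exists (cst 0), t, (t^-1 *: \1_B); split => //.
  + exact: ltW.
  + apply: exp_bounded_indic => //.
    apply: (@le_trans _ _ ((expR t^-1 - 1)%:E * (1 / (expR t^-1 - 1))%:E)%E).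
      by rewrite lee_pmul2l ?lte_fin//; exact: Hdlt.
    by rewrite -EFinM mul1r mulfV// gt_eqF.
  + move=> x; rewrite add0r -[(_ *: _) x]/(_ * _) mulrA mulfV ?mul1r//.
    by rewrite gt_eqF.
  + by rewrite int_cst' add0r /t mulrC divfK// gt_eqF.
have [nu [nuB nuL]] := measure_of_functional LPf Lac.
have nuC : forall B, measurable B -> fine (nu B) <= C * fine (mu B).
  apply: dom => [e' e'0|h Hh].
    have [dlt dlt0 Hdlt] := Lac _ e'0; exists dlt => // B mB muB.
    by rewrite nuB// lee_fin Hdlt.
  by rewrite nuL ?LH//; exact: H_bmeas.
rewrite -Lg -nuL//.
have C0 : 0 <= C.
  have := nuC _ (@measurableT _ T); rewrite mu1 mulr1; apply: le_trans.
  exact: fine_ge0.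
apply: (@pfun_le_indic _ _ _ (fun u => \int[nu]_x u x) (fun u => C * \int[mu]_x u x)) => //.
- exact: positive_functional_integral.
- have P := positive_functional_integral mu; split.
  + by move=> u v bu bv; rewrite (pfunD P)// mulrDr.
  + by move=> a u bu; rewrite (pfunZ P)// mulrCA.
  + by move=> u bu u0; rewrite mulr_ge0// (pfun_ge0 P).
- by move=> B mB; rewrite /Rintegral !integral_indic// !setIT; exact: nuC.
Qed.

End Duality.

(** * Multipliers *)

Section ComplexModulus.
Context (R : realType).
Implicit Types (z w : R[i]) (a : R).

Lemma nrm_sqr z : nrm z ^+ 2 = Re z ^+ 2 + Im z ^+ 2.
Proof. by case: z => x y /=; rewrite sqr_sqrtr// addr_ge0// sqr_ge0. Qed.

Lemma nrm_ge0 z : 0 <= nrm z.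
Proof. by case: z => x y; exact: sqrtr_ge0. Qed.

Lemma nrm1 : nrm (1 : R[i]) = 1.
Proof. exact: Normc.normc1. Qed.

Lemma nrm0 : nrm (0 : R[i]) = 0.
Proof. exact: Normc.normc0. Qed.

Lemma nrmC z : `|z| = (nrm z)%:C%C.
Proof. by []. Qed.

Lemma nrmM z w : nrm (z * w) = nrm z * nrm w.
Proof. exact: Normc.normcM. Qed.

Lemma nrmD z w : nrm (z + w) <= nrm z + nrm w.
Proof. by rewrite -lecR rmorphD -!nrmC ler_normD. Qed.

Lemma nrmN z : nrm (- z) = nrm z.
Proof. by case: z => x y /=; rewrite !sqrrN. Qed.

Lemma nrmB z w : nrm (z - w) <= nrm z + nrm w.
Proof. by rewrite -(nrmN w) nrmD. Qed.

Lemma nrm_distC z w : nrm (z - w) = nrm (w - z).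
Proof. by rewrite -nrmN opprB. Qed.

Lemma nrmX z n : nrm (z ^+ n) = nrm z ^+ n.
Proof.
elim: n => [|n ih]; first by rewrite !expr0 Normc.normc1.
by rewrite !exprS nrmM ih.
Qed.

Lemma nrm_real a : nrm (a%:C%C) = `|a|.
Proof. by rewrite /= expr0n addr0 sqrtr_sqr. Qed.

Lemma Re_le_nrm z : `|Re z| <= nrm z.
Proof.
rewrite -(ler_pXn2r (_ : 0 < 2)%N) ?nnegrE ?nrm_ge0// nrm_sqr.
by rewrite real_normK ?num_real// lerDl sqr_ge0.
Qed.

Lemma Im_le_nrm z : `|Im z| <= nrm z.
Proof.
rewrite -(ler_pXn2r (_ : 0 < 2)%N) ?nnegrE ?nrm_ge0// nrm_sqr.
by rewrite real_normK ?num_real// lerDr sqr_ge0.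
Qed.

Lemma nrm_le_ReIm z : nrm z <= `|Re z| + `|Im z|.
Proof.
rewrite -(ler_pXn2r (_ : 0 < 2)%N) ?nnegrE ?nrm_ge0 ?addr_ge0// nrm_sqr.
rewrite sqrrD !real_normK ?num_real// lerD2r lerDl.
by rewrite mulrn_wge0// mulr_ge0.
Qed.

Lemma cReD z w : Re (z + w) = Re z + Re w. Proof. by case: z; case: w. Qed.
Lemma cImD z w : Im (z + w) = Im z + Im w. Proof. by case: z; case: w. Qed.
Lemma cReM z w : Re (z * w) = Re z * Re w - Im z * Im w.
Proof. by case: z; case: w. Qed.
Lemma cImM z w : Im (z * w) = Re z * Im w + Im z * Re w.
Proof. by case: z => a b; case: w. Qed.
Lemma cReN z : Re (- z) = - Re z. Proof. by case: z. Qed.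
Lemma cImN z : Im (- z) = - Im z. Proof. by case: z. Qed.

Lemma bernoulli (x : R) n : -1 <= x -> 1 + n%:R * x <= (1 + x) ^+ n.
Proof.
move=> x1; elim: n => [|n ih]; first by rewrite mul0r addr0 expr0.
rewrite exprSr; apply: (@le_trans _ _ ((1 + n%:R * x) * (1 + x))).
  rewrite -natr1; have : 0 <= n%:R * (x * x) by rewrite mulr_ge0// -expr2 sqr_ge0.
  by nra.
by rewrite ler_wpM2r//; lra.
Qed.

(* (1 - z/n)^n plays the role of exp(-z) and stays polynomial in z. *)
Lemma nrm_pow_le z (c : R) n : nrm z ^+ 2 <= c -> (0 < n)%N ->
  nrm ((1 - (n%:R^-1)%:C%C * z) ^+ n) <= expR (- Re z + c / (2 * n%:R)).
Proof.
move=> zc n0; have n0' : 0 < n%:R :> R by rewrite ltr0n.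
have n0'' : n%:R != 0 :> R by rewrite gt_eqF.
(* [y] is the wanted exponent divided by [n]: the squared modulus of 1 - z/n is at most 1 + 2y,
   hence at most exp(2y). *)
pose y := - (Re z / n%:R) + c / (2 * n%:R ^+ 2).
have -> : - Re z + c / (2 * n%:R) = n%:R * y by rewrite /y; field.
rewrite expRM_natl nrmX lerXn2r ?nnegrE ?nrm_ge0 ?expR_ge0//.
rewrite -(ler_pXn2r (_ : 0 < 2)%N) ?nnegrE ?nrm_ge0 ?expR_ge0//.
rewrite -expRM_natl; apply: le_trans (expR_ge1Dx _).
have -> : nrm (1 - (n%:R^-1)%:C%C * z) ^+ 2 =
    1 - 2 * (Re z / n%:R) + nrm z ^+ 2 / n%:R ^+ 2.
  rewrite !nrm_sqr cReD cImD cReN cImN cReM cImM /= !mul0r subr0 addr0 sub0r.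
  by field.
have -> : 2 * y = - (2 * (Re z / n%:R)) + c / n%:R ^+ 2 by rewrite /y; field.
by rewrite addrA lerD2l ler_wpM2r// invr_ge0 sqr_ge0.
Qed.

End ComplexModulus.

(** * A single multiplier from the duality *)

Section Step.
Context d (T : measurableType d) (R : realType).
Variable mu : {finite_measure set T -> \bar R}.

Local Notation mfun f := (measurable_fun [set: T] f).

(* [C] bounds the densities of the absolutely continuous representing measures. *)
Record dominating_algebra (A : set (T -> R[i])) (C : R) : Prop := {
  alg_bmeas : forall a, A a -> bmeas (fun x => Re (a x)) /\ bmeas (fun x => Im (a x));
  alg_cst : forall c : R[i], A (cst c);
  algD : forall a b, A a -> A b -> A (a \+ b);
  algM : forall a b, A a -> A b -> A (a \* b);
  alg_integralM : forall a b, A a -> A b ->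
    \int[mu]_x Re (a x * b x) = \int[mu]_x Re (a x) * \int[mu]_x Re (b x)
      - \int[mu]_x Im (a x) * \int[mu]_x Im (b x) /\
    \int[mu]_x Im (a x * b x) = \int[mu]_x Re (a x) * \int[mu]_x Im (b x)
      + \int[mu]_x Im (a x) * \int[mu]_x Re (b x);
  alg_mass : mu setT = 1%E;
  alg_dom : forall nu : {finite_measure set T -> \bar R},
    (forall e : R, 0 < e -> exists2 dlt : R, 0 < dlt & forall B, measurable B ->
      (mu B < dlt%:E)%E -> (nu B <= e%:E)%E) ->
    (forall a, A a -> \int[nu]_x Re (a x) = \int[mu]_x Re (a x)) ->
    forall B, measurable B -> fine (nu B) <= C * fine (mu B) }.

Variables (A : set (T -> R[i])) (C : R).
Hypothesis AC : dominating_algebra A C.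

Lemma algZ c a : A a -> A (c \*o a).
Proof. by move=> Aa; exact: (algM AC (alg_cst AC c) Aa). Qed.

Lemma alg_pow a n : A a -> A (fun x => a x ^+ n).
Proof.
move=> Aa; elim: n => [|n ih].
  by rewrite (_ : (fun x => _) = cst 1)//; exact: (alg_cst AC).
rewrite (_ : (fun x => _) = a \* (fun x => a x ^+ n)); first exact: (algM AC).
by apply/funext => x; rewrite exprS.
Qed.

Lemma alg_dom_ge0 : 0 <= C.
Proof.
have := alg_dom AC (nu := mu) _ (fun _ _ => erefl) (@measurableT _ T).
rewrite -[X in fine X]/(mu setT) (alg_mass AC) mulr1 => h.
apply: le_trans ler01 _; apply: h => e e0; exists e => // B _; exact: ltW.
Qed.

Let int1 (c : R) : \int[mu]_x c = c.
Proof. by rewrite Rintegral_cst// -[X in fine X]/(mu setT) (alg_mass AC) mulr1. Qed.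

Lemma alg_integralX a n : A a -> \int[mu]_x Im (a x) = 0 ->
  \int[mu]_x Re (a x ^+ n) = (\int[mu]_x Re (a x)) ^+ n /\
  \int[mu]_x Im (a x ^+ n) = 0.
Proof.
move=> Aa a0; elim: n => [|n [ih1 ih2]].
  by rewrite !expr0; split; exact: int1.
have [h1 h2] := alg_integralM AC Aa (alg_pow n Aa).
under eq_Rintegral do rewrite exprS.
under [in X in _ /\ X]eq_Rintegral do rewrite exprS.
by rewrite h1 h2 a0 ih1 ih2 exprS !mul0r mulr0 subr0 addr0.
Qed.

(** Here [H] consists of the real parts of [A]. Comparing the lower bound, taken at the smallest
    admissible rate [exp_bound], with the upper bound leaves K - exp_bound times [t] below the
    right-hand side: a large [K] forces a small [t]. *)
Lemma alg_duality (om g : T -> R) (K e : R) : mfun om -> (forall x, 1 <= om x) ->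
  (\int[mu]_x (om x)%:E < +oo)%E -> exp_bound mu om <= K ->
  bmeas g -> (forall x, 0 <= g x) -> 0 < e ->
  exists b t w, [/\ A b, 0 <= t, exp_bounded mu om w,
    forall x, g x <= Re (b x) + t * w x &
    [/\ \int[mu]_x Im (b x) = 0, 0 <= \int[mu]_x Re (b x) + exp_bound mu om * t &
    \int[mu]_x Re (b x) + K * t < C * \int[mu]_x g x + e]].
Proof.
move=> mom om1 om_fin KD bg g0 e0.
pose H := [set u : T -> R | exists2 a, A a & u = (fun x => Re (a x))].
have Hb : H `<=` bmeas by move=> _ [a Aa ->]; exact: (alg_bmeas AC Aa).1.
have Hc c : H (cst c) by exists (cst c%:C%C) => //; exact: alg_cst AC _.
have HD u v : H u -> H v -> H (u + v).
  move=> [a Aa ->] [b Ab ->]; exists (a \+ b); first exact: (algD AC).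
  by apply/funext => x; rewrite /= cReD.
have HZ a u : H u -> H (a *: u).
  move=> [b Ab ->]; exists (a%:C%C \*o b); first exact: algZ.
  by apply/funext => x; rewrite /= cReM /= mul0r subr0.
have Hdom (nu : {finite_measure set T -> \bar R}) :
    (forall e : R, 0 < e -> exists2 dlt : R, 0 < dlt & forall B, measurable B ->
      (mu B < dlt%:E)%E -> (nu B <= e%:E)%E) ->
    (forall h, H h -> \int[nu]_x h x = \int[mu]_x h x) ->
    forall B, measurable B -> fine (nu B) <= C * fine (mu B).
  move=> nuac nuH; apply: (alg_dom AC) => // a Aa.
  by apply: (nuH (fun x => Re (a x))); exists a.
have [_ [t [w [[b Ab ->] t0 Ew gw lt]]]] :=
  duality (alg_mass AC) Hb Hc HD HZ Hdom mom om1 om_fin KD bg g0 e0.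
pose c := \int[mu]_x Im (b x).
(* Subtracting an imaginary constant makes the integral of [b'] real, so that the integrals of
   powers of 1 - b'/N are powers of a real number. *)
pose b' := b \+ cst (0 +i* (- c))%C.
have Re_b' x : Re (b' x) = Re (b x) by rewrite /b' /= cReD /= addr0.
have Ab' : A b' by apply: (algD AC) => //; exact: (alg_cst AC).
have Hlb : dual_set mu H om (exp_bound mu om) g
    (\int[mu]_x Re (b x) + exp_bound mu om * t).
  by exists (fun x => Re (b x)), t, w; split => //; exists b.
exists b', t, w; split; [exact: Ab'|exact: t0|exact: Ew| |].
  by move=> x; rewrite Re_b'.
have -> : \int[mu]_x Re (b' x) = \int[mu]_x Re (b x).
  by apply: eq_Rintegral => x _; exact: Re_b'.
split.
- under eq_Rintegral do rewrite cImD /=.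
  rewrite RintegralD//; [|exact/bmeas_integrable/(alg_bmeas AC Ab).2|].
    by rewrite int1 subrr.
  exact/bmeas_integrable/bmeas_cst.
- have := dual_set_lb Hb mom om1 (lexx _) bg Hlb.
  by apply: le_trans; exact: Rintegral_ge0.
- exact: lt.
Qed.

(** [E] is (1 - b/N)^N. Multiplicativity of the integral on [A] gives it the integral (1 -
    beta/N)^N, at least 1 - beta by Bernoulli, where beta is the integral of [b]. Its modulus is at
    most exp(-Re b + c/(2N)), and the defect of [Re b] below [g] is absorbed into [r]. *)
Theorem multiplier_step (om g : T -> R) (tau e : R) : mfun om -> (forall x, 1 <= om x) ->
  (\int[mu]_x (om x)%:E < +oo)%E -> bmeas g -> (forall x, 0 <= g x) ->
  0 < tau -> 0 < e ->
  exists (E : T -> R[i]) (r : T -> R), [/\ A E, bmeas r, forall x, 0 <= r x,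
    forall x, nrm (E x) <= expR (r x - g x) &
    (\int[mu]_x (expR (r x / tau) * om x)%:E <= (expR 1 * exp_bound mu om)%:E)%E /\
    1 - C * \int[mu]_x g x - e <= \int[mu]_x Re (E x)].
Proof.
move=> mom om1 om_fin bg g0 tau0 e0.
have Cg0 : 0 <= C * \int[mu]_x g x.
  by rewrite mulr_ge0 ?alg_dom_ge0//; exact: Rintegral_ge0.
set D := exp_bound mu om.
(* This rate is the one that forces [t <= tau]. *)
pose K := D + (C * \int[mu]_x g x + e) / tau.
have KD : D <= K by rewrite lerDl divr_ge0 ?ltW// ltr_wpDl.
have [b [t [w [Ab t0 Ew gw [b0 lb ub]]]]] :=
  alg_duality mom om1 om_fin KD bg g0 e0.
have om0 x : 0 <= om x by exact: le_trans (om1 x).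
have D0 : 0 < D by rewrite ltr_wpDl//; exact: Rintegral_ge0.
have tt : t <= tau.
  have : (C * \int[mu]_x g x + e) / tau * t <= C * \int[mu]_x g x + e.
    by move: ub lb; rewrite /K -/D mulrDl; lra.
  by rewrite mulrAC ler_pdivrMr// ler_pM2l// ltr_wpDl.
have beta_ub : \int[mu]_x Re (b x) < C * \int[mu]_x g x + e.
  by apply: le_lt_trans ub; rewrite lerDl mulr_ge0// (le_trans _ KD)// ltW.
set beta := \int[mu]_x Re (b x) in beta_ub.
have [[mRb [c1 hc1]] [mIb [c2 hc2]]] := alg_bmeas AC Ab.
pose c := (c1 + c2) ^+ 2.
have bc x : nrm (b x) ^+ 2 <= c.
  have h : nrm (b x) <= c1 + c2.
    by apply: le_trans (nrm_le_ReIm _) _; apply: lerD; [exact: hc1|exact: hc2].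
  by rewrite lerXn2r ?nnegrE ?nrm_ge0// (le_trans _ h)// nrm_ge0.
have c0 : 0 <= c by exact: sqr_ge0.
(* The term |beta| is for Bernoulli's inequality. The other keeps c/(2N) below [tau], so that r/tau
   <= w + 1; this is the origin of the factor [expR 1] in the conclusion. *)
pose N := (Num.truncn (`|beta| + c / (2 * tau))).+1.
have N0 : 0 < N%:R :> R by rewrite ltr0n.
have hN : `|beta| + c / (2 * tau) < N%:R by exact: truncnS_gt.
have hN1 : `|beta| <= N%:R.
  by apply: ltW; apply: le_lt_trans hN; rewrite lerDl divr_ge0// mulr_ge0// ltW.
have hN2 : c / (2 * N%:R) <= tau.
  have : c / (2 * tau) <= N%:R by apply: ltW; apply: le_lt_trans hN; rewrite lerDr.
  by rewrite !ler_pdivrMr ?mulr_gt0//; lra.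
pose u x := 1 - (N%:R^-1)%:C%C * b x.
have Au : A u.
  rewrite (_ : u = cst 1 \+ ((- (N%:R^-1)%:C%C) \*o b)).
    by apply: (algD AC); [exact: (alg_cst AC)|exact: algZ].
  by apply/funext => x; rewrite /u /= mulNr.
have intu : \int[mu]_x Re (u x) = 1 - beta / N%:R.
  under eq_Rintegral do rewrite /u cReD cReN cReM /= mul0r subr0.
  rewrite (@RintegralB _ _ _ mu _ (cst 1)) ?int1//.
  - rewrite (@RintegralZl _ _ _ mu _ (fun x => Re (b x)))// ?[_ * beta]mulrC//.
    exact: bmeas_integrable (alg_bmeas AC Ab).1.
  - exact/bmeas_integrable/bmeas_cst.
  - exact: bmeas_integrable (bmeasZ _ (alg_bmeas AC Ab).1).
have intIu : \int[mu]_x Im (u x) = 0.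
  under eq_Rintegral do rewrite /u cImD cImN cImM /= mul0r addr0 add0r -mulNr.
  rewrite (@RintegralZl _ _ _ mu _ (fun x => Im (b x)))// ?b0 ?mulr0//.
  exact: bmeas_integrable (alg_bmeas AC Ab).2.
pose r0 x := Num.max (g x - Re (b x)) 0.
pose r x := r0 x + c / (2 * N%:R).
have eta0 : 0 <= c / (2 * N%:R) by rewrite divr_ge0// mulr_ge0// ltW.
have r00 x : 0 <= r0 x by rewrite /r0 le_max lexx orbT.
have r0g x : g x - Re (b x) <= r0 x by rewrite /r0 le_max lexx.
have r0w x : r0 x <= tau * w x.
  have w0 : 0 <= w x by have [_ + _] := Ew.
  have tw0 : 0 <= tau * w x by rewrite mulr_ge0// ltW.
  rewrite /r0 ge_max tw0 andbT lerBlDl (le_trans (gw x))//.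
  by rewrite lerD2l ler_wpM2r.
have [mg [c3 hc3]] := bg.
have mr : mfun r.
  apply: measurable_funD => //; apply: measurable_maxr => //.
  exact: measurable_funB.
exists (fun x => u x ^+ N), r; split.
- exact: alg_pow.
- split => //; exists (c3 + c1 + c / (2 * N%:R)) => x.
  rewrite ger0_norm ?addr_ge0// lerD2r /r0 ge_max.
  have := hc3 x; have := hc1 x; rewrite !ler_norml => /andP[h1 h2] /andP[h3 h4].
  by apply/andP; split; lra.
- by move=> x; rewrite addr_ge0.
- move=> x; apply: le_trans (nrm_pow_le (n:=N) (bc x) isT) _.
  by rewrite ler_expR /r; have := r0g x; lra.
split; last first.
  rewrite (alg_integralX _ Au intIu).1 intu.
  apply: (@le_trans _ _ (1 - beta)); first by rewrite -addrA -opprD lerD2l lerN2 ltW.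
  have -> : 1 - beta = 1 + N%:R * (- (beta / N%:R)) by field; rewrite gt_eqF.
  apply: bernoulli; rewrite lerN2 ler_pdivrMr// mul1r.
  exact: le_trans (ler_norm _) hN1.
have [mw w0 Iw] := Ew.
have m_exp f : mfun f -> mfun (fun x => expR (f x) * om x).
  by move=> mf; apply: measurable_funM => //; exact: measurableT_comp.
apply: (@le_trans _ _ (\int[mu]_x (expR 1 * (expR (w x) * om x))%:E)%E).
  apply: int_le => [||x|x].
  - by apply: (m_exp (fun x => r x / tau)); exact: measurable_funM.
  - by apply: measurable_funM => //; exact: m_exp.
  - by rewrite mulr_ge0// expR_ge0.
  - rewrite mulrA -expRD ler_wpM2r// ler_expR ler_pdivrMr// mulrDl mul1r /r.
    by rewrite addrC [w x * tau]mulrC lerD.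
rewrite intZ ?expR_ge0//; last 2 first.
- exact: m_exp.
- by move=> x; rewrite mulr_ge0// expR_ge0.
by rewrite EFinM lee_wpmul2l// lee_fin expR_ge0.
Qed.

End Step.

Section ComplexMeasurable.
Context d (T : measurableType d) (R : realType).
Implicit Types f g : T -> R[i].

Local Notation mfun f := (measurable_fun [set: T] f).

Definition cmeas : set (T -> R[i]) :=
  [set f | mfun (fun x => Re (f x)) /\ mfun (fun x => Im (f x))].

Lemma cmeas_cst c : cmeas (cst c).
Proof. by split; exact: measurable_cst. Qed.

Lemma cmeasD f g : cmeas f -> cmeas g -> cmeas (fun x => f x + g x).
Proof.
move=> [f1 f2] [g1 g2]; split.
- by under eq_fun do rewrite cReD; exact: measurable_funD.
- by under eq_fun do rewrite cImD; exact: measurable_funD.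
Qed.

Lemma cmeasM f g : cmeas f -> cmeas g -> cmeas (fun x => f x * g x).
Proof.
move=> [f1 f2] [g1 g2]; split.
- by under eq_fun do rewrite cReM; apply: measurable_funB; exact: measurable_funM.
- by under eq_fun do rewrite cImM; apply: measurable_funD; exact: measurable_funM.
Qed.

Lemma cmeasB f g : cmeas f -> cmeas g -> cmeas (fun x => f x - g x).
Proof.
move=> [f1 f2] [g1 g2]; split.
- by under eq_fun do rewrite cReD cReN; exact: measurable_funB.
- by under eq_fun do rewrite cImD cImN; exact: measurable_funB.
Qed.

Lemma cmeas_nrm f : cmeas f -> mfun (fun x => nrm (f x)).
Proof.
move=> [f1 f2].
have -> : (fun x => nrm (f x)) = Num.sqrt \o (fun x => Re (f x) ^+ 2 + Im (f x) ^+ 2).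
  by apply/funext => x /=; case: (f x).
apply: measurableT_comp.
  by apply: continuous_measurable_fun; exact: sqrt_continuous.
by apply: measurable_funD; exact: measurable_funX.
Qed.

End ComplexMeasurable.
Arguments cmeas {d T R}.

Lemma geometric_half_le (R : realType) n : \sum_(i < n) (2^-1 : R) ^+ i <= 2.
Proof.
suff -> : \sum_(i < n) (2^-1 : R) ^+ i = 2 - 2 * 2^-1 ^+ n.
  by rewrite lerBlDr lerDl mulr_ge0// exprn_ge0// invr_ge0.
elim: n => [|n ih]; first by rewrite big_ord0 expr0; lra.
by rewrite big_ord_recr /= ih exprS; lra.
Qed.

Lemma expR_scale_le (R : realType) (l y : R) : 0 <= l <= 1 ->
  expR (l * y) - 1 <= l * (expR y - 1).
Proof.
move=> l01; have := expR_convex y 0 l01.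
by rewrite mulr0 addr0 expR0; lra.
Qed.

Section SeriesToZero.
Context d (T : measurableType d) (R : realType).
Variable mu : {finite_measure set T -> \bar R}.
Local Notation mfun f := (measurable_fun [set: T] f).

Lemma int_series_cvg0 (u : nat -> T -> R) (c : nat -> R) (C : R) :
  (forall n, mfun (u n)) -> (forall n x, 0 <= u n x) ->
  (forall n, (\int[mu]_x (u n x)%:E <= (c n)%:E)%E) ->
  (forall n, \sum_(i < n) c i <= C) ->
  {ae mu, forall x, u ^~ x @ \oo --> (0 : R)}.
Proof.
move=> mu_ u0 uc cC.
have [S [_ _ _]] := int_series mu_ u0 uc cC.
apply: filterS => x h; apply: cvg_series_cvg_0.
apply: nondecreasing_is_cvgn.
  by apply: (@nondecreasing_series R (u^~ x) xpredT 0) => n _ _.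
by exists (S x) => _ [n _ <-]; have := h n; rewrite -(big_mkord xpredT (u^~ x)).
Qed.

End SeriesToZero.

(** * Products of multipliers *)

Section Multipliers.
Context d (T : measurableType d) (R : realType).
Variables (mu : {finite_measure set T -> \bar R}) (A : set (T -> R[i])) (C : R).
Hypothesis AC : dominating_algebra mu A C.
Local Notation mfun f := (measurable_fun [set: T] f).

Lemma alg_cmeas a : A a -> cmeas a.
Proof. by move=> /(alg_bmeas AC)[[]] ? ? []. Qed.

Let int1 (c : R) : \int[mu]_x c = c.
Proof. by rewrite Rintegral_cst// -[X in fine X]/(mu setT) (alg_mass AC) mulr1. Qed.

Variables (om : T -> R) (la : R).
Hypotheses (mom : mfun om) (om1 : forall x, 1 <= om x).
Hypotheses (om_fin : (\int[mu]_x (om x)%:E < +oo)%E) (la0 : 0 < la).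

Let om0 x : 0 <= om x. Proof. exact: le_trans (om1 x). Qed.

Let B := expR 1 * exp_bound mu om.

Let D1 : 1 <= exp_bound mu om.
Proof. by rewrite lerDr; exact: Rintegral_ge0. Qed.

Let B1 : 1 <= B.
Proof. by rewrite -[1]mulr1 ler_pM// -expR0 ler_expR. Qed.

Let B0 : 0 < B. Proof. exact: lt_le_trans B1. Qed.

Let m_exp (w : T -> R) : mfun w -> mfun (fun x => expR (w x) * om x).
Proof.
by move=> mw; apply: measurable_funM => //; exact: measurableT_comp.
Qed.

Section ExpSmall.
Variables (r : T -> R) (tau : R).
Hypotheses (br : bmeas r) (r0 : forall x, 0 <= r x) (tau0 : 0 < tau).
Hypothesis rB : (\int[mu]_x (expR (r x / tau) * om x)%:E <= B%:E)%E.

Let mr : mfun (fun x => expR (r x / tau) * om x).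
Proof. by apply: (m_exp (w := fun x => r x / tau)); apply: measurable_funM => //; case: br. Qed.

Let r'0 x : 0 <= expR (r x / tau) * om x.
Proof. by rewrite mulr_ge0// expR_ge0. Qed.

Lemma exp_small_int : (\int[mu]_x (r x)%:E <= (tau * B)%:E)%E.
Proof.
have [mr' _] := br.
apply: (@le_trans _ _ (\int[mu]_x (tau * (expR (r x / tau) * om x))%:E)%E).
  apply: int_le => // [|x]; first exact: measurable_funM.
  rewrite -ler_pdivrMl// mulrC; apply: (@le_trans _ _ (expR (r x / tau))).
    by apply: le_trans (expR_ge1Dx _); rewrite lerDr.
  by rewrite ler_peMr// expR_ge0.
have t0 := ltW tau0.
by rewrite intZ// [in leRHS]EFinM; apply: lee_wpmul2l.
Qed.

(** Convexity of exp between 0 and r/tau: because l tau <= 1, exp(l r) - 1 is at most l tau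
    exp(r/tau). *)
Lemma exp_small_power l : 0 < l -> l * tau <= 1 ->
  (\int[mu]_x ((expR (l * r x) - 1) * om x)%:E <= (l * tau * B)%:E)%E.
Proof.
move=> l0 ltau; have [mr' _] := br.
apply: (@le_trans _ _ (\int[mu]_x (l * tau * (expR (r x / tau) * om x))%:E)%E).
  apply: int_le => [||x|x].
  - apply: measurable_funM => //; apply: measurable_funB => //.
    by apply: measurableT_comp => //; exact: measurable_funM.
  - exact: measurable_funM.
  - by rewrite mulr_ge0// subr_ge0 -expR0 ler_expR mulr_ge0// ltW.
  - rewrite mulrA ler_wpM2r//.
    have -> : l * r x = l * tau * (r x / tau).
      by field; rewrite gt_eqF.
    apply: le_trans (expR_scale_le _ _) _; first by rewrite ltau mulr_ge0// ltW.
    by apply: ler_wpM2l; [rewrite mulr_ge0// ltW|rewrite lerBlDr lerDl].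
have lt0 : 0 <= l * tau by rewrite mulr_ge0// ltW.
by rewrite intZ// [in leRHS]EFinM; apply: lee_wpmul2l.
Qed.

Lemma exp_small_sqr : 2 * tau <= 1 ->
  (\int[mu]_x (expR (r x) ^+ 2)%:E <= B%:E)%E.
Proof.
move=> tau1; have [mr' _] := br; apply: le_trans rB; apply: int_le => //.
- by apply: measurable_funX; exact: measurableT_comp.
- move=> x; apply: (@le_trans _ _ (expR (r x / tau))).
    rewrite -expRM_natl ler_expR ler_pdivlMr// mulrAC.
    by rewrite ler_piMl.
  by rewrite ler_peMr// expR_ge0.
Qed.

(** Expand |1 - E|^2 = 1 - 2 Re E + |E|^2 and replace |E|^2 by exp(2r): a modulus hardly above 1
    together with a mean near 1 forces [E] to be near 1 in L^2. *)
Lemma exp_small_dist E : A E -> 2 * tau <= 1 -> (forall x, nrm (E x) <= expR (r x)) ->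
  (\int[mu]_x (nrm (1 - E x) ^+ 2)%:E <= (2 * (1 - \int[mu]_x Re (E x)) + 2 * tau * B)%:E)%E.
Proof.
move=> AE tau1 Er; have [mr' _] := br.
have mE := alg_cmeas AE.
have m1E : mfun (fun x => nrm (1 - E x) ^+ 2).
  by apply: measurable_funX; apply: cmeas_nrm; apply: cmeasB => //; exact: cmeas_cst.
pose f1 x := 2 * (1 - Re (E x)).
pose f2 x := (expR (2 * r x) - 1) * om x.
have pointwise x : nrm (1 - E x) ^+ 2 <= f1 x + f2 x.
  rewrite nrm_sqr cReD cImD cReN cImN /= sub0r.
  have := nrm_sqr (E x); have : nrm (E x) ^+ 2 <= expR (2 * r x).
    by rewrite expRM_natl lerXn2r ?nnegrE ?nrm_ge0 ?expR_ge0.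
  have : expR (2 * r x) - 1 <= f2 x.
    by rewrite ler_peMr// subr_ge0 -expR0 ler_expR mulr_ge0.
  rewrite /f1; set y := f2 x; set z := expR _; lra.
have f20 x : 0 <= f2 x.
  by rewrite mulr_ge0// subr_ge0 -expR0 ler_expR mulr_ge0.
have mf2 : mfun f2.
  apply: measurable_funM => //; apply: measurable_funB => //.
  by apply: measurableT_comp => //; exact: measurable_funM.
have If2 : (\int[mu]_x (f2 x)%:E <= (2 * tau * B)%:E)%E.
  by apply: exp_small_power.
have if2 := int_integrable mf2 f20 (le_lt_trans If2 (ltry _)).
have bE : bmeas (fun x => Re (E x)) := (alg_bmeas AC AE).1.
have b1E : bmeas (fun x => 1 - Re (E x)).
  by apply: (bmeasB (bmeas_cst T (1 : R)) bE).
have bf1 : bmeas f1 by exact: (bmeasZ 2 b1E).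
have if1 : mu.-integrable setT (EFin \o f1) by exact: bmeas_integrable.
have i12 := integrableD measurableT if1 if2.
apply: (@le_trans _ _ (\int[mu]_x (f1 x + f2 x)%:E)%E).
  apply: int_le => //; first by case: i12 => /measurable_int /measurable_EFinP.
  by move=> x; exact: sqr_ge0.
rewrite [X in (X <= _)%E](_ : _ = \int[mu]_x (f1 x)%:E + \int[mu]_x (f2 x)%:E)%E; last first.
  by rewrite -integralD_EFin.
rewrite EFinD leeD//.
rewrite -(fineK (integrable_fin_num measurableT if1)) lee_fin.
rewrite -[X in X <= _]/(\int[mu]_x f1 x) /f1.
rewrite (@RintegralZl _ _ _ mu _ (fun x => 1 - Re (E x)))//; last exact: bmeas_integrable.
rewrite (@RintegralB _ _ _ mu _ (cst 1))//.
- by rewrite int1.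
- by apply: bmeas_integrable; exact: bmeas_cst.
- exact: bmeas_integrable.
Qed.

End ExpSmall.

Let state := ((T -> R[i]) * (T -> R))%type.

(* The n-th factor makes up for the next truncation of [F] and for the error
   [r n] left by the previous factors, so that only the last error remains. *)
Lemma multiplier_chain (F : T -> R) (rho : nat -> R) : mfun F ->
  (forall x, 0 <= F x) -> (\int[mu]_x (F x)%:E < (rho 0%N)%:E)%E ->
  (forall n, 0 < rho n <= 1) -> (forall n, rho n.+1 <= rho n) ->
  exists (a : nat -> T -> R[i]) (r : nat -> T -> R) (M : nat -> nat),
  let tau n := rho n / (B * (la + 2)) in
  [/\ a 0%N = cst 1, forall n, A (a n), forall n, bmeas (r n) /\ forall x, 0 <= r n x,
    forall n, (\int[mu]_x (expR (r n x / tau n) * om x)%:E <= B%:E)%E &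
    [/\ forall n x, nrm (a n x) <= expR (r n x - Num.min (F x) (M n)%:R),
      forall n, (\int[mu]_x (F x - Num.min (F x) (M n)%:R)%:E <= (rho n)%:E)%E &
      forall n, exists E, [/\ A E, forall x, a n.+1 x = a n x * E x &
       (\int[mu]_x (nrm (1 - E x) ^+ 2)%:E <= (4 * (1 + C) * rho n)%:E)%E]]].
Proof.
move=> mF F0 IF rho01 rhoS.
have rho0 n : 0 < rho n by have /andP[] := rho01 n.
have rho1 n : rho n <= 1 by have /andP[] := rho01 n.
(* One scale for three needs: tau B <= rho for the integral of [r], and 2 tau <= 1 and la tau <= 1
   for the powers 2 and [la] of exp(r). *)
pose tau n := rho n / (B * (la + 2)).
have la2 : 0 < la + 2 by rewrite addr_gt0.
have Bla0 : 0 < B * (la + 2) by rewrite mulr_gt0.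
have tau0 n : 0 < tau n by rewrite divr_gt0.
have tauB n : tau n * B <= rho n.
  rewrite /tau mulrAC ler_pdivrMr// ler_pM2l//.
  by apply: ler_peMr; [exact: ltW|move: la0; lra].
have tau2 n : 2 * tau n <= 1.
  rewrite /tau mulrA ler_pdivrMr// mul1r.
  apply: (@le_trans _ _ 2); first by rewrite ler_piMr.
  by apply: (@le_trans _ _ (la + 2)); [rewrite lerDr ltW|rewrite ler_peMl// ltW].
(* The level 0 at index 0 makes the first truncation vanish, as the initial term [a 0 = 1]
   requires. *)
have [M0 HM0] : exists M : nat -> nat, M 0%N = 0%N /\ forall n,
    (\int[mu]_x (F x - Num.min (F x) (M n)%:R)%:E <= (rho n)%:E)%E.
  have Fy : (\int[mu]_x (F x)%:E < +oo)%E by exact: lt_trans IF (ltry _).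
  have /choice[M HM] : forall n, exists k : nat,
      (\int[mu]_x (F x - Num.min (F x) k%:R)%:E < (rho n)%:E)%E.
    by move=> n; exact: int_trunc_small.
  exists (fun n => if n is 0%N then 0%N else M n); split => // -[|n].
    apply/ltW; apply: le_lt_trans IF; apply: int_le => // [|x|x].
    - by apply: measurable_funB => //; exact: measurable_minr.
    - by rewrite subr_ge0 ge_min lexx.
    - by rewrite gerBl le_min F0 ler0n.
  exact: ltW.
case: HM0 => M00 HM0.
(* The levels [M0 n] need not increase; the positive part keeps the increment nonnegative, as the
   step requires. *)
pose pd n x := Num.max (Num.min (F x) (M0 n.+1)%:R - Num.min (F x) (M0 n)%:R) 0.
have bmin n : bmeas (fun x => Num.min (F x) (M0 n)%:R).
  split; first exact: measurable_minr.
  exists (M0 n)%:R => x; rewrite ger0_norm ?ge_min ?lexx ?orbT//.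
  by rewrite le_min F0 ler0n.
have mpd n : mfun (pd n).
  apply: measurable_maxr => //; apply: measurable_funB.
    by case: (bmin n.+1).
  by case: (bmin n).
have pd0 n x : 0 <= pd n x by rewrite /pd le_max lexx orbT.
have pdF n x : pd n x <= F x - Num.min (F x) (M0 n)%:R.
  rewrite /pd ge_max subr_ge0 ge_min lexx andbT /= lerB//.
  by rewrite ge_min lexx.
have bpd n : bmeas (pd n).
  split => //; exists (M0 n.+1)%:R => x; rewrite ger0_norm// /pd ge_max ler0n andbT.
  apply: (@le_trans _ _ (Num.min (F x) (M0 n.+1)%:R)).
    by rewrite gerBl le_min F0 ler0n.
  by rewrite ge_min lexx orbT.
(* The conditions on the old error stay inside the existential, so that choice yields a total
   function of the index and of that error; the pair of zero functions is a dummy value. *)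
have step : forall ns : nat * (T -> R), exists Er : state,
    bmeas ns.2 -> (forall x, 0 <= ns.2 x) ->
    [/\ A Er.1, bmeas Er.2, forall x, 0 <= Er.2 x,
      forall x, nrm (Er.1 x) <= expR (Er.2 x - (pd ns.1 x + ns.2 x)) &
      (\int[mu]_x (expR (Er.2 x / tau ns.1.+1) * om x)%:E <= B%:E)%E /\
      1 - C * \int[mu]_x (pd ns.1 x + ns.2 x) - rho ns.1 <= \int[mu]_x Re (Er.1 x)].
  move=> [n r]; have [br|nbr] := pselect (bmeas r); last by exists (cst 0, cst 0).
  have [r0|nr0] := pselect (forall x, 0 <= r x); last by exists (cst 0, cst 0).
  have bg : bmeas (fun x => pd n x + r x) by exact: (bmeasD (bpd n) br).
  have g0 x : 0 <= pd n x + r x by rewrite addr_ge0.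
  have [E [r' [AE br' r'0 Er' [h1 h2]]]] :=
    multiplier_step AC mom om1 om_fin bg g0 (tau0 n.+1) (rho0 n).
  by exists (E, r') => _ _.
have {step}[step Hstep] := choice step.
pose st := fix st n : state := match n with
  | 0%N => (cst 1, cst 0)
  | n.+1 => let s := st n in let Er := step (n, s.2) in
            ((fun x => s.1 x * Er.1 x), Er.2) end.
have st_r n : bmeas (st n).2 /\ forall x, 0 <= (st n).2 x.
  elim: n => [|n [br r0]]; first by split => //; exact: bmeas_cst.
  by have [] := Hstep (n, (st n).2) br r0.
have st_step n := Hstep (n, (st n).2) (st_r n).1 (st_r n).2.
have st_B n : (\int[mu]_x (expR ((st n).2 x / tau n) * om x)%:E <= B%:E)%E.
  case: n => [|n]; last by have [_ _ _ _ []] := st_step n.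
  under eq_integral do rewrite /= mul0r expR0 mul1r.
  rewrite intE// lee_fin; apply: (@le_trans _ _ (exp_bound mu om)); first by rewrite lerDl.
  by rewrite ler_peMl ?(le_trans ler01)// -expR0 ler_expR.
exists (fun n => (st n).1), (fun n => (st n).2), M0; split => //.
- elim => [|n ih]; first exact: (alg_cst AC).
  by apply: (algM AC ih); have [] := st_step n.
split => // [n x|n].
- elim: n => [|n ih].
    rewrite M00 -[(st 0%N).1 x]/(1 : R[i]) nrm1 -expR0 ler_expR subr_ge0.
    by rewrite ge_min lexx orbT.
  have [_ _ _ h _] := st_step n.
  (* In the exponent, the old error cancels against the copy of it built into the new factor. *)
  rewrite -[(st n.+1).1 x]/((st n).1 x * (step (n, (st n).2)).1 x) nrmM.
  apply: le_trans (ler_pM (nrm_ge0 _) (nrm_ge0 _) ih (h x)) _.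
  rewrite -expRD ler_expR /=.
  have : Num.min (F x) (M0 n.+1)%:R - Num.min (F x) (M0 n)%:R <= pd n x.
    by rewrite /pd le_max lexx.
  by lra.
have [AE br' r'0 h [hB hRe]] := st_step n.
exists (step (n, (st n).2)).1; split => //.
have [br r0] := st_r n.
have tB1 : tau n.+1 * B <= rho n by rewrite (le_trans (tauB _)).
apply: le_trans (exp_small_dist br' r'0 (tau0 n.+1) hB AE (tau2 _) _) _.
  move=> x; apply: le_trans (h x) _; rewrite ler_expR gerBl addr_ge0//=.
rewrite lee_fin.
(* The increment is at most the tail left by the previous truncation, and the old error integrates
   to at most tau B; each contributes rho. The final bound is then 2 (2C + 1) rho + 2 rho = 4 (1 +
   C) rho. *)
have Ipd : \int[mu]_x (pd n x + (st n).2 x) <= 2 * rho n.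
  rewrite RintegralD//; [|exact: bmeas_integrable|exact: bmeas_integrable].
  have e1 : \int[mu]_x pd n x <= rho n.
    rewrite -lee_fin -intE//; last first.
      have := integrable_lty measurableT (bmeas_integrable mu (bpd n)); exact.
    apply: le_trans (HM0 n); apply: int_le => //.
    by apply: measurable_funB => //; exact: measurable_minr.
  have e2 : \int[mu]_x (st n).2 x <= rho n.
    rewrite -lee_fin -intE//; [|by case: br|]; last first.
      have := integrable_lty measurableT (bmeas_integrable mu br); exact.
    apply: le_trans (exp_small_int br r0 (tau0 n) (st_B n)) _.
    by rewrite lee_fin.
  by lra.
have C0 := alg_dom_ge0 AC.
have := ler_wpM2l C0 Ipd.
set i := \int[mu]_x _ in Ipd hRe *; set j := \int[mu]_x Re _ in hRe *.
rewrite /= in hRe; move=> Ci.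
have -> : 2 * tau n.+1 * B = 2 * (tau n.+1 * B) by rewrite mulrA.
by lra.
Qed.

End Multipliers.

Lemma cvgn_ge_cst (R : realType) (u : nat -> R) (l x : R) :
  u @ \oo --> l -> (forall n, x <= u n) -> x <= l.
Proof.
move=> ul xu; rewrite leNgt; apply/negP => lx.
have [N _ /(_ N (leqnn N))] := cvgr_lt _ ul _ lx.
by rewrite ltNge xu.
Qed.

Section ComplexLimits.
Context d (T : measurableType d) (R : realType).
Variable mu : {finite_measure set T -> \bar R}.

Lemma ae_ccvg_of_series (v : nat -> T -> R[i]) (S : T -> R) :
  (forall n, cmeas (v n)) ->
  {ae mu, forall x, forall n, \sum_(i < n) nrm (v i.+1 x - v i x) <= S x} ->
  exists2 w : T -> R[i], cmeas w &
    {ae mu, forall x, (fun n => nrm (v n x - w x)) @ \oo --> (0 : R)}.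
Proof.
move=> mv vS.
have [w1 mw1 h1] : exists2 w : T -> R, measurable_fun setT w &
    {ae mu, forall x, (fun n => Re (v n x)) @ \oo --> w x}.
  apply: (@ae_cvg_of_series _ _ _ mu (fun n x => Re (v n x)) S).
    by move=> n; case: (mv n).
  apply: filterS vS => x h n; apply: le_trans (h n); apply: ler_sum => i _.
  by rewrite -cReN -cReD Re_le_nrm.
have [w2 mw2 h2] : exists2 w : T -> R, measurable_fun setT w &
    {ae mu, forall x, (fun n => Im (v n x)) @ \oo --> w x}.
  apply: (@ae_cvg_of_series _ _ _ mu (fun n x => Im (v n x)) S).
    by move=> n; case: (mv n).
  apply: filterS vS => x h n; apply: le_trans (h n); apply: ler_sum => i _.
  by rewrite -cImN -cImD Im_le_nrm.
exists (fun x => w1 x +i* w2 x)%C; first by split.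
apply: filterS2 h1 h2 => x h1 h2.
apply: (@squeeze_cvgr _ _ _ _ (cst 0)
  (fun n => `|Re (v n x) - w1 x| + `|Im (v n x) - w2 x|)).
- apply: nearW => n; rewrite nrm_ge0 /=; apply: le_trans (nrm_le_ReIm _) _.
  by rewrite cReD cImD cReN cImN.
- exact: cvg_cst.
rewrite -[0]addr0; apply: cvgD.
  by apply/cvgr0_norm_cvg0 || (rewrite -(normr0 R); apply: cvg_norm; apply/subr_cvg0).
by rewrite -(normr0 R); apply: cvg_norm; apply/subr_cvg0.
Qed.

End ComplexLimits.

Section MultiplierTheorem.
Context d (T : measurableType d) (R : realType).
Variables (mu : {finite_measure set T -> \bar R}) (A : set (T -> R[i])) (C : R).
Hypothesis AC : dominating_algebra mu A C.
Local Notation mfun f := (measurable_fun [set: T] f).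

(** The chain is applied to the tail [F] of ln(1 + S) above a height [k]; the part below [k]
    reappears as the constant c = exp(k). *)
Theorem multipliers (om S : T -> R) (la eps : R) : mfun om ->
  (forall x, 1 <= om x) -> (\int[mu]_x (om x)%:E < +oo)%E -> 0 < la ->
  mfun S -> (forall x, 0 <= S x) -> (\int[mu]_x (ln (1 + S x))%:E < +oo)%E ->
  0 < eps ->
  exists (a : nat -> T -> R[i]) (h : T -> R[i]) (c : R) (G : T -> R),
  [/\ forall n, A (a n), cmeas h,
    {ae mu, forall x, (fun n => nrm (a n x - h x)) @ \oo --> (0 : R)},
    {ae mu, forall x, nrm (h x) <= 1 /\ nrm (h x) * S x <= c} &
    [/\ (\int[mu]_x (nrm (1 - h x))%:E <= eps%:E)%E, mfun G, forall x, 0 <= G x,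
      (\int[mu]_x (G x)%:E < +oo)%E &
      {ae mu, forall x, forall n, nrm (a n x) `^ la * om x <= G x}]].
Proof.
move=> mom om1 om_fin la0 mS S0 lnS eps0.
have C0 := alg_dom_ge0 AC.
have om0 x : 0 <= om x by exact: le_trans (om1 x).
pose B := expR 1 * exp_bound mu om.
have B1 : 1 <= B.
  have D1 : 1 <= exp_bound mu om by rewrite lerDr; exact: Rintegral_ge0.
  by rewrite -[1]mulr1 ler_pM// -expR0 ler_expR.
(* Fitted to the final sum: the increments of [a] integrate to at most s_n (B + 1)/2, and these add
   up to at most theta (B + 1) <= eps. *)
pose theta := Num.min 1 (eps / (B + 1)).
have B10 : 0 < B + 1 by lra.
have theta0 : 0 < theta by rewrite lt_min ltr01 divr_gt0.
have thetaB : theta * (B + 1) <= eps.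
  by rewrite -ler_pdivlMr// ge_min lexx orbT.
pose s n := theta * 2^-1 ^+ n.
have s0 n : 0 < s n by rewrite mulr_gt0// exprn_gt0// invr_gt0.
have s1 n : s n <= 1.
  rewrite mulr_ile1 ?exprn_ge0 ?invr_ge0 ?exprn_ile1 ?invr_ge0//; try exact: ltW.
    by rewrite ge_min lexx.
  by rewrite invf_le1// ler1n.
have sS n : s n.+1 = s n / 2 by rewrite /s exprSr mulrA.
(* With this choice the chain gives 1 - E a squared L^2 norm of at most s_n^2. *)
pose rho n := s n ^+ 2 / (4 * (1 + C)).
have C10 : 0 < 4 * (1 + C) by lra.
have rho01 n : 0 < rho n <= 1.
  rewrite divr_gt0 ?exprn_gt0//= ler_pdivrMr// mul1r.
  by apply: (@le_trans _ _ 1); [rewrite expr_le1// ltW|lra].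
have rho_s n : rho n <= s n.
  rewrite ler_pdivrMr// expr2 ler_pM2l//; apply: le_trans (s1 n) _; lra.
have rhoS n : rho n.+1 <= rho n.
  have h : s n.+1 ^+ 2 <= s n ^+ 2.
    by rewrite lerXn2r ?nnegrE ?(ltW (s0 _))// sS; have := s0 n; lra.
  by rewrite /rho ler_wpM2r// invr_ge0 (ltW C10).
have sum_s n : \sum_(i < n) s i <= 2 * theta.
  by rewrite -mulr_sumr mulrC ler_wpM2r ?(ltW theta0)// geometric_half_le.
have mlnS : mfun (fun x => ln (1 + S x)).
  apply: (measurableT_comp (@measurable_ln R)); exact: measurable_funD.
have lnS0 x : 0 <= ln (1 + S x) by rewrite ln_ge0// lerDl.
have rho00 : 0 < rho 0%N by have /andP[] := rho01 0%N.
have [k hk] := int_trunc_small mlnS lnS0 lnS rho00.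
pose F x := ln (1 + S x) - Num.min (ln (1 + S x)) k%:R.
have mF : mfun F by apply: measurable_funB => //; exact: measurable_minr.
have F0 x : 0 <= F x by rewrite subr_ge0 ge_min lexx.
have [a [r [M]]] := multiplier_chain AC mom om1 om_fin la0 mF F0 hk rho01 rhoS.
rewrite /= -/B => -[a0 Aa br rB [ar FM aE]].
have la2 : 0 < la + 2 by rewrite addr_gt0.
have B0 : 0 < B by exact: lt_le_trans B1.
pose tau n := rho n / (B * (la + 2)).
have tau0 n : 0 < tau n.
  by apply: divr_gt0; [have /andP[] := rho01 n|exact: mulr_gt0].
have {}rB n : (\int[mu]_x (expR (r n x / tau n) * om x)%:E <= B%:E)%E := rB n.
have tauB n : tau n * B * (la + 2) = rho n by rewrite /tau; field; rewrite !gt_eqF.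
clearbody tau.
have tauB0 n : 0 <= tau n * B by apply: mulr_ge0; exact: ltW.
have tau_le n : tau n * (la + 2) <= 1.
  have /andP[_ r1] := rho01 n; apply: le_trans r1.
  by rewrite -(tauB n) mulrAC ler_peMr//; apply: mulr_ge0; exact: ltW.
have tau_la n : la * tau n <= 1 by have := tau_le n; have := tau0 n; lra.
have tau_2 n : 2 * tau n <= 1 by have := tau_le n; have := mulr_gt0 (tau0 n) la0; lra.
have mr n : mfun (r n) by have [[]] := br n.
have r0 n x : 0 <= r n x by have [] := br n.
have mFM n : mfun (fun x => F x - Num.min (F x) (M n)%:R).
  by apply: measurable_funB => //; exact: measurable_minr.
have FM0 n x : 0 <= F x - Num.min (F x) (M n)%:R by rewrite subr_ge0 ge_min lexx.
(* The exponent in the bound for |a_n| is v_n - F. Since v_n tends to 0 almost everywhere, the limit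
   satisfies |h| <= exp(-F). *)
pose v n x := r n x + (F x - Num.min (F x) (M n)%:R).
have v_cvg : {ae mu, forall x, v ^~ x @ \oo --> (0 : R)}.
  apply: (@int_series_cvg0 _ _ _ mu v (fun n => 2 * s n) (2 * (2 * theta))).
  - by move=> n; exact: measurable_funD.
  - by move=> n x; rewrite addr_ge0.
  - move=> n; rewrite intD// mulr_natl mulr2n EFinD leeD//.
      apply: le_trans (exp_small_int mom om1 (br n).1 (r0 n) (tau0 n) (rB n)) _.
      rewrite lee_fin; apply: le_trans (rho_s n); rewrite -(tauB n) ler_peMr//; lra.
    by apply: le_trans (FM n) _; rewrite lee_fin.
  - by move=> n; rewrite -mulr_sumr ler_wpM2l.
pose u n x := nrm (a n.+1 x - a n x).
have ma n := alg_cmeas AC (Aa n).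
have mu_ n : mfun (u n) by apply: cmeas_nrm; exact: cmeasB.
have u0 n x : 0 <= u n x by exact: nrm_ge0.
have uB n : (\int[mu]_x (u n x)%:E <= (s n * (B + 1) / 2)%:E)%E.
  have [E [AE aEx hE]] := aE n; have mE := alg_cmeas AC AE.
  have m1 : mfun (fun x => nrm (a n x) ^+ 2) by apply: measurable_funX; exact: cmeas_nrm.
  have m2 : mfun (fun x => nrm (1 - E x) ^+ 2).
    by apply: measurable_funX; apply: cmeas_nrm; apply: cmeasB => //; exact: cmeas_cst.
  have mr2 : mfun (fun x => expR (r n x) ^+ 2).
    by apply: measurable_funX; exact: measurableT_comp.
  (* The arithmetic-geometric inequality for |a_n| |1 - E|, weighted by s_n: the first factor is
     bounded in L^2 and the second has size s_n there. *)
  apply: (@le_trans _ _ (\int[mu]_x (s n / 2 * nrm (a n x) ^+ 2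
      + (2 * s n)^-1 * nrm (1 - E x) ^+ 2)%:E)%E).
    apply: int_le => // [|x]; first by apply: measurable_funD; exact: measurable_funM.
    rewrite /u aEx -[X in _ - X]mulr1 -mulrBr nrmM nrm_distC.
    set y := nrm (a n x); set z := nrm (1 - E x).
    rewrite -subr_ge0; have -> : s n / 2 * y ^+ 2 + (2 * s n)^-1 * z ^+ 2 - y * z =
        (2 * s n)^-1 * (s n * y - z) ^+ 2 by field; rewrite gt_eqF.
    by rewrite mulr_ge0 ?sqr_ge0// invr_ge0 mulr_ge0// ltW.
  have s20 : 0 <= s n / 2 by rewrite divr_ge0// ltW.
  have s2i0 : 0 <= (2 * s n)^-1 by rewrite invr_ge0 mulr_ge0// ltW.
  rewrite intD//; [|exact: measurable_funM|exact: measurable_funM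
    |by move=> x; rewrite mulr_ge0// sqr_ge0|by move=> x; rewrite mulr_ge0// sqr_ge0].
  rewrite !intZ//; [|by move=> x; exact: sqr_ge0|by move=> x; exact: sqr_ge0].
  have h1 : (\int[mu]_x (nrm (a n x) ^+ 2)%:E <= B%:E)%E.
    apply: le_trans (exp_small_sqr mom om1 (br n).1 (r0 n) (tau0 n) (rB n) (tau_2 n)).
    apply: int_le => // [x|x]; first exact: sqr_ge0.
    rewrite lerXn2r ?nnegrE ?nrm_ge0 ?expR_ge0// (le_trans (ar n x))// ler_expR gerBl.
    by rewrite le_min F0 ler0n.
  apply: (@le_trans _ _ ((s n / 2)%:E * B%:E + (2 * s n)^-1%:E * (s n ^+ 2)%:E)%E).
    apply: leeD; first exact: lee_wpmul2l.
    apply: lee_wpmul2l => //; apply: le_trans hE _.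
    by rewrite lee_fin /rho mulrC divfK// gt_eqF.
  rewrite -!EFinM -EFinD lee_fin le_eqVlt; apply/orP; left; apply/eqP.
  by field; rewrite gt_eqF.
have uC n : \sum_(i < n) s i * (B + 1) / 2 <= eps.
  rewrite (_ : \sum_(i < n) _ = (\sum_(i < n) s i) * ((B + 1) / 2)); last first.
    by rewrite mulr_suml; apply: eq_bigr => i _; rewrite mulrA.
  apply: le_trans thetaB; apply: le_trans (ler_wpM2r _ (sum_s n)) _; first by lra.
  by lra.
have [S2 [mS2 S20 IS2 uS2]] := int_series mu_ u0 uB uC.
have [h mh ah] := ae_ccvg_of_series ma uS2.
(* |a_n|^la om is at most om + w_n, and the w_n have an integrable sum, which supplies the common
   majorant [G]. *)
pose w n x := (expR (la * r n x) - 1) * om x.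
have w0 n x : 0 <= w n x.
  by rewrite mulr_ge0// subr_ge0 -expR0 ler_expR mulr_ge0// ltW.
have mw n : mfun (w n).
  apply: measurable_funM => //; apply: measurable_funB => //.
  by apply: measurableT_comp => //; exact: measurable_funM.
have wB n : (\int[mu]_x (w n x)%:E <= (la * s n)%:E)%E.
  apply: le_trans (exp_small_power mom om1 (br n).1 (r0 n) (tau0 n) (rB n) la0 (tau_la n)) _.
  rewrite lee_fin -mulrA ler_pM2l//; apply: le_trans (rho_s n).
  by rewrite -(tauB n) ler_peMr//; lra.
have wC n : \sum_(i < n) la * s i <= la * (2 * theta).
  by rewrite -mulr_sumr ler_pM2l.
have [S3 [mS3 S30 IS3 wS3]] := int_series mw w0 wB wC.
exists a, h, (expR k%:R), (fun x => om x + S3 x); split => //.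
- apply: filterS2 ah v_cvg => x hx vx.
  have hF : nrm (h x) <= expR (- F x).
    apply: (@cvgn_ge_cst _ (fun n => expR (v n x - F x) + nrm (a n x - h x))).
      rewrite -[X in _ --> X]addr0 -[X in _ --> expR X + _]add0r; apply: cvgD => //.
      apply: continuous_cvg; first exact: continuous_expR.
      by apply: cvgD => //; exact: cvg_cst.
    move=> n; rewrite -lerBlDr; apply: (@le_trans _ _ (nrm (a n x))).
      rewrite lerBlDr; have := nrmB (a n x) (a n x - h x).
      by rewrite opprB [X in nrm X]addrC subrK.
    by apply: le_trans (ar n x) _; rewrite ler_expR /v; lra.
  have F_le : F x <= ln (1 + S x) by rewrite gerBl le_min lnS0 ler0n.
  split; first by apply: le_trans hF _; rewrite -expR0 ler_expR oppr_le0.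
  apply: (@le_trans _ _ (expR (- F x) * (1 + S x))).
    by apply: ler_pM => //; [exact: nrm_ge0|rewrite lerDr].
  have S10 : 0 < 1 + S x by rewrite ltr_pwDl.
  have e1 : 1 + S x = expR (ln (1 + S x)) by rewrite lnK.
  rewrite [X in _ * X]e1 -expRD ler_expR /F opprB subrK.
  by rewrite ge_min lexx orbT.
- split => //.
  + apply: le_trans IS2; apply: int_ae_le => //.
    * by apply: cmeas_nrm; apply: cmeasB => //; exact: cmeas_cst.
    * by move=> x; exact: nrm_ge0.
    apply: filterS2 ah uS2 => x hx ux.
    apply: (@cvgn_ge_cst _ (fun n => S2 x + nrm (a n x - h x))).
      by rewrite -[X in _ --> X]addr0; apply: cvgD => //; exact: cvg_cst.
    move=> n; apply: (@le_trans _ _ (nrm (1 - a n x) + nrm (a n x - h x))).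
      by apply: le_trans (nrmD _ _); rewrite addrA subrK.
    rewrite lerD2r; apply: le_trans (ux n).
    elim: n => [|n ih]; first by rewrite a0 -[cst 1 x]/(1 : R[i]) subrr big_ord0 nrm0.
    rewrite big_ord_recr /=; apply: le_trans (lerD ih (lexx _)).
    have := nrmB (1 - a n x) (a n.+1 x - a n x).
    by rewrite opprB addrA subrK.
  + exact: measurable_funD.
  + by move=> x; rewrite addr_ge0.
  + by rewrite intD// lte_add_pinfty// (le_lt_trans IS3)// ltry.
  + apply: filterS wS3 => x hx n.
    apply: (@le_trans _ _ (expR (la * r n x) * om x)).
      rewrite ler_wpM2r// [la * _]mulrC expRM; apply: ge0_ler_powR => //.
      * exact: ltW.
      * by rewrite nnegrE nrm_ge0.
      * by rewrite nnegrE expR_ge0.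
      * apply: le_trans (ar n x) _; rewrite ler_expR gerBl.
        by rewrite le_min F0 ler0n.
    have := hx n.+1; rewrite big_ord_recr /= => hx'.
    have : 0 <= \sum_(i < n) w i x by apply: sumr_ge0.
    rewrite {2}/w in hx'; lra.
Qed.

End MultiplierTheorem.

(** * Approximation by multipliers for arbitrary exponents *)

Section Powers.
Context (R : realType).
Implicit Types x y z s p : R.

Lemma powR_le x y s : 0 <= s -> 0 <= x -> x <= y -> x `^ s <= y `^ s.
Proof.
move=> s0 x0 xy; apply: ge0_ler_powR => //; rewrite nnegrE//.
exact: le_trans xy.
Qed.

(** The sum is at most three times its largest term; this treats exponents on both sides of 1
    alike. *)
Lemma powR_add3_le x y z s : 0 < s -> 0 <= x -> 0 <= y -> 0 <= z ->
  (x + y + z) `^ s <= 3 `^ s * (x `^ s + y `^ s + z `^ s).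
Proof.
move=> s0 x0 y0 z0; have s0' := ltW s0.
have [px py pz] : [/\ 0 <= x `^ s, 0 <= y `^ s & 0 <= z `^ s] by split; exact: powR_ge0.
have key w : 0 <= w -> x <= w -> y <= w -> z <= w ->
    (x + y + z) `^ s <= 3 `^ s * w `^ s.
  move=> w0 xw yw zw; rewrite -powRM//; apply: powR_le => //; [|lra].
  by rewrite !addr_ge0.
have p3 : 0 <= 3 `^ s :> R by exact: powR_ge0.
have [xy|yx] := leP x y.
  have [yz|zy] := leP y z.
    apply: le_trans (key z z0 (le_trans xy yz) yz (lexx _)) _.
    by rewrite ler_wpM2l// lerDr addr_ge0.
  apply: le_trans (key y y0 xy (lexx _) (ltW zy)) _.
  by rewrite ler_wpM2l// addrAC lerDr addr_ge0.
have [xz|zx] := leP x z.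
  apply: le_trans (key z z0 xz (le_trans (ltW yx) xz) (lexx _)) _.
  by rewrite ler_wpM2l// lerDr addr_ge0.
apply: le_trans (key x x0 (lexx _) (ltW yx) (ltW zx)) _.
by rewrite ler_wpM2l// -addrA lerDl addr_ge0.
Qed.

Lemma powR_add_le x y s : 0 < s -> 0 <= x -> 0 <= y ->
  (x + y) `^ s <= 3 `^ s * (x `^ s + y `^ s).
Proof.
move=> s0 x0 y0; have := powR_add3_le s0 x0 y0 (lexx 0).
by rewrite (@powR0 _ s) ?gt_eqF// !addr0.
Qed.

Lemma powR_cvg0_seq (u : nat -> R) s : 0 < s -> (forall n, 0 <= u n) ->
  u @ \oo --> (0 : R) -> (fun n => u n `^ s) @ \oo --> (0 : R).
Proof.
move=> s0 u0 uc; apply/cvgr0Pnorm_lt => e e0.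
have es0 : 0 < e `^ s^-1 by exact: powR_gt0.
have /cvgr0Pnorm_lt/(_ _ es0) := uc; apply: filterS => n.
rewrite !ger0_norm ?powR_ge0// => h.
have -> : e = (e `^ s^-1) `^ s by rewrite -powRrM mulVf ?gt_eqF// powRr1// ltW.
by apply: gt0_ltr_powR => //; rewrite nnegrE ?powR_ge0.
Qed.

Lemma ln_le_powR x p : 0 < p -> 0 <= x -> ln (1 + x) <= 3 `^ p / p * (1 + x `^ p).
Proof.
move=> p0 x0; have x10 : 0 < 1 + x by rewrite ltr_pwDl.
rewrite mulrAC ler_pdivlMr// mulrC -ln_powR.
apply: le_trans (ltW (ln_sublinear (powR_gt0 _ x10))) _.
apply: le_trans (powR_add_le p0 ler01 x0) _.
by rewrite powR1.
Qed.

End Powers.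

Section MultiplierApprox.
Context d (T : measurableType d) (R : realType).
Variables (mu : {finite_measure set T -> \bar R}) (A : set (T -> R[i])) (C : R).
Hypothesis AC : dominating_algebra mu A C.
Local Notation mfun f := (measurable_fun [set: T] f).

Lemma mfun_powR (f : T -> R) s : mfun f -> mfun (fun x => f x `^ s).
Proof. by move=> mf; exact: (measurableT_comp (measurable_powR s)). Qed.

(** By contradiction: counterexamples at L^1 distance at most 2^-n from 1 tend to 1 almost
    everywhere, and 2^s W dominates the integrands. *)
Lemma int_small_multiplier (W : T -> R) (s e : R) : mfun W -> (forall x, 0 <= W x) ->
  (\int[mu]_x (W x)%:E < +oo)%E -> 0 < s -> 0 < e ->
  exists2 eps : R, 0 < eps & forall h : T -> R[i], cmeas h ->
    {ae mu, forall x, nrm (h x) <= 1} -> (\int[mu]_x (nrm (1 - h x))%:E <= eps%:E)%E ->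
    (\int[mu]_x (nrm (1 - h x) `^ s * W x)%:E < e%:E)%E.
Proof.
move=> mW W0 Wy s0 e0; apply: contrapT => H.
have {H} /choice[h Hh] : forall n, exists h : T -> R[i],
    [/\ cmeas h, {ae mu, forall x, nrm (h x) <= 1},
    (\int[mu]_x (nrm (1 - h x))%:E <= (2^-1 ^+ n)%:E)%E &
    ~ (\int[mu]_x (nrm (1 - h x) `^ s * W x)%:E < e%:E)%E].
  move=> n; apply: contrapT => Hn; apply: H; exists (2^-1 ^+ n).
    by rewrite exprn_gt0// invr_gt0.
  move=> h mh h1 Ih; apply: contrapT => h2; apply: Hn; by exists h.
have m1 n : mfun (fun x => nrm (1 - h n x)).
  by have [mh _ _ _] := Hh n; apply: cmeas_nrm; apply: cmeasB => //; exact: cmeas_cst.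
have hc : {ae mu, forall x, (fun n => nrm (1 - h n x)) @ \oo --> (0 : R)}.
  apply: (@int_series_cvg0 _ _ _ mu (fun n x => nrm (1 - h n x)) (fun n => 2^-1 ^+ n) 2) => //.
  - by move=> n x; exact: nrm_ge0.
  - by move=> n; have [] := Hh n.
  - by move=> n; exact: geometric_half_le.
have h1 : {ae mu, forall x, forall n, nrm (h n x) <= 1}.
  by apply/ae_foralln => n; have [] := Hh n.
have [|||||||N hN] := @int_cvg0 _ _ _ mu (fun n x => nrm (1 - h n x) `^ s * W x)
    (fun x => 2 `^ s * W x) _ e0.
- by move=> n; apply: measurable_funM => //; exact: mfun_powR.
- exact: measurable_funM.
- by move=> n x; rewrite mulr_ge0// powR_ge0.
- by move=> x; rewrite mulr_ge0// powR_ge0.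
- rewrite intZ ?powR_ge0// lte_mul_pinfty// ?lee_fin ?powR_ge0//.
- apply: filterS h1 => x h1 n; rewrite ler_wpM2r//; apply: powR_le; [exact: ltW|exact: nrm_ge0|].
  apply: le_trans (nrmB _ _) _; rewrite nrm1; have := h1 n; lra.
- apply: filterS hc => x hx; rewrite -[0](mul0r (W x)); apply: cvgM; last exact: cvg_cst.
  by apply: powR_cvg0_seq => // n; exact: nrm_ge0.
by have [] := Hh N.
Qed.

Theorem multiplier_approx (om S : T -> R) (s e : R) : mfun om ->
  (forall x, 1 <= om x) -> (\int[mu]_x (om x)%:E < +oo)%E -> 0 < s ->
  mfun S -> (forall x, 0 <= S x) -> (\int[mu]_x (ln (1 + S x))%:E < +oo)%E ->
  0 < e -> exists (h : T -> R[i]) (c : R), [/\ cmeas h,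
    {ae mu, forall x, nrm (h x) <= 1 /\ nrm (h x) * S x <= c},
    (\int[mu]_x (nrm (1 - h x) `^ s * om x)%:E < e%:E)%E &
    forall e' : R, 0 < e' -> exists2 a, A a &
      (\int[mu]_x (nrm (h x - a x) `^ s * om x)%:E < e'%:E)%E].
Proof.
move=> mom om1 om_fin s0 mS S0 lnS e0.
have om0 x : 0 <= om x by exact: le_trans (om1 x).
have [eps eps0 Heps] := int_small_multiplier mom om0 om_fin s0 e0.
have [a [h [c [G [Aa mh ah hS [Ih mG G0 IG aG]]]]]] :=
  multipliers AC mom om1 om_fin s0 mS S0 lnS eps0.
have h1 : {ae mu, forall x, nrm (h x) <= 1} by apply: filterS hS => x [].
exists h, c; split => //; first exact: Heps.
move=> e' e'0.
have md n : mfun (fun x => nrm (h x - a n x)).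
  by apply: cmeas_nrm; apply: cmeasB => //; exact: alg_cmeas AC _ (Aa n).
have [|||||||N hN] := @int_cvg0 _ _ _ mu (fun n x => nrm (h x - a n x) `^ s * om x)
    (fun x => 3 `^ s * (om x + G x)) _ e'0.
- by move=> n; apply: measurable_funM => //; exact: mfun_powR.
- by apply: measurable_funM => //; exact: measurable_funD.
- by move=> n x; rewrite mulr_ge0// powR_ge0.
- by move=> x; rewrite mulr_ge0 ?powR_ge0// addr_ge0.
- rewrite intZ ?powR_ge0//; [|exact: measurable_funD|by move=> x; rewrite addr_ge0].
  rewrite intD// lte_mul_pinfty// ?lee_fin ?powR_ge0//.
  by rewrite lte_add_pinfty.
- apply: filterS2 h1 aG => x h1 aG n.
  apply: (@le_trans _ _ (3 `^ s * (nrm (h x) `^ s + nrm (a n x) `^ s) * om x)).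
    rewrite ler_wpM2r//; apply: le_trans (powR_add_le s0 (nrm_ge0 _) (nrm_ge0 _)).
    by apply: powR_le; [exact: ltW|exact: nrm_ge0|exact: nrmB].
  rewrite -mulrA ler_wpM2l ?powR_ge0// mulrDl lerD//.
  by rewrite ler_piMl//; have := powR_le (ltW s0) (nrm_ge0 _) h1; rewrite powR1.
- apply: filterS ah => x hx; rewrite -[0](mul0r (om x)); apply: cvgM; last exact: cvg_cst.
  apply: powR_cvg0_seq => // [n|]; first exact: nrm_ge0.
  by under eq_fun do rewrite nrm_distC.
by exists (a N).
Qed.

Lemma ln_powR_integrable (S : T -> R) p : 0 < p -> mfun S -> (forall x, 0 <= S x) ->
  (\int[mu]_x (S x `^ p)%:E < +oo)%E -> (\int[mu]_x (ln (1 + S x))%:E < +oo)%E.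
Proof.
move=> p0 mS S0 IS.
have mlnS : mfun (fun x => ln (1 + S x)).
  by apply: (measurableT_comp (@measurable_ln R)); exact: measurable_funD.
have mSp := mfun_powR p mS.
have c0 : 0 <= 3 `^ p / p by rewrite divr_ge0 ?powR_ge0// ltW.
apply: (@le_lt_trans _ _ (\int[mu]_x (3 `^ p / p * (1 + S x `^ p))%:E)%E).
  apply: int_le => // [|x|x].
  - by apply: measurable_funM => //; exact: measurable_funD.
  - by rewrite ln_ge0// lerDl.
  - exact: ln_le_powR.
rewrite intZ//; [|exact: measurable_funD|by move=> x; rewrite addr_ge0 ?powR_ge0].
rewrite intD//; last by move=> x; exact: powR_ge0.
rewrite lte_mul_pinfty// lte_add_pinfty// int_cst mul1e.
by rewrite -ge0_fin_numE// fin_num_measure.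
Qed.

Theorem bounded_density (f : T -> R[i]) (p e : R) : 0 < p -> cmeas f ->
  (\int[mu]_x (nrm (f x) `^ p)%:E < +oo)%E -> 0 < e ->
  exists (g : T -> R[i]) (c : R), [/\ cmeas g, {ae mu, forall x, nrm (g x) <= c},
    (\int[mu]_x (nrm (f x - g x) `^ p)%:E < e%:E)%E &
    forall e' : R, 0 < e' -> exists2 a, A a &
      (\int[mu]_x (nrm (g x - a x * f x) `^ p)%:E < e'%:E)%E].
Proof.
move=> p0 mf If e0.
have mnf : mfun (fun x => nrm (f x)) by exact: cmeas_nrm.
have mfp := mfun_powR p mnf.
have fp0 x : 0 <= nrm (f x) `^ p by exact: powR_ge0.
(* The summand |f|^p turns approximation of [h] in the weighted space into approximation of h f in
   L^p; the 1 is there because weights must be at least 1. *)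
pose om x := 1 + nrm (f x) `^ p.
have mom : mfun om by exact: measurable_funD.
have om1 x : 1 <= om x by rewrite lerDl.
have om_fin : (\int[mu]_x (om x)%:E < +oo)%E.
  rewrite intD// lte_add_pinfty// int_cst mul1e.
  by rewrite -ge0_fin_numE// fin_num_measure.
have lnf := ln_powR_integrable p0 mnf (fun x => nrm_ge0 (f x)) If.
have [h [c [mh hS h1 ha]]] :=
  multiplier_approx mom om1 om_fin p0 mnf (fun x => nrm_ge0 (f x)) lnf e0.
have bound (u v : T -> R[i]) (e' : R) : cmeas u -> cmeas v ->
    (\int[mu]_x (nrm (u x - v x) `^ p * om x)%:E < e'%:E)%E ->
    (\int[mu]_x (nrm (u x * f x - v x * f x) `^ p)%:E < e'%:E)%E.
  move=> mu_ mv; apply: le_lt_trans; apply: int_le.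
  - apply: mfun_powR; apply: cmeas_nrm; apply: cmeasB; exact: cmeasM.
  - by apply: measurable_funM => //; apply: mfun_powR; apply: cmeas_nrm; exact: cmeasB.
  - by move=> x; exact: powR_ge0.
  - move=> x; rewrite -mulrBl nrmM powRM ?nrm_ge0// ler_wpM2l ?powR_ge0//.
    by rewrite lerDr.
exists (fun x => h x * f x), c; split.
- exact: cmeasM.
- by apply: filterS hS => x [_]; rewrite nrmM.
- have := bound (cst 1) h _ (cmeas_cst _ _) mh h1.
  by under eq_integral do rewrite /= mul1r.
- move=> e' /ha[a Aa h2]; exists a => //; apply: bound => //.
  exact: alg_cmeas AC _ Aa.
Qed.

(** f - a g = (1 - h) f + h (f - g) + (h - a) g, with the choices made in this order: [h] close to 1
    for the first term, [g] far along a sequence for the second, then [a] close to [h] relative to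
    the bound of [g]. *)
Theorem bounded_transfer (M : set (T -> R[i])) (f : T -> R[i]) (eta : T -> R) (p s e : R) :
  0 < p -> 0 < s -> cmeas f -> mfun eta -> (forall x, 0 <= eta x) ->
  (\int[mu]_x (eta x)%:E < +oo)%E ->
  (\int[mu]_x (nrm (f x) `^ s * eta x)%:E < +oo)%E ->
  (forall g, M g -> cmeas g /\ exists c, {ae mu, forall x, nrm (g x) <= c}) ->
  (forall e' : R, 0 < e' -> exists2 g, M g &
    (\int[mu]_x (nrm (f x - g x) `^ p)%:E < e'%:E)%E) -> 0 < e ->
  exists a g, [/\ A a, M g &
    (\int[mu]_x (nrm (f x - a x * g x) `^ s * eta x)%:E < e%:E)%E].
Proof.
move=> p0 s0 mf meta eta0 Ieta If MB Mf e0.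
have /choice[g Hg] : forall n, exists g, M g /\
    (\int[mu]_x (nrm (f x - g x) `^ p)%:E < (2^-1 ^+ n)%:E)%E.
  move=> n; have [|g Mg h] := Mf (2^-1 ^+ n); first by rewrite exprn_gt0// invr_gt0.
  by exists g.
have mg n : cmeas (g n) by have [/MB[]] := Hg n.
have md n : mfun (fun x => nrm (f x - g n x)) by apply: cmeas_nrm; exact: cmeasB.
have d0 n x : 0 <= nrm (f x - g n x) `^ p by exact: powR_ge0.
have Id n : (\int[mu]_x (nrm (f x - g n x) `^ p)%:E <= (2^-1 ^+ n)%:E)%E.
  by apply: ltW; have [] := Hg n.
have [T0 [mT T00 IT gT]] := int_series (fun n => mfun_powR p (md n)) d0 Id
  (geometric_half_le R).
have gc := int_series_cvg0 (fun n => mfun_powR p (md n)) d0 Id (geometric_half_le R).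
(* [S] dominates all |f - g_n| almost everywhere, so |h| |f - g_n| <= c for every n. Convergence in
   L^p thus gives dominated convergence for the exponent [s], which may exceed [p]. *)
pose S x := T0 x `^ p^-1.
have mS : mfun S by exact: mfun_powR.
have S0 x : 0 <= S x by exact: powR_ge0.
have Sp x : S x `^ p = T0 x by rewrite /S -powRrM mulVf ?gt_eqF// powRr1.
have lnS : (\int[mu]_x (ln (1 + S x))%:E < +oo)%E.
  apply: (ln_powR_integrable p0) => //; under eq_integral do rewrite Sp.
  exact: le_lt_trans IT (ltry _).
have mnf : mfun (fun x => nrm (f x)) by exact: cmeas_nrm.
have mfs := mfun_powR s mnf.
have fs0 x : 0 <= nrm (f x) `^ s by exact: powR_ge0.
pose om x := 1 + (eta x + nrm (f x) `^ s * eta x).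
have mfe : mfun (fun x => nrm (f x) `^ s * eta x) by exact: measurable_funM.
have fe0 x : 0 <= nrm (f x) `^ s * eta x by rewrite mulr_ge0.
have mom2 : mfun (fun x => eta x + nrm (f x) `^ s * eta x) by exact: measurable_funD.
have mom : mfun om by exact: measurable_funD.
have om20 x : 0 <= eta x + nrm (f x) `^ s * eta x by rewrite addr_ge0.
have om1 x : 1 <= om x by rewrite lerDl.
have om_fin : (\int[mu]_x (om x)%:E < +oo)%E.
  rewrite intD// intD//; apply: lte_add_pinfty; last exact: lte_add_pinfty.
  by rewrite int_cst mul1e -ge0_fin_numE// fin_num_measure.
have p3 : 0 < 3 `^ s :> R by exact: powR_gt0.
pose e1 := e / 3 / 3 `^ s.
have e10 : 0 < e1 by rewrite !divr_gt0.
have [h [c [mh hS h1 ha]]] := multiplier_approx mom om1 om_fin s0 mS S0 lnS e10.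
have mhd n : mfun (fun x => nrm (h x) * nrm (f x - g n x)).
  by apply: measurable_funM => //; exact: cmeas_nrm.
have [n hn] : exists n,
    (\int[mu]_x ((nrm (h x) * nrm (f x - g n x)) `^ s * eta x)%:E < e1%:E)%E.
  have [|||||||N hN] := @int_cvg0 _ _ _ mu
      (fun n x => (nrm (h x) * nrm (f x - g n x)) `^ s * eta x)
      (fun x => c `^ s * eta x) _ e10.
  - by move=> n; apply: measurable_funM => //; exact: mfun_powR.
  - exact: measurable_funM.
  - by move=> n x; rewrite mulr_ge0// powR_ge0.
  - by move=> x; rewrite mulr_ge0// powR_ge0.
  - by rewrite intZ ?powR_ge0// lte_mul_pinfty// lee_fin powR_ge0.
  - apply: filterS2 hS gT => x [_ hS] gT n.
    rewrite ler_wpM2r//; apply: powR_le; [exact: ltW|by rewrite mulr_ge0 ?nrm_ge0|].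
    apply: le_trans hS; rewrite ler_wpM2l ?nrm_ge0//.
    have -> : nrm (f x - g n x) = (nrm (f x - g n x) `^ p) `^ p^-1.
      by rewrite -powRrM mulfV ?gt_eqF// powRr1// nrm_ge0.
    apply: powR_le => //; first by rewrite invr_ge0 ltW.
    apply: le_trans (gT n.+1); rewrite big_ord_recr /= lerDr.
    by apply: sumr_ge0.
  - apply: filterS gc => x gx; rewrite -[0](mul0r (eta x)).
    apply: cvgM; last exact: cvg_cst.
    apply: powR_cvg0_seq => // [n|]; first by rewrite mulr_ge0 ?nrm_ge0.
    rewrite -[0](mulr0 (nrm (h x))); apply: cvgM; first exact: cvg_cst.
    have := powR_cvg0_seq (_ : 0 < p^-1) _ gx; rewrite invr_gt0 => /(_ p0 (d0^~ x)).
    by under eq_fun do rewrite -powRrM mulfV ?gt_eqF// powRr1 ?nrm_ge0//.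
  by exists N.
have [Mgn _] := Hg n; have [_ [c' hc']] := MB _ Mgn.
pose b := `|c'| + 1; have b0 : 0 < b by rewrite ltr_pwDr.
have bs0 : 0 < b `^ s by exact: powR_gt0.
have [a Aa ha'] := ha (e1 / b `^ s) (divr_gt0 e10 bs0).
have ma := alg_cmeas AC Aa.
exists a, (g n); split => //.
pose t1 x := nrm (1 - h x) `^ s * (nrm (f x) `^ s * eta x).
pose t2 x := (nrm (h x) * nrm (f x - g n x)) `^ s * eta x.
pose t3 x := b `^ s * (nrm (h x - a x) `^ s * om x).
have mh1 : mfun (fun x => nrm (1 - h x)).
  by apply: cmeas_nrm; apply: cmeasB => //; exact: cmeas_cst.
have mha : mfun (fun x => nrm (h x - a x)) by apply: cmeas_nrm; exact: cmeasB.
have mt1 : mfun t1 by apply: measurable_funM => //; exact: mfun_powR.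
have mt2 : mfun t2 by apply: measurable_funM => //; exact: mfun_powR.
have mt3' : mfun (fun x => nrm (h x - a x) `^ s * om x).
  by apply: measurable_funM => //; exact: mfun_powR.
have mt3 : mfun t3 by exact: measurable_funM.
have t10 x : 0 <= t1 x by rewrite mulr_ge0// powR_ge0.
have t20 x : 0 <= t2 x by rewrite mulr_ge0// powR_ge0.
have om0 x : 0 <= om x by exact: le_trans (om1 x).
have t30' x : 0 <= nrm (h x - a x) `^ s * om x by rewrite mulr_ge0// powR_ge0.
have t30 x : 0 <= t3 x by rewrite mulr_ge0// powR_ge0.
apply: (@le_lt_trans _ _ (\int[mu]_x (3 `^ s * (t1 x + t2 x + t3 x))%:E)%E).
  apply: int_ae_le => //.
  - apply: measurable_funM => //; apply: mfun_powR; apply: cmeas_nrm.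
    by apply: cmeasB => //; exact: cmeasM.
  - apply: measurable_funM => //; apply: measurable_funD => //.
    exact: measurable_funD.
  - by move=> x; rewrite mulr_ge0// powR_ge0.
  - by move=> x; rewrite mulr_ge0 ?powR_ge0// !addr_ge0.
  apply: filterS hc' => x gb.
  have -> : f x - a x * g n x =
      (1 - h x) * f x + h x * (f x - g n x) + (h x - a x) * g n x by ring.
  have tri : nrm ((1 - h x) * f x + h x * (f x - g n x) + (h x - a x) * g n x) <=
      nrm (1 - h x) * nrm (f x) + nrm (h x) * nrm (f x - g n x)
      + nrm (h x - a x) * b.
    apply: le_trans (nrmD _ _) _; apply: lerD.
      by apply: le_trans (nrmD _ _) _; rewrite !nrmM.
    rewrite nrmM ler_wpM2l ?nrm_ge0//; apply: le_trans gb _.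
    by apply: le_trans (ler_norm _) _; rewrite lerDl.
  apply: (@le_trans _ _ (3 `^ s * ((nrm (1 - h x) * nrm (f x)) `^ s +
      (nrm (h x) * nrm (f x - g n x)) `^ s + (nrm (h x - a x) * b) `^ s) * eta x)).
    rewrite ler_wpM2r//; apply: le_trans (powR_add3_le s0 _ _ _);
      rewrite ?mulr_ge0 ?nrm_ge0// ?(ltW b0)//.
    by apply: powR_le; [exact: ltW|exact: nrm_ge0|].
  rewrite -mulrA ler_wpM2l ?powR_ge0// !mulrDl; apply: lerD.
    by rewrite lerD2r powRM ?nrm_ge0// /t1 mulrA.
  rewrite powRM ?nrm_ge0 ?(ltW b0)// /t3 [X in X * eta x]mulrC -mulrA.
  rewrite ler_wpM2l ?powR_ge0// ler_wpM2l ?powR_ge0// /om addrCA lerDl.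
  by rewrite addr_ge0.
rewrite intZ ?powR_ge0//; [|by apply: measurable_funD => //; exact: measurable_funD
  |by move=> x; rewrite !addr_ge0].
rewrite intD//; [|exact: measurable_funD|by move=> x; rewrite addr_ge0].
rewrite intD//.
have I1 : (\int[mu]_x (t1 x)%:E < e1%:E)%E.
  apply: le_lt_trans h1; apply: int_le => //.
    by apply: measurable_funM => //; exact: mfun_powR.
  move=> x; rewrite ler_wpM2l ?powR_ge0// /om addrA lerDr.
  by rewrite addr_ge0.
have I3 : (\int[mu]_x (t3 x)%:E < e1%:E)%E.
  rewrite intZ ?powR_ge0//.
  have -> : e1 = b `^ s * (e1 / b `^ s) by rewrite mulrC divfK// gt_eqF.
  by rewrite EFinM lte_pmul2l ?lte_fin.
have -> : e = 3 `^ s * (e1 + e1 + e1) by rewrite /e1; field; rewrite gt_eqF.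
by rewrite EFinM lte_pmul2l ?lte_fin// !EFinD !lteD.
Qed.

End MultiplierApprox.

(** * Weak-star closure and L^2 projection *)

Section RealInnerProduct.
Context (R : realType).
Implicit Types (z w v : R[i]) (t : R).

Definition rip z w := Re z * Re w + Im z * Im w.

Lemma ripE z w : rip z w = Re (z * (w^*)%C).
Proof. by rewrite cReM; case: z => a b; case: w => c e /=; rewrite /rip /=; ring. Qed.

Lemma nrm_conj z : nrm (z^*)%C = nrm z.
Proof. by case: z => a b /=; rewrite sqrrN. Qed.

Lemma rip_le z w : `|rip z w| <= nrm z * nrm w.
Proof. by rewrite ripE -(nrm_conj w) -nrmM Re_le_nrm. Qed.

Lemma rip_self z : rip z z = nrm z ^+ 2.
Proof. by rewrite nrm_sqr /rip !expr2. Qed.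

Lemma ripDr z v w : rip z (v + w) = rip z v + rip z w.
Proof. by rewrite /rip cReD cImD; ring. Qed.

Lemma ripBl z v w : rip (z - v) w = rip z w - rip v w.
Proof. by rewrite /rip cReD cImD cReN cImN; ring. Qed.

Lemma nrm_sqrD z w : nrm (z + w) ^+ 2 = nrm z ^+ 2 + 2 * rip z w + nrm w ^+ 2.
Proof. by rewrite !nrm_sqr /rip cReD cImD; ring. Qed.

Lemma nrm_parallelogram z v w :
  nrm (v - w) ^+ 2 = 2 * nrm (z - v) ^+ 2 + 2 * nrm (z - w) ^+ 2
    - 4 * nrm (z - ((2^-1)%:C%C * v + (2^-1)%:C%C * w)) ^+ 2.
Proof.
by rewrite !nrm_sqr !(cReD, cImD, cReN, cImN, cReM, cImM) /=; field.
Qed.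

End RealInnerProduct.

Section EssentiallyBounded.
Context d (T : measurableType d) (R : realType).
Variable mu : {finite_measure set T -> \bar R}.
Local Notation mfun f := (measurable_fun [set: T] f).

Definition ess_bounded : set (T -> R[i]) :=
  [set f | cmeas f /\ exists c, {ae mu, forall x, nrm (f x) <= c}].

Lemma ess_boundedB f g : ess_bounded f -> ess_bounded g ->
  ess_bounded (fun x => f x - g x).
Proof.
move=> [mf [c fc]] [mg [c' gc']]; split; first exact: cmeasB.
exists (c + c'); apply: filterS2 fc gc' => x h1 h2.
by apply: le_trans (nrmB _ _) _; exact: lerD.
Qed.

Lemma mfun_rip (f g : T -> R[i]) : cmeas f -> cmeas g -> mfun (fun x => rip (f x) (g x)).
Proof.
by move=> [? ?] [? ?]; apply: measurable_funD; exact: measurable_funM.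
Qed.

Lemma rip_integrable (f g : T -> R[i]) : cmeas f -> ess_bounded g ->
  (\int[mu]_x (nrm (f x))%:E < +oo)%E ->
  mu.-integrable setT (fun x => (rip (f x) (g x))%:E).
Proof.
move=> mf [mg [c gc]] If; apply/integrableP; split.
  by apply/measurable_EFinP; exact: mfun_rip.
apply: (@le_lt_trans _ _ (\int[mu]_x (`|c| * nrm (f x))%:E)%E).
  apply: (@int_ae_le _ _ _ mu (fun x => `|rip (f x) (g x)|)) => //.
  - by apply: measurableT_comp => //; exact: mfun_rip.
  - by apply: measurable_funM => //; exact: cmeas_nrm.
  - by move=> x; rewrite mulr_ge0 ?nrm_ge0.
  - apply: filterS gc => x h; apply: le_trans (rip_le _ _) _.
    by rewrite mulrC ler_wpM2r ?nrm_ge0// (le_trans h)// ler_norm.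
rewrite intZ//; [|exact: cmeas_nrm|by move=> x; exact: nrm_ge0].
by rewrite lte_mul_pinfty// lee_fin.
Qed.

Lemma ess_bounded_int (f : T -> R[i]) : ess_bounded f ->
  (\int[mu]_x (nrm (f x))%:E < +oo)%E.
Proof.
move=> [mf [c fc]]; apply: (@le_lt_trans _ _ (\int[mu]_x `|c|%:E)%E).
  apply: (@int_ae_le _ _ _ mu (fun x => nrm (f x)) (cst `|c|)) => //.
  - exact: cmeas_nrm.
  - by move=> x; exact: nrm_ge0.
  - by apply: filterS fc => x h; rewrite (le_trans h)//= ler_norm.
by rewrite int_cst lte_mul_pinfty// ?lee_fin// -ge0_fin_numE// fin_num_measure.
Qed.

Lemma ess_bounded_rip f g : ess_bounded f -> ess_bounded g ->
  mu.-integrable setT (fun x => (rip (f x) (g x))%:E).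
Proof.
by move=> ff gg; apply: rip_integrable => //; [case: ff|exact: ess_bounded_int].
Qed.

Lemma ess_bounded_sqr f : ess_bounded f ->
  mu.-integrable setT (fun x => (nrm (f x) ^+ 2)%:E).
Proof.
by move=> ff; have := ess_bounded_rip ff ff; under eq_fun do rewrite rip_self.
Qed.

End EssentiallyBounded.
Arguments ess_bounded {d T R}.

Section WeakSeparation.
Context d (T : measurableType d) (R : realType).
Variable mu : {finite_measure set T -> \bar R}.
Local Notation mfun f := (measurable_fun [set: T] f).
Variables (M : set (T -> R[i])) (f : T -> R[i]).
Hypothesis MB : M `<=` ess_bounded mu.
Hypothesis fB : ess_bounded mu f.
Hypothesis M0 : M !=set0.
Hypothesis Mconvex : forall g g' (t : R), M g -> M g' -> 0 <= t <= 1 ->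
  M (fun x => (1 - t)%:C%C * g x + t%:C%C * g' x).

Let Q g := \int[mu]_x nrm (f x - g x) ^+ 2.

Let dB g : M g -> ess_bounded mu (fun x => f x - g x).
Proof. by move=> /MB gB; exact: ess_boundedB. Qed.

Let iQ g : M g -> mu.-integrable setT (fun x => (nrm (f x - g x) ^+ 2)%:E).
Proof. by move=> /dB; exact: ess_bounded_sqr. Qed.

Let d2 := inf [set Q g | g in M].

Let d2_le g : M g -> d2 <= Q g.
Proof.
move=> Mg; apply: ge_inf; last by exists g.
by exists 0 => _ [g' _ <-]; apply: Rintegral_ge0 => x _; exact: sqr_ge0.
Qed.

(** Parallelogram identity: the midpoint is in [M], hence at squared distance at least [d2] from
    [f], so near-minimisers are close to one another. *)
Let midpoint g g' : M g -> M g' ->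
  \int[mu]_x nrm (g x - g' x) ^+ 2 <= 2 * (Q g - d2) + 2 * (Q g' - d2).
Proof.
move=> Mg Mg'.
pose h x := (2^-1)%:C%C * g x + (2^-1)%:C%C * g' x.
have Mh : M h.
  have h2 : 0 <= (2^-1 : R) <= 1 by rewrite invr_ge0 ler0n invf_le1// ler1n.
  have := Mconvex Mg Mg' h2.
  by have -> : 1 - 2^-1 = 2^-1 :> R by field.
have i1 := iQ Mg; have i2 := iQ Mg'; have i3 := iQ Mh.
have i1' := integrableZl measurableT 2 i1.
have i2' := integrableZl measurableT 2 i2.
have i3' := integrableZl measurableT 4 i3.
have i12 := integrableD measurableT i1' i2'.
have -> : \int[mu]_x nrm (g x - g' x) ^+ 2 = 2 * Q g + 2 * Q g' - 4 * Q h.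
  transitivity (\int[mu]_x (2 * nrm (f x - g x) ^+ 2 + 2 * nrm (f x - g' x) ^+ 2
      - 4 * nrm (f x - h x) ^+ 2)).
    by apply: eq_Rintegral => x _; exact: nrm_parallelogram.
  rewrite RintegralB// RintegralD//.
  by rewrite !(@RintegralZl _ _ _ mu _ (fun x => nrm (f x - _ x) ^+ 2)).
have := d2_le Mh; lra.
Qed.

(** First-order condition at a near-minimiser: along the segment from [g] to [g'] the squared
    distance to [f] is a quadratic in [t] that stays above [d2]. *)
Let variation g g' (t : R) : M g -> M g' -> 0 < t <= 1 ->
  - (Q g - d2) - t ^+ 2 * \int[mu]_x nrm (g x - g' x) ^+ 2
    <= 2 * t * \int[mu]_x rip (f x - g x) (g x - g' x).
Proof.
move=> Mg Mg' /andP[t0 t1].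
have t01 : 0 <= t <= 1 by rewrite ltW.
have := d2_le (Mconvex Mg Mg' t01).
have gB := ess_boundedB (MB Mg) (MB Mg').
have i1 := iQ Mg.
have i2 := ess_bounded_rip (dB Mg) gB.
have i3 := ess_bounded_sqr gB.
have i2' := integrableZl measurableT (2 * t) i2.
have i3' := integrableZl measurableT (t ^+ 2) i3.
have i12 := integrableD measurableT i1 i2'.
suff -> : Q (fun x => (1 - t)%:C%C * g x + t%:C%C * g' x) = Q g
    + 2 * t * (\int[mu]_x rip (f x - g x) (g x - g' x))
    + t ^+ 2 * \int[mu]_x nrm (g x - g' x) ^+ 2 by lra.
have E x : nrm (f x - ((1 - t)%:C%C * g x + t%:C%C * g' x)) ^+ 2 =
    nrm (f x - g x) ^+ 2 + 2 * t * rip (f x - g x) (g x - g' x)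
    + t ^+ 2 * nrm (g x - g' x) ^+ 2.
  have -> : f x - ((1 - t)%:C%C * g x + t%:C%C * g' x) =
      (f x - g x) + t%:C%C * (g x - g' x).
    by rewrite rmorphB rmorph1; ring.
  rewrite nrm_sqrD nrmM nrm_real exprMn real_normK ?num_real//.
  rewrite /rip cReM cImM /= !mul0r subr0 addr0; ring.
rewrite /Q; under eq_Rintegral do rewrite E.
rewrite RintegralD// RintegralD//.
rewrite (@RintegralZl _ _ _ mu _ (fun x => rip _ _))//.
by rewrite (@RintegralZl _ _ _ mu _ (fun x => nrm _ ^+ 2)).
Qed.

(** [k] is the conjugate of f - u, where [u] is the almost everywhere limit of a fast minimising
    sequence. The exact variational bound would be [d2]; the two approximations made below lose at
    most d2/4 each. *)
Theorem weak_separation (e : R) : 0 < e ->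
  (forall g, M g -> (e%:E <= \int[mu]_x (nrm (f x - g x) ^+ 2)%:E)%E) ->
  exists (k : T -> R[i]) (dlt : R), [/\ cmeas k,
    (\int[mu]_x (nrm (k x))%:E < +oo)%E, 0 < dlt &
    forall g, M g -> mu.-integrable setT (fun x => (Re ((f x - g x) * k x))%:E) /\
      dlt <= \int[mu]_x Re ((f x - g x) * k x)].
Proof.
move=> e0 Me.
have QE g : M g -> (\int[mu]_x (nrm (f x - g x) ^+ 2)%:E)%E = (Q g)%:E.
  by move=> Mg; rewrite fineK//; exact: integrable_fin_num (iQ Mg).
have Qe g : M g -> e <= Q g by move=> Mg; rewrite -lee_fin -QE// Me.
have ne : [set Q g | g in M] !=set0 by case: M0 => g Mg; exists (Q g), g.
have d2e : e <= d2 by apply: lb_le_inf => // _ [g Mg <-]; exact: Qe.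
have d20 : 0 < d2 by exact: lt_le_trans d2e.
pose q n : R := 2^-1 ^+ n.
have q0 n : 0 < q n by rewrite exprn_gt0// invr_gt0.
have qS n : q n.+1 = q n / 2 by rewrite /q exprSr.
have q1 n : q n <= 1 by rewrite exprn_ile1// ?invr_ge0// invf_le1// ler1n.
(* The fourth power leaves room: squared increments of order q^4 stay summable after division by
   q^2, and the variation at t = q has an error of order q. *)
have /choice[g Hg] : forall n, exists g, M g /\ Q g < d2 + q n ^+ 4.
  move=> n; have lt_ : d2 < d2 + q n ^+ 4 by rewrite ltrDl exprn_gt0.
  by have [_ [g Mg <-] h] := inf_lt ne lt_; exists g.
have Mg n : M (g n) by have [] := Hg n.
have Qg n : Q (g n) - d2 <= q n ^+ 4 by have [_] := Hg n; rewrite lerBlDl => /ltW.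
have mg n : cmeas (g n) by have [] := MB (Mg n).
pose dl n x := nrm (g n.+1 x - g n x).
have mdl n : mfun (dl n) by apply: cmeas_nrm; exact: cmeasB.
have dl0 n x : 0 <= dl n x by exact: nrm_ge0.
pose w n x := (q n ^- 2) * dl n x ^+ 2.
have mw n : mfun (w n) by apply: measurable_funM => //; exact: measurable_funX.
have w0 n x : 0 <= w n x by rewrite mulr_ge0 ?sqr_ge0// invr_ge0 sqr_ge0.
have wI n : (\int[mu]_x (w n x)%:E <= (4 * q n)%:E)%E.
  have gB := ess_boundedB (MB (Mg n.+1)) (MB (Mg n)).
  have ii := ess_bounded_sqr gB.
  rewrite intZ//; [|exact: measurable_funX|by move=> x; exact: sqr_ge0
    |by rewrite invr_ge0 sqr_ge0].
  rewrite -(fineK (integrable_fin_num measurableT ii)) -EFinM lee_fin.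
  have := midpoint (Mg n.+1) (Mg n); have := Qg n; have := Qg n.+1.
  rewrite -[fine _]/(\int[mu]_x nrm (g n.+1 x - g n x) ^+ 2).
  set i := \int[mu]_x _ => h1 h2 h3.
  rewrite mulrC ler_pdivrMr ?exprn_gt0//.
  have h4 : q n.+1 ^+ 4 <= q n ^+ 4.
    by rewrite lerXn2r ?nnegrE ?(ltW (q0 _))// qS; have := q0 n; lra.
  apply: (@le_trans _ _ (4 * q n ^+ 4)); first by lra.
  rewrite -mulrA -exprS ler_pM2l// (exprSr _ 3) ler_piMr// exprn_ge0//.
  exact: ltW.
have wC n : \sum_(i < n) 4 * q i <= 8.
  rewrite -mulr_sumr; have := geometric_half_le R n; rewrite -/q; lra.
have [W [mW W0 IW wW]] := int_series mw w0 wI wC.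
have dlW : {ae mu, forall x, forall n, \sum_(i < n) dl i x <= 2 * (1 + W x)}.
  apply: filterS wW => x wx n.
  have dq i : dl i x <= q i * (1 + W x).
    have wi : w i x <= W x.
      apply: le_trans (wx i.+1); rewrite big_ord_recr /= lerDr.
      by apply: sumr_ge0.
    have qi := q0 i.
    have : (dl i x / q i) ^+ 2 <= W x by rewrite expr_div_n mulrC.
    set y := dl i x / q i => yW; rewrite mulrC -ler_pdivrMr// -/y.
    have : 0 <= (y - 1) ^+ 2 by exact: sqr_ge0.
    have := sqr_ge0 y; rewrite sqrrB1; lra.
  apply: (@le_trans _ _ (\sum_(i < n) q i * (1 + W x))).
    by apply: ler_sum => i _.
  rewrite -mulr_suml ler_wpM2r ?addr_ge0//; exact: geometric_half_le.
have [u mu_ gu] := ae_ccvg_of_series mg dlW.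
have mf : cmeas f by case: fB.
have g_dom : {ae mu, forall x, forall n, nrm (g n x - u x) <= 4 * (1 + W x)}.
  apply: filterS2 gu dlW => x gx dx.
  have g0n n : nrm (g n x - g 0%N x) <= 2 * (1 + W x).
    apply: le_trans (dx n); elim: n => [|n ih]; first by rewrite subrr big_ord0 nrm0.
    rewrite big_ord_recr /=; apply: le_trans (lerD ih (lexx _)).
    by rewrite [leRHS]addrC; apply: le_trans (nrmD _ _); rewrite addrA subrK.
  have g0u : nrm (g 0%N x - u x) <= 2 * (1 + W x).
    apply: (@cvgn_ge_cst _ (fun n => 2 * (1 + W x) + nrm (g n x - u x))).
      by rewrite -[X in _ --> X]addr0; apply: cvgD => //; exact: cvg_cst.
    move=> n; apply: le_trans (lerD (g0n n) (lexx _)).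
    by rewrite (nrm_distC (g n x) (g 0%N x)); apply: le_trans (nrmD _ _); rewrite addrA subrK.
  move=> n; have := lerD (g0n n) g0u; have := nrmD (g n x - g 0%N x) (g 0%N x - u x).
  rewrite addrA subrK; lra.
have m1W : mfun (fun x => 1 + W x) by exact: measurable_funD.
have W10 x : 0 <= 1 + W x by rewrite addr_ge0.
have I1W : (\int[mu]_x (1 + W x)%:E < +oo)%E.
  rewrite intD//; apply: lte_add_pinfty; last exact: le_lt_trans IW (ltry _).
  by rewrite int_cst mul1e -ge0_fin_numE// fin_num_measure.
have mfu : cmeas (fun x => f x - u x) by exact: cmeasB.
have Ifu : (\int[mu]_x (nrm (f x - u x))%:E < +oo)%E.
  have [mfg0 [c hc]] := dB (Mg 0%N).
  apply: (@le_lt_trans _ _ (\int[mu]_x ((`|c| + 4) * (1 + W x))%:E)%E).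
    apply: int_ae_le => //.
    - exact: cmeas_nrm.
    - exact: measurable_funM.
    - by move=> x; exact: nrm_ge0.
    - by move=> x; rewrite mulr_ge0// addr_ge0.
    apply: filterS2 hc g_dom => x h1 /(_ 0%N) h2.
    have := nrmD (f x - g 0%N x) (g 0%N x - u x); rewrite addrA subrK => h3.
    apply: le_trans h3 _; rewrite mulrDl; apply: lerD => //.
    apply: le_trans h1 _; apply: le_trans (ler_norm _) _.
    by rewrite ler_peMr// lerDl.
  by rewrite intZ// ?addr_ge0// lte_mul_pinfty// lee_fin addr_ge0.
exists (fun x => ((f x - u x)^*)%C), (d2 / 2); split.
- case: mfu => m1 m2; split.
    have -> : (fun x => Re ((f x - u x)^*)%C) = (fun x => Re (f x - u x)).
      by apply/funext => x; case: (f x - u x).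
    exact: m1.
  have -> : (fun x => Im ((f x - u x)^*)%C) = (fun x => - Im (f x - u x)).
    by apply/funext => x; case: (f x - u x).
  exact: measurable_funN.
- by under eq_integral do rewrite nrm_conj.
- by rewrite divr_gt0.
move=> h Mh; have hB := dB Mh; have [mh [c hc]] := hB.
have ipE x : Re ((f x - h x) * ((f x - u x)^*)%C) = rip (f x - u x) (f x - h x).
  by rewrite -ripE /rip mulrC [X in _ + X]mulrC.
have ifu := rip_integrable mfu hB Ifu.
split; first by under eq_fun do rewrite ipE.
under eq_Rintegral do rewrite ipE.
pose Bh := 4 * (d2 + 1) + 4 * Q h.
have Q0 g' : 0 <= Q g' by apply: Rintegral_ge0 => x _; exact: sqr_ge0.
have Bh0 : 0 <= Bh by rewrite addr_ge0// mulr_ge0// addr_ge0// ltW.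
(* The variation at t = q_n, divided by 2t: both the excess of [Q (g n)] over [d2] and the quadratic
   term contribute O(q_n). *)
have lowerJ n : d2 - q n * (1 + Bh) <= \int[mu]_x rip (f x - g n x) (f x - h x).
  have gh := ess_boundedB (MB (Mg n)) (MB Mh).
  have -> : \int[mu]_x rip (f x - g n x) (f x - h x) =
      Q (g n) + \int[mu]_x rip (f x - g n x) (g n x - h x).
    rewrite -RintegralD//; [|exact: iQ|exact: ess_bounded_rip (dB (Mg n)) gh].
    apply: eq_Rintegral => x _; rewrite -rip_self -ripDr; congr rip.
    by rewrite addrA subrK.
  have v := variation (Mg n) Mh (_ : 0 < q n <= 1).
  have {v} := v (introT andP (conj (q0 n) (q1 n))).
  have := midpoint (Mg n) Mh; have := Qg n; have := d2_le (Mg n); have := d2_le Mh.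
  set i := \int[mu]_x nrm _ ^+ 2; set j := \int[mu]_x rip _ _.
  set qq := q n => h1 h2 h3 h4 h5.
  have qq0 : 0 < qq by exact: q0.
  have qq1 : qq <= 1 by exact: q1.
  have q41 : qq ^+ 4 <= 1 by rewrite exprn_ile1// ltW.
  have q43 : qq ^+ 4 <= qq ^+ 2 by rewrite (exprD _ 2 2) ler_piMr ?sqr_ge0// exprn_ile1// ltW.
  have iBh : i <= Bh by rewrite /Bh; have := d20; lra.
  have i0 : 0 <= i by apply: Rintegral_ge0 => x _; exact: sqr_ge0.
  have h6 : - (qq ^+ 2) - qq ^+ 2 * Bh <= 2 * qq * j.
    apply: le_trans h5; apply: lerB; first by rewrite lerN2; lra.
    by rewrite ler_wpM2l ?sqr_ge0.
  have h7 : - (qq * (1 + Bh)) <= 2 * j.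
    rewrite -(ler_pM2l qq0); move: h6; rewrite expr2; lra.
  have : 0 <= qq * (1 + Bh) by apply: mulr_ge0; [exact: ltW|rewrite addr_ge0].
  lra.
have [N hN] : exists N, q N * (1 + Bh) <= d2 / 4.
  have B1 : 0 < 1 + Bh by rewrite ltr_pwDl.
  have : (fun n => q n) @ \oo --> (0 : R).
    by apply: cvg_expr; rewrite ger0_norm ?invr_ge0// invf_lt1// ltr1n.
  have d4B : 0 < d2 / 4 / (1 + Bh) by rewrite !divr_gt0.
  move=> /cvgr0Pnorm_lt/(_ _ d4B) [N _ /(_ N (leqnn N))] hN; exists N.
  by rewrite -ler_pdivlMr//; apply: ltW; move: hN; rewrite ger0_norm// ltW.
have d40 : 0 < d2 / 4 by rewrite divr_gt0.
have mfh : mfun (fun x => nrm (f x - h x)) by exact: cmeas_nrm.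
have [||||||| n hn] := @int_cvg0 _ _ _ mu
  (fun n x => nrm (g (n + N)%N x - u x) * nrm (f x - h x))
  (fun x => 4 * `|c| * (1 + W x)) _ d40.
- by move=> n; apply: measurable_funM => //; apply: cmeas_nrm; exact: cmeasB.
- exact: measurable_funM.
- by move=> n x; rewrite mulr_ge0 ?nrm_ge0.
- by move=> x; rewrite mulr_ge0// mulr_ge0.
- by rewrite intZ ?mulr_ge0// lte_mul_pinfty// lee_fin mulr_ge0.
- apply: filterS2 hc g_dom => x h1 h2 n.
  rewrite mulrAC; apply: ler_pM; rewrite ?nrm_ge0//.
  by apply: le_trans h1 _; exact: ler_norm.
- apply: filterS gu => x gx; rewrite -[0](mul0r (nrm (f x - h x))).
  apply: cvgM; last exact: cvg_cst.
  by rewrite (cvg_shiftn N (fun n => nrm (g n x - u x))).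
have [mgn [cn hcn]] := dB (Mg (n + N)%N).
have idiff := ess_bounded_rip (dB (Mg (n + N)%N)) hB.
have diff : \int[mu]_x rip (f x - g (n + N)%N x) (f x - h x) - d2 / 4 <=
    \int[mu]_x rip (f x - u x) (f x - h x).
  rewrite lerBlDr -lerBlDl -RintegralB//.
  pose b x := nrm (g (n + N)%N x - u x) * nrm (f x - h x).
  have mb : mfun b.
    by apply: measurable_funM => //; apply: cmeas_nrm; exact: cmeasB.
  have b0 x : 0 <= b x by rewrite mulr_ge0 ?nrm_ge0.
  have Ib := lt_trans hn (ltry _).
  have ib := int_integrable mb b0 Ib.
  apply: (@le_trans _ _ (\int[mu]_x b x)); last by rewrite -lee_fin -intE// ltW.
  apply: le_Rintegral => //.
    by have := integrableB measurableT idiff ifu.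
  move=> x _; rewrite -ripBl; apply: le_trans (ler_norm _) _.
  apply: le_trans (rip_le _ _) _; rewrite /b ler_wpM2r ?nrm_ge0//.
  by rewrite opprB addrC addrA subrK addrC nrm_distC addrC.
have qN : q (n + N)%N <= q N.
  by rewrite /q exprD ler_piMl ?exprn_ge0 ?invr_ge0// exprn_ile1 ?invr_ge0// invf_le1// ler1n.
have := lowerJ (n + N)%N.
have : q (n + N)%N * (1 + Bh) <= q N * (1 + Bh) by rewrite ler_wpM2r// addr_ge0.
lra.
Qed.

End WeakSeparation.

(** * Representing measures of a uniform algebra *)

Section RealMeasures.
Context (R : realType) (X : ptopologicalType).
Implicit Types (u v : real_measure R X) (B : set (Borel X)).

Lemma real_measureD u v B : (u + v) B = u B + v B.
Proof. by []. Qed.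

Lemma real_measureZ (a : R) u B : (a *: u) B = a * u B.
Proof. by []. Qed.

Lemma real_measureN u B : (- u) B = - u B.
Proof. by rewrite -scaleN1r real_measureZ mulN1r. Qed.

Lemma real_measure_sum n (c : 'I_n -> R) (u : 'I_n -> real_measure R X) B :
  (\sum_i c i *: u i) B = \sum_i c i * u i B.
Proof.
elim/big_rec2 : _ => [|i y1 y2 _ <-]; first by rewrite -(scale0r 0) real_measureZ mul0r.
by rewrite real_measureD real_measureZ.
Qed.

Lemma real_measure_ofE (m : {finite_measure set (Borel X) -> \bar R}) B :
  measurable B -> real_measure_of m B = fine (m B).
Proof. by move=> mB; rewrite /= /borel_part; case: asboolP. Qed.

Lemma real_measure_of_le (m : {finite_measure set (Borel X) -> \bar R}) B :
  0 <= real_measure_of m B <= fine (m setT).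
Proof.
rewrite /= /borel_part; case: asboolP => mB; last by rewrite lexx /= fine_ge0.
rewrite fine_ge0//= fine_le ?fin_num_measure// le_measure ?inE//.
Qed.

Lemma mem_affine_span (V : lmodType R) (W : set V) x : W x -> affine_span W x.
Proof.
move=> Wx; exists 1%N, (fun _ => x), (fun _ => 1); split => //.
- by rewrite big_ord_recl big_ord0 addr0.
- by rewrite big_ord_recl big_ord0 addr0 scale1r.
Qed.

(** The spanning points [w i] need not lie in [W], but each is an affine combination of elements of
    [W] and so inherits a domination by [b]. Interpolation expresses [u] through its values on
    finitely many sets, all bounded by 1, so the constant does not depend on [u]. *)
Lemma finite_dimensional_bound (W : set (real_measure R X)) (b : set (Borel X) -> R) :
  finite_dimensional W -> (forall B, 0 <= b B) ->
  (forall u, W u -> (forall B, `|u B| <= 1) /\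
    exists2 K, 0 <= K & forall B, `|u B| <= K * b B) ->
  exists2 C, 0 <= C & forall u, W u -> forall B, u B <= C * b B.
Proof.
move=> [n [w spanE]] b0 Wb.
have wb i : exists2 K, 0 <= K & forall B, `|w i B| <= K * b B.
  have : affine_span W (w i) by rewrite spanE; apply: mem_affine_span; exists i.
  move=> [N [v [c [Wv _ ->]]]].
  have /choice[K HK] : forall j, exists K, 0 <= K /\ forall B, `|v j B| <= K * b B.
    by move=> j; have [_ [K K0 h]] := Wb _ (Wv j); exists K.
  exists (\sum_j `|c j| * K j).
    by apply: sumr_ge0 => j _; rewrite mulr_ge0//; have [] := HK j.
  move=> B; rewrite real_measure_sum mulr_suml; apply: le_trans (ler_norm_sum _ _ _) _.
  by apply: ler_sum => j _; rewrite normrM -mulrA ler_wpM2l//; have [] := HK j.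
have /choice[Kw HKw] : forall i, exists K, 0 <= K /\ forall B, `|w i B| <= K * b B.
  by move=> i; have [K K0 h] := wb i; exists K.
have [k [t [P HP]]] := interpolation (fun i B => w i B).
exists (\sum_(j < k) \sum_(i < n) Kw i * `|P i j|).
  apply: sumr_ge0 => j _; apply: sumr_ge0 => i _; rewrite mulr_ge0//.
  by have [] := HKw i.
move=> u Wu; have [u1 _] := Wb _ Wu.
have [N [v [c [vw _ uE]]]] : affine_span (range w) u.
  by rewrite -spanE; exact: mem_affine_span.
have /choice[f Hf] : forall j, exists i, w i = v j.
  by move=> j; have [i _ h] := vw j; exists i.
(* A point of the range may occur several times in the combination; its coefficients are
   collected. *)
pose c' i := \sum_(j | f j == i) c j.
have uB B : u B = \sum_i c' i * w i B.
  rewrite uE real_measure_sum (partition_big f xpredT)//=.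
  apply: eq_bigr => i _; rewrite /c' mulr_suml; apply: eq_bigr => j /eqP <-.
  by rewrite Hf.
move=> B; rewrite uB HP.
apply: le_trans (ler_norm _) _; apply: le_trans (ler_norm_sum _ _ _) _.
rewrite mulr_suml; apply: ler_sum => j _; rewrite -uB normrM.
apply: le_trans (ler_piMr _ (u1 _)) _; first exact: normr_ge0.
rewrite mulr_suml; apply: le_trans (ler_norm_sum _ _ _) _.
apply: ler_sum => i _; rewrite normrM mulrAC ler_wpM2r//.
by have [] := HKw i.
Qed.

End RealMeasures.

Section RepresentingAlgebra.
Context (R : realType) (X : ptopologicalType).
Variables (A : set (X -> R[i])) (phi : (X -> R[i]) -> R[i]).
Variable m : {finite_measure set (Borel X) -> \bar R}.
Hypotheses (Xc : compact [set: X]) (Xh : hausdorff_space X).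
Hypotheses (uA : uniform_algebra A) (mphi : multiplicative_functional A phi).

Lemma open_borel (U : set X) : open U -> measurable (U : set (Borel X)).
Proof. by move=> oU; exact: sub_sigma_algebra. Qed.

Lemma compact_borel (K : set X) : compact K -> measurable (K : set (Borel X)).
Proof.
move=> cK; rewrite -(setCK (K : set (Borel X))); apply: measurableC.
by apply: open_borel; apply: closed_openC; exact: compact_closed Xh cK.
Qed.

Lemma continuous_bmeas (f : X -> R) : continuous f -> bmeas (f : Borel X -> R).
Proof.
move=> cf; split.
  apply: (measurability _ (RGenOpens.measurableE R)).
  move=> _ [_ [a [b ->] <-]]; rewrite setTI; apply: open_borel.
  by move/continuousP: cf; apply; exact: interval_open.
have : compact (f @` setT).
  by apply: continuous_compact => //; exact: continuous_subspaceT.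
move=> /compact_bounded[M [_ hM]]; exists (M + 1) => x.
by apply: (hM (M + 1)); [rewrite ltrDl|exists x].
Qed.

Lemma continuous_Re (f : X -> R[i]) : continuous (f : X -> R[i]^o) ->
  continuous (fun x => Re (f x)).
Proof.
move=> cf x; apply/cvgrPdist_lt => e e0.
have e0' : 0 < e%:C%C :> R[i] by rewrite ltcR.
have /cvgrPdist_lt/(_ _ e0') := cf x; apply: filterS => y.
rewrite -cReN -cReD => h; apply: le_lt_trans (Re_le_nrm _) _.
by rewrite -ltcR.
Qed.

Lemma continuous_Im (f : X -> R[i]) : continuous (f : X -> R[i]^o) ->
  continuous (fun x => Im (f x)).
Proof.
move=> cf x; apply/cvgrPdist_lt => e e0.
have e0' : 0 < e%:C%C :> R[i] by rewrite ltcR.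
have /cvgrPdist_lt/(_ _ e0') := cf x; apply: filterS => y.
rewrite -cImN -cImD => h; apply: le_lt_trans (Im_le_nrm _) _.
by rewrite -ltcR.
Qed.

Lemma uniform_algebra_bmeas a : A a ->
  bmeas ((fun x => Re (a x)) : Borel X -> R) /\ bmeas ((fun x => Im (a x)) : Borel X -> R).
Proof.
move=> Aa; have [Ac _ _ _ _] := uA; have ca := Ac _ Aa.
by split; apply: continuous_bmeas; [exact: continuous_Re|exact: continuous_Im].
Qed.

(** phi is nonzero at some f, so phi(f) phi(1) = phi(f) gives phi(1) = 1. *)
Lemma representing_mass nu : representing A phi nu -> nu setT = 1%E.
Proof.
have [_ _ Acst _ _] := uA; have [[f Af f0] _ _ phiM] := mphi.
move=> [_ nuE]; have := phiM _ _ Af (Acst 1).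
rewrite (_ : f \* cst 1 = f); last by apply/funext => x; rewrite /= mulr1.
rewrite -{1}[phi f]mulr1 => /(mulfI f0); rewrite nuE// => /(congr1 (@complex.Re R)).
rewrite /Cintegral /= Rintegral_cst// mul1r => h.
by rewrite -[LHS](@fineK R) ?fin_num_measure// -h.
Qed.

(** The core property in the direction nu - m yields e > 0 for which m - e (nu - m) is a positive
    measure, that is, e nu <= (1 + e) m. *)
Lemma core_dominates nu : core_measure A phi m -> representing A phi nu ->
  exists2 K, 0 <= K & forall B, real_measure_of nu B <= K * real_measure_of m B.
Proof.
move=> [_ core] rnu.
have := core (real_measure_of nu - real_measure_of m).
rewrite addrC subrK => /(_ (ex_intro2 _ _ _ rnu erefl)) H.
have [e [[sg _ sgE] e0]] := filter_ex (filterI H (nbhs_right_gt (0 : R))).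
exists ((1 + e) / e); first by rewrite divr_ge0 ?addr_ge0// ltW.
move=> B; have /andP[h _] := real_measure_of_le sg B.
move: h; rewrite sgE real_measureD real_measureN real_measureZ real_measureD real_measureN.
by rewrite mulrAC ler_pdivlMr//; lra.
Qed.

(** Passing to [real_measure] forgets the values off the Borel sets, so [m] is only known to
    coincide on Borel sets with a representing measure. *)
Lemma core_representing : core_measure A phi m -> exists2 nu, representing A phi nu &
  forall B, measurable B -> m B = nu B.
Proof.
move=> [[nu rnu nuE] _]; exists nu => // B mB.
have : real_measure_of nu B = real_measure_of m B by rewrite nuE.
rewrite !real_measure_ofE// => h.
by rewrite -[LHS](@fineK R) ?fin_num_measure// -h fineK// fin_num_measure.
Qed.

Lemma core_dominating : finite_dimensional (representing_measures A phi) ->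
  core_measure A phi m ->
  exists2 C, 0 <= C & forall nu, representing A phi nu ->
    forall B, measurable B -> fine (nu B) <= C * fine (m B).
Proof.
move=> fd core.
have [||C C0 HC] := finite_dimensional_bound (b := real_measure_of m) fd.
- by move=> B; have /andP[] := real_measure_of_le m B.
- move=> _ [nu rnu <-]; split => [B|].
    have /andP[h1 h2] := real_measure_of_le nu B.
    by rewrite ger0_norm// (le_trans h2)// representing_mass.
  have [K K0 HK] := core_dominates core rnu; exists K => // B.
  by have /andP[h1 h2] := real_measure_of_le nu B; rewrite ger0_norm.
exists C => // nu rnu B mB; have := HC (real_measure_of nu) _ B.
by rewrite !real_measure_ofE//; apply; exists nu.
Qed.

Theorem uniform_algebra_dominating : finite_dimensional (representing_measures A phi) ->
  core_measure A phi m -> exists C, dominating_algebra m A C.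
Proof.
move=> fd core; have [C C0 HC] := core_dominating fd core.
have [rho [rreg rphi] mrho] := core_representing core.
have int_eq (f : Borel X -> R) : \int[m]_x f x = \int[rho]_x f x.
  by congr fine; apply: eq_measure_integral => B mB _; exact: mrho.
have phiE a : A a -> phi a = (\int[m]_x Re (a x) +i* \int[m]_x Im (a x))%C.
  by move=> Aa; rewrite !int_eq rphi.
have [_ _ Acst [AD AZ AM] _] := uA; have [_ _ _ phiM] := mphi.
exists C; split.
- exact: uniform_algebra_bmeas.
- exact: Acst.
- exact: AD.
- exact: AM.
- move=> a b Aa Ab; have := phiM _ _ Aa Ab.
  rewrite !phiE//; last exact: AM.
  by move=> /eqP; rewrite eq_complex /= => /andP[/eqP h1 /eqP h2].
- by rewrite mrho// representing_mass.
(* Absolute continuity transfers regularity to [nu]; this is why [alg_dom] is stated for absolutely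
   continuous measures. *)
move=> nu nuac nuA; apply: HC; split.
  move=> B mB e e0; have e20 : 0 < e / 2 by rewrite divr_gt0.
  have [dlt dlt0 Hdlt] := nuac _ e20.
  have [K [U [cK oU KB BU UK]]] := rreg B mB dlt dlt0.
  exists K, U; split => //.
  have mUK : measurable (U `\` K : set (Borel X)).
    by apply: measurableD; [exact: open_borel|exact: compact_borel].
  apply: (@le_lt_trans _ _ (e / 2)%:E); first by apply: Hdlt => //; rewrite mrho.
  by rewrite lte_fin ltr_pdivrMr// ltr_pMr// ltr1n.
move=> f Af; rewrite phiE// /Cintegral; congr (_ +i* _)%C; first by rewrite nuA.
(* Imaginary parts follow from real parts applied to -i f, which is in [A]. *)
have := nuA (fun x => (0 +i* (-1))%C * f x) (AZ _ _ Af).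
under eq_Rintegral do rewrite cReM /= mul0r sub0r mulN1r opprK.
under [in X in _ = X]eq_Rintegral do rewrite cReM /= mul0r sub0r mulN1r opprK.
by [].
Qed.

End RepresentingAlgebra.

(** * Invariant subspaces *)

Lemma lte_scaled_sum (R : realType) (c e : R) (x y : \bar R) : 0 < c ->
  (x < (e / c / 2)%:E)%E -> (y < (e / c / 2)%:E)%E -> (c%:E * (x + y) < e%:E)%E.
Proof.
move=> c0 xe ye; have -> : e = c * (e / c / 2 + e / c / 2) by field; rewrite gt_eqF.
by rewrite EFinM lte_pmul2l ?lte_fin// EFinD lteD.
Qed.

(** * Integrals of powers in place of norms *)

Section PowerIntegrals.
Context d (T : measurableType d) (R : realType).
Variable mu : {finite_measure set T -> \bar R}.
Local Notation mfun f := (measurable_fun [set: T] f).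

Definition pint (r : R) (f : T -> R[i]) : \bar R := (\int[mu]_x (nrm (f x) `^ r)%:E)%E.

Lemma pint_ge0 r f : (0 <= pint r f)%E.
Proof. by apply: int_ge0 => x; exact: powR_ge0. Qed.

Lemma cmeas_pow (r : R) f : cmeas f -> mfun (fun x => nrm (f x) `^ r).
Proof. by move=> mf; apply: mfun_powR; exact: cmeas_nrm. Qed.

Lemma pintB r (f : T -> R[i]) : pint r (fun x => f x - f x)%R = pint r (cst 0).
Proof. by congr (\int[_]_(_ in _) _)%E; apply/funext => x; rewrite subrr. Qed.

Lemma pint0 r : 0 < r -> pint r (cst 0) = 0%E.
Proof.
move=> r0; rewrite -(integral0 mu setT); apply: eq_integral => x _.
by rewrite -[cst 0 x]/(0 : R[i]) nrm0 powR0// gt_eqF.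
Qed.

Lemma pint1 f : pint 1 f = (\int[mu]_x (nrm (f x))%:E)%E.
Proof. by apply: eq_integral => x _; rewrite powRr1// nrm_ge0. Qed.

Lemma pint_tri r (f g h : T -> R[i]) : 0 < r -> cmeas f -> cmeas g -> cmeas h ->
  (pint r (fun x => f x - h x)%R <= (3 `^ r)%:E *
    (pint r (fun x => f x - g x)%R + pint r (fun x => g x - h x)%R))%E.
Proof.
move=> r0 mf mg mh.
have m1 := cmeas_pow r (cmeasB mf mg); have m2 := cmeas_pow r (cmeasB mg mh).
rewrite /pint -intD//; try by move=> x; exact: powR_ge0.
rewrite -intZ ?powR_ge0//; [|exact: measurable_funD|by move=> x; rewrite addr_ge0 ?powR_ge0].
apply: int_le.
- exact: cmeas_pow (cmeasB mf mh).
- by apply: measurable_funM => //; exact: measurable_funD.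
- by move=> x; exact: powR_ge0.
move=> x; apply: le_trans (powR_add_le r0 (nrm_ge0 _) (nrm_ge0 _)).
apply: powR_le; [exact: ltW|exact: nrm_ge0|].
by apply: le_trans (nrmD _ _); rewrite addrA subrK.
Qed.

Lemma pintD r (f g : T -> R[i]) : 0 < r -> cmeas f -> cmeas g ->
  (pint r (fun x => f x + g x)%R <= (3 `^ r)%:E * (pint r f + pint r g))%E.
Proof.
move=> r0 mf mg; have mg' : cmeas (fun x => 0 - g x).
  by apply: cmeasB => //; exact: cmeas_cst.
have := pint_tri r0 mf (cmeas_cst T 0) mg'.
have E u v : (forall x, nrm (u x) = nrm (v x)) -> pint r u = pint r v.
  by move=> uv; congr (\int[_]_(_ in _) _)%E; apply/funext => x; rewrite uv.
rewrite (E (fun x => f x - (0 - g x)) (fun x => f x + g x)); last first.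
  by move=> x; rewrite sub0r opprK.
rewrite (E (fun x => f x - cst 0 x) f); last by move=> x; rewrite subr0.
rewrite (E (fun x => cst 0 x - (0 - g x)) g)// => x.
by rewrite -[cst 0 x]/(0 : R[i]) !sub0r opprK.
Qed.

Lemma pint_bounded r (a f : T -> R[i]) (c : R) : 0 < r -> cmeas a -> cmeas f ->
  {ae mu, forall x, nrm (a x) <= c} ->
  (pint r (fun x => a x * f x)%R <= (`|c| `^ r)%:E * pint r f)%E.
Proof.
move=> r0 ma mf ac; have mfr := cmeas_pow r mf.
have fr0 x : 0 <= nrm (f x) `^ r by exact: powR_ge0.
rewrite /pint -intZ ?powR_ge0//; apply: int_ae_le.
- exact: cmeas_pow (cmeasM ma mf).
- exact: measurable_funM.
- by move=> x; exact: powR_ge0.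
- by move=> x; rewrite mulr_ge0 ?powR_ge0.
apply: filterS ac => x h; rewrite nrmM powRM ?nrm_ge0// ler_wpM2r//.
by apply: powR_le; [exact: ltW|exact: nrm_ge0|rewrite (le_trans h)// ler_norm].
Qed.

(** Cut at height [t]: below it u^r <= t^r, above it u^(r - r') <= t^(r - r'). *)
Lemma powR_lower_le (u t r r' : R) : 0 < r -> r < r' -> 0 < t -> 0 <= u ->
  u `^ r <= t `^ r + t `^ (r - r') * u `^ r'.
Proof.
move=> r0 rr' t0 u0; have [ut|tu] := leP u t.
  apply: le_trans (powR_le (ltW r0) u0 ut) _.
  by rewrite lerDl mulr_ge0// powR_ge0.
have u0' : 0 < u by exact: lt_trans tu.
have -> : u `^ r = u `^ (r - r') * u `^ r'.
  by rewrite -powRD ?subrK// (gt_eqF u0') implybT.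
apply: ler_wpDl; first exact: powR_ge0.
rewrite ler_wpM2r ?powR_ge0// -opprB !powRN lef_pV2 ?posrE ?powR_gt0//.
apply: powR_le; [|exact: ltW|exact: ltW].
by rewrite subr_ge0 ltW.
Qed.

Lemma pint_lower (f : T -> R[i]) (t r r' : R) : 0 < r -> r < r' -> 0 < t -> cmeas f ->
  (pint r f <= (t `^ r)%:E * mu setT + (t `^ (r - r'))%:E * pint r' f)%E.
Proof.
move=> r0 rr' t0 mf; have mr := cmeas_pow r mf; have mr' := cmeas_pow r' mf.
rewrite /pint -int_cst -intZ ?powR_ge0//; last by move=> x; exact: powR_ge0.
rewrite -(@intD _ _ _ mu (cst _))//; last 3 first.
- exact: measurable_funM.
- by move=> x; exact: powR_ge0.
- by move=> x; rewrite mulr_ge0 ?powR_ge0.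
apply: int_le => //.
- by apply: measurable_funD => //; exact: measurable_funM.
- by move=> x; exact: powR_ge0.
- by move=> x; apply: powR_lower_le => //; exact: nrm_ge0.
Qed.

Lemma pint_small_lower (r r' e : R) : mu setT = 1%E -> 0 < r -> r < r' -> 0 < e ->
  exists2 e' : R, 0 < e' & forall f, cmeas f -> (pint r' f < e'%:E)%E ->
    (pint r f < e%:E)%E.
Proof.
(* This cut spends e/2 on the small values; [e'] is chosen to spend the other half on the large
   ones. *)
move=> mu1 r0 rr' e0; pose t := (e / 2) `^ r^-1.
have e20 : 0 < e / 2 by rewrite divr_gt0.
have t0 : 0 < t by exact: powR_gt0.
have tr : t `^ r = e / 2 by rewrite /t -powRrM mulVf ?gt_eqF// powRr1// ltW.
have tp : 0 < t `^ (r - r') by exact: powR_gt0.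
exists (e / 2 / t `^ (r - r')); first by rewrite divr_gt0.
move=> f mf hf; apply: le_lt_trans (pint_lower r0 rr' t0 mf) _.
rewrite -[X in (_ * X + _)%E]/(mu setT) mu1 mule1 tr [in ltRHS](splitr e) EFinD.
rewrite lteD2lE//.
apply: (@lt_le_trans _ _ ((t `^ (r - r'))%:E * (e / 2 / t `^ (r - r'))%:E)%E).
  by rewrite lte_pmul2l.
by rewrite -EFinM lee_fin mulrC divfK// gt_eqF.
Qed.

End PowerIntegrals.
Arguments pint {d T R}.

Section LpSpaces.
Context (R : realType) (X : ptopologicalType).
Variable m : {finite_measure set (Borel X) -> \bar R}.
Hypothesis m1 : m setT = 1%E.

Lemma CLnormE (r : R) f : CLnorm m r%:E f = (pint m r f `^ r^-1)%E.
Proof.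
rewrite /CLnorm unlock (eq_integral (fun x : Borel X => (nrm (f x) `^ r)%:E))// => x _.
by rewrite abse_EFin poweR_EFin ger0_norm ?nrm_ge0.
Qed.

Lemma CLnorm_lt (r e : R) f : 0 < r -> 0 < e ->
  (CLnorm m r%:E f < e%:E)%E = (pint m r f < (e `^ r)%:E)%E.
Proof.
move=> r0 e0; rewrite CLnormE; have := pint_ge0 m r f.
have ri0 : r^-1 != 0 by rewrite gt_eqF// invr_gt0.
case: (pint m r f) => [j|_|//]; last by rewrite poweRyr.
rewrite lee_fin => j0; rewrite poweR_EFin !lte_fin.
have e1 : (e `^ r) `^ r^-1 = e by rewrite -powRrM mulfV ?gt_eqF// powRr1// ltW.
have je : (j `^ r^-1) `^ r = j by rewrite -powRrM mulVf ?gt_eqF// powRr1.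
apply/idP/idP => h.
  by rewrite -je; apply: gt0_ltr_powR => //; rewrite nnegrE ?powR_ge0// ltW.
by rewrite -e1; apply: gt0_ltr_powR; rewrite ?invr_gt0// nnegrE// powR_ge0.
Qed.

Lemma CLspace_fin (r : R) f : 0 < r ->
  CLspace m r%:E f <-> cmeas (f : Borel X -> R[i]) /\ (pint m r f < +oo)%E.
Proof.
move=> r0; have E : (CLnorm m r%:E f < +oo)%E = (pint m r f < +oo)%E.
  rewrite CLnormE; have ri0 : r^-1 != 0 by rewrite gt_eqF// invr_gt0.
  case: (pint m r f) (pint_ge0 m r f) => [j|_|//]; last by rewrite poweRyr.
  by rewrite poweR_EFin !ltry.
split; first by move=> [h1 h2]; rewrite E.
by move=> [[h1 h2]]; rewrite -E.
Qed.

Lemma CLspace_infty f : CLspace m +oo%E f <-> ess_bounded m (f : Borel X -> R[i]).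
Proof.
(* The L^oo norm is defined as an essential supremum only for a measure of positive mass, which [m1]
   provides. *)
have nE : CLnorm m +oo%E f = ess_sup m (abse \o (fun x => (nrm (f x))%:E)).
  by rewrite /CLnorm unlock ifT// -[X in (_ < X)%E]/(m setT) m1.
split => [[h1 h2]|[[h1 h2] [c hc]]].
  rewrite nE => h3; split => //.
  have h := ess_sup_ge m (abse \o (fun x => (nrm (f x))%:E)).
  move: h h3; case: (ess_sup _ _) => [c|//|] h _.
    exists c; apply: filterS h => x /=.
    by rewrite lee_fin ger0_norm ?nrm_ge0.
  by exists 0; apply: filterS h => x.
split => //; rewrite nE; apply: (@le_lt_trans _ _ c%:E); last exact: ltry.
apply/ess_supP; apply: filterS hc => x /=.
by rewrite lee_fin ger0_norm ?nrm_ge0.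
Qed.

Lemma ess_bounded_pint (r : R) (f : Borel X -> R[i]) : 0 < r -> ess_bounded m f ->
  (pint m r f < +oo)%E.
Proof.
move=> r0 [mf [c fc]].
have := pint_bounded r0 mf (cmeas_cst _ 1) fc.
rewrite (_ : (fun x => f x * _) = f); last by apply/funext => x; rewrite mulr1.
move=> /le_lt_trans; apply; rewrite /pint.
rewrite (eq_integral (fun _ => 1%E)); last first.
  by move=> x _; rewrite -[cst 1 x]/(1 : R[i]) nrm1 powR1.
by rewrite int_cst -[X in (_ * (_ * X))%E]/(m setT) m1 !mule1 ltry.
Qed.

Lemma CLspace_cmeas q f : CLspace m q f -> cmeas (f : Borel X -> R[i]).
Proof. by case. Qed.

Lemma ess_bounded_CLspace q f : (0 < q)%E -> ess_bounded m (f : Borel X -> R[i]) ->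
  CLspace m q f.
Proof.
case: q => [r||//] r0 fB; last exact/CLspace_infty.
by apply/(CLspace_fin _ r0); split; [case: fB|exact: ess_bounded_pint].
Qed.

Lemma CLspace_lower (r : R) q f : 0 < r -> (r%:E < q)%E -> CLspace m q f ->
  CLspace m r%:E f.
Proof.
move=> r0; case: q => [r'|_|//]; last first.
  by move=> /CLspace_infty; exact: ess_bounded_CLspace.
rewrite lte_fin => rr'; have r'0 : 0 < r' by exact: lt_trans rr'.
move=> /(CLspace_fin _ r'0)[mf If]; apply/(CLspace_fin _ r0); split; first exact: mf.
apply: le_lt_trans (pint_lower m r0 rr' ltr01 mf) _.
rewrite -[X in (_ * X + _)%E]/(m setT) m1 !powR1 !mul1e.
by apply: lte_add_pinfty => //; exact: ltry.
Qed.

Lemma CLspaceD q f g : (0 < q)%E -> CLspace m q f -> CLspace m q g ->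
  CLspace m q (f \+ g).
Proof.
case: q => [r||//] r0; last first.
  move=> /CLspace_infty[mf [c fc]] /CLspace_infty[mg [c' gc']].
  apply/CLspace_infty; split; first exact: cmeasD.
  exists (c + c'); apply: filterS2 fc gc' => x h1 h2.
  by apply: le_trans (nrmD _ _) _; exact: lerD.
move=> /(CLspace_fin _ r0)[mf If] /(CLspace_fin _ r0)[mg Ig].
apply/(CLspace_fin _ r0); split; first exact: cmeasD.
apply: le_lt_trans (pintD m r0 mf mg) _.
have IfIg := lte_add_pinfty If Ig.
by apply: (lte_mul_pinfty _ _ IfIg); rewrite ?lee_fin ?powR_ge0.
Qed.

Lemma CLspaceM q a f : (0 < q)%E -> ess_bounded m (a : Borel X -> R[i]) ->
  CLspace m q f -> CLspace m q (a \* f).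
Proof.
case: q => [r||//] r0 [ma [c ac]]; last first.
  move=> /CLspace_infty[mf [c' fc']].
  apply/CLspace_infty; split; first exact: cmeasM.
  exists (c * c'); apply: filterS2 ac fc' => x h1 h2.
  by rewrite nrmM ler_pM ?nrm_ge0.
move=> /(CLspace_fin _ r0)[mf If].
apply/(CLspace_fin _ r0); split; first exact: cmeasM.
apply: le_lt_trans (pint_bounded r0 ma mf ac) _.
by apply: lte_mul_pinfty; [rewrite lee_fin powR_ge0| |].
Qed.

Lemma norm_closureP (r : R) M f : 0 < r -> norm_closure m r%:E M f <->
  CLspace m r%:E f /\ forall e : R, 0 < e ->
    exists2 g, M g & (pint m r (fun x => f x - g x)%R < e%:E)%E.
Proof.
move=> r0; split => -[fC H]; split => // e e0.
  have er0 : 0 < e `^ r^-1 by exact: powR_gt0.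
  have [g Mg] := H _ er0; rewrite CLnorm_lt// => h; exists g => //.
  by move: h; rewrite -powRrM mulVf ?gt_eqF// powRr1// ltW.
have er0 : 0 < e `^ r by exact: powR_gt0.
by have [g Mg h] := H _ er0; exists g => //; rewrite CLnorm_lt.
Qed.

Lemma fine_abs_lt (x : \bar R) (e : R) : (`|x| < e%:E)%E -> `|fine x| < e.
Proof. by case: x => [r|//|//]; rewrite lte_fin. Qed.

(** The finitely many test functions of a weak-star neighbourhood are absorbed into one weight, the
    sum of their moduli, so approximation in every weighted L^1 is enough. *)
Lemma weak_star_closure_approx M f : ess_bounded m (f : Borel X -> R[i]) ->
  (forall (eta : Borel X -> R) (e : R), measurable_fun [set: Borel X] eta ->
    (forall x, 0 <= eta x) -> (\int[m]_x (eta x)%:E < +oo)%E -> 0 < e ->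
    exists g, [/\ M g, cmeas (g : Borel X -> R[i]) &
      (\int[m]_x (nrm (f x - g x) `^ 1 * eta x)%:E < e%:E)%E]) ->
  weak_star_closure m M f.
Proof.
move=> fB H; split; first exact/CLspace_infty.
move=> n h e hC e0.
have hm i : cmeas (h i : Borel X -> R[i]) /\ (pint m 1 (h i) < +oo)%E.
  exact: (CLspace_fin (h i) ltr01).1.
pose eta (x : Borel X) := \sum_(i < n) nrm (h i x).
have meta : measurable_fun [set: Borel X] eta.
  apply: measurable_sum => i; apply: cmeas_nrm; exact: (hm i).1.
have eta0 x : 0 <= eta x by apply: sumr_ge0 => i _; exact: nrm_ge0.
have Ieta : (\int[m]_x (eta x)%:E < +oo)%E.
  rewrite /eta; under eq_integral do rewrite -sumEFin.
  rewrite ge0_integral_sum//.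
  - by apply: lte_sum_pinfty => i _; have [_] := hm i; rewrite pint1.
  - by move=> i; apply/measurable_EFinP; apply: cmeas_nrm; exact: (hm i).1.
  - by move=> i x _; rewrite lee_fin nrm_ge0.
have [g [Mg mg hg]] := H eta (e / 2) meta eta0 Ieta (divr_gt0 e0 (ltr0Sn _ 1)).
exists g => // i; have mf : cmeas (f : Borel X -> R[i]) by case: fB.
have mfg := cmeasB mf mg.
have [mR mI] := cmeasM mfg (hm i).1.
have key (F : Borel X -> R) : measurable_fun [set: Borel X] F ->
    (forall x, `|F x| <= nrm ((f x - g x) * h i x)) -> `|\int[m]_x F x| < e / 2.
  move=> mF FB; apply: fine_abs_lt.
  apply: le_lt_trans (le_abse_integral m measurableT ((measurable_EFinP _ _).2 mF)) _.
  apply: le_lt_trans hg; apply: (@int_le _ _ _ m (fun x => `|F x|)) => //.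
  - exact: measurableT_comp.
  - by apply: measurable_funM => //; exact: cmeas_pow.
  - move=> x; apply: le_trans (FB x) _; rewrite nrmM powRr1 ?nrm_ge0//.
    rewrite ler_wpM2l ?nrm_ge0// /eta (bigD1 i)//= lerDl.
    by apply: sumr_ge0 => j _; exact: nrm_ge0.
apply: le_lt_trans (nrm_le_ReIm _) _; rewrite (splitr e) /Cintegral /=.
by apply: ltrD; apply: key => // x; [exact: Re_le_nrm|exact: Im_le_nrm].
Qed.

(** If [f] were at positive L^2 distance from [M], the separating function [k], being in L^1, would
    alone define a weak-star neighbourhood of [f] that misses [M]. *)
Lemma weak_star_norm_closure M f : M (cst 0) ->
  (forall g h, M g -> M h -> M (g \+ h)) -> (forall (c : R[i]) g, M g -> M (c \*o g)) ->
  (forall g, M g -> ess_bounded m (g : Borel X -> R[i])) -> weak_star_closure m M f ->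
  forall e : R, 0 < e -> exists2 g, M g & (pint m 2 (fun x => f x - g x)%R < e%:E)%E.
Proof.
move=> M0 MD MZ MB [/CLspace_infty fB fM] e e0; apply: contrapT => H.
have pint2 g : pint m 2 g = (\int[m]_x (nrm (g x) ^+ 2)%:E)%E.
  by apply: eq_integral => x _; rewrite powR_mulrn// nrm_ge0.
have Me g : M g -> (e%:E <= \int[m]_x (nrm (f x - g x) ^+ 2)%:E)%E.
  move=> Mg; rewrite leNgt; apply/negP => h; apply: H; exists g => //.
  by rewrite pint2.
have Mconv g g' (t : R) : M g -> M g' -> 0 <= t <= 1 ->
    M (fun x => (1 - t)%:C%C * g x + t%:C%C * g' x).
  by move=> Mg Mg' _; exact: MD (MZ _ _ Mg) (MZ _ _ Mg').
have [k [dlt [mk Ik dlt0 Hk]]] :=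
  weak_separation (MB : M `<=` ess_bounded m) fB (ex_intro _ _ M0) Mconv e0 Me.
have kC : CLspace m 1 k.
  by apply/(CLspace_fin _ ltr01); split => //; rewrite pint1.
have [g Mg /(_ ord0)] := fM 1%N (fun _ => k) dlt (fun _ => kC) dlt0.
have [_ h1] := Hk _ Mg; move=> h2.
have : dlt < dlt.
  apply: le_lt_trans h2; apply: le_trans h1 _.
  by apply: le_trans (Re_le_nrm _); exact: ler_norm.
by rewrite ltxx.
Qed.

Lemma Lclosure_sub q M N : M `<=` N -> Lclosure m q M `<=` Lclosure m q N.
Proof.
rewrite /Lclosure; case: ifP => _ MN f [fC H]; split => //.
- by move=> n h e hC e0; have [g Mg hg] := H n h e hC e0; exists g => //; exact: MN.
- by move=> e e0; have [g Mg hg] := H e e0; exists g => //; exact: MN.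
Qed.

Lemma Lclosure_fin (r : R) M : Lclosure m r%:E M = norm_closure m r%:E M.
Proof. by []. Qed.

(** * Restriction to L^q and closure in L^p *)

Section InvariantSubspaces.
Variables (A : set (X -> R[i])) (C : R).
Hypothesis AC : dominating_algebra m (A : set (Borel X -> R[i])) C.

Lemma alg_ess_bounded a : A a -> ess_bounded m (a : Borel X -> R[i]).
Proof.
move=> Aa; split; first exact: alg_cmeas AC _ Aa.
have [[_ [c1 h1]] [_ [c2 h2]]] := alg_bmeas AC Aa.
exists (c1 + c2); apply: nearW => x.
by apply: le_trans (nrm_le_ReIm _) _; exact: lerD.
Qed.

(** The bounded approximant of [f] is itself an L^r limit of products a f, which are in [M] by
    invariance, so it belongs to the closed set [M]. *)
Lemma invariant_bounded_dense (r e : R) M f : 0 < r ->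
  closed_invariant_subspace m A r%:E M -> M f -> 0 < e ->
  exists g, [/\ M g, ess_bounded m (g : Borel X -> R[i]) &
    (pint m r (fun x => f x - g x)%R < e%:E)%E].
Proof.
move=> r0 [MC _ MA Mcl] Mf e0.
have [mf If] := (CLspace_fin f r0).1 (MC _ Mf).
have [g [c [mg gc fg Hg]]] := bounded_density AC r0 mf If e0.
have gB : ess_bounded m (g : Borel X -> R[i]) by split => //; exists c.
exists g; split; [apply: Mcl|exact: gB|exact: fg].
rewrite Lclosure_fin; apply/(norm_closureP _ _ r0).
split; first exact: ess_bounded_CLspace.
by move=> e' /Hg[a Aa h]; exists (a \* f) => //; exact: MA.
Qed.

(* The weighted exponents cover both topologies: [eta = 1], [s = q] for the
   norm of L^q, and [s = 1] with [eta] in L^1 for the weak-star topology. *)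
Lemma Lclosure_transfer q (p : R) M f : (0 < q)%E -> 0 < p -> CLspace m q f ->
  (forall a g, A a -> M g -> M (a \* g)) ->
  (forall e : R, 0 < e -> exists g, [/\ M g, ess_bounded m (g : Borel X -> R[i]) &
    (pint m p (fun x => f x - g x)%R < e%:E)%E]) ->
  Lclosure m q M f.
Proof.
move=> q0 p0 fC MA H; have mf := CLspace_cmeas fC.
have transfer (s : R) (eta : Borel X -> R) (e : R) : 0 < s ->
    measurable_fun [set: Borel X] eta -> (forall x, 0 <= eta x) ->
    (\int[m]_x (eta x)%:E < +oo)%E ->
    (\int[m]_x (nrm (f x) `^ s * eta x)%:E < +oo)%E -> 0 < e ->
    exists g, [/\ M g, cmeas (g : Borel X -> R[i]) &
      (\int[m]_x (nrm (f x - g x) `^ s * eta x)%:E < e%:E)%E].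
  move=> s0 meta eta0 Ieta If e0.
  have H' (e' : R) : 0 < e' -> exists2 g, (M `&` ess_bounded m) g &
      (\int[m]_x (nrm (f x - g x) `^ p)%:E < e'%:E)%E.
    by move=> /H[g [Mg gB h]]; exists g.
  have [a [g [Aa [Mg [mg _]] h]]] := bounded_transfer AC p0 s0 mf meta eta0 Ieta If
    (fun g (Mg : (M `&` ess_bounded m) g) => Mg.2) H' e0.
  exists (a \* g); split => //; first exact: MA.
  exact: cmeasM (alg_cmeas AC Aa) mg.
case: q q0 fC => [r||//] r0 fC; last first.
  rewrite /Lclosure eqxx; have fB := (CLspace_infty f).1 fC.
  apply: weak_star_closure_approx => // eta e meta eta0 Ieta e0.
  apply: transfer => //; have [_ [c fc]] := fB.
  apply: (@le_lt_trans _ _ (\int[m]_x (`|c| * eta x)%:E)%E).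
    apply: int_ae_le => //.
    - by apply: measurable_funM => //; exact: cmeas_pow.
    - exact: measurable_funM.
    - by move=> x; rewrite mulr_ge0// powR_ge0.
    - by move=> x; rewrite mulr_ge0.
    apply: filterS fc => x h; rewrite powRr1 ?nrm_ge0// ler_wpM2r//.
    by apply: le_trans h _; exact: ler_norm.
  by rewrite intZ// lte_mul_pinfty// lee_fin.
rewrite Lclosure_fin; apply/(norm_closureP _ _ r0); split => // e e0.
have [_ If] := (CLspace_fin f r0).1 fC.
have [] := transfer r (cst 1) e r0 _ _ _ _ e0 => //.
- by rewrite int_cst mul1e -[X in (X < _)%E]/(m setT) m1 ltry.
- by under eq_integral do rewrite /= mulr1.
move=> g [Mg _ h]; exists g => //.
by move: h; under eq_integral do rewrite /= mulr1.
Qed.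

Lemma invariant_restrict_dense (r : R) q M : 0 < r -> (r%:E < q)%E ->
  closed_invariant_subspace m A r%:E M ->
  M = Lclosure m r%:E (M `&` CLspace m q).
Proof.
move=> r0 rq MI; have [MC _ MA Mcl] := MI.
have q0 : (0 < q)%E by apply: lt_trans rq; rewrite lte_fin.
apply/seteqP; split; last first.
  by apply: subset_trans Mcl; apply: Lclosure_sub; exact: subIsetl.
move=> f Mf; rewrite Lclosure_fin; apply/(norm_closureP _ _ r0).
split => [|e e0]; first exact: MC.
have [g [Mg gB h]] := invariant_bounded_dense r0 MI Mf e0.
by exists g => //; split => //; exact: ess_bounded_CLspace.
Qed.

Lemma invariant_restrict (r : R) q M : 0 < r -> (r%:E < q)%E ->
  closed_invariant_subspace m A r%:E M ->
  closed_invariant_subspace m A q (M `&` CLspace m q).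
Proof.
move=> r0 rq MI; have [MC [M0 MD MZ] MA Mcl] := MI.
have q0 : (0 < q)%E by apply: lt_trans rq; rewrite lte_fin.
have cstB (c : R[i]) : ess_bounded m (cst c : Borel X -> R[i]).
  by split; [exact: cmeas_cst|exists (nrm c); exact: nearW].
split.
- exact: subIsetr.
- split.
  + by split => //; apply: ess_bounded_CLspace.
  + by move=> f g [Mf Cf] [Mg Cg]; split; [exact: MD|exact: CLspaceD].
  + by move=> c f [Mf Cf]; split; [exact: MZ|exact: (CLspaceM q0 (cstB c) Cf)].
- move=> a f Aa [Mf Cf]; split; first exact: MA.
  by apply: CLspaceM => //; exact: alg_ess_bounded.
case: q rq q0 => [r'|_ _|//].
  rewrite lte_fin => rr' r'0 f; rewrite Lclosure_fin => /norm_closureP - /(_ r'0)[fC H].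
  split => //; apply: Mcl; rewrite Lclosure_fin; apply/(norm_closureP _ _ r0).
  split; first exact: CLspace_lower fC.
  move=> e e0; have [e' e'0 He'] := pint_small_lower m1 r0 rr' e0.
  have [g [Mg Cg] hg] := H _ e'0; exists g => //; apply: He' => //.
  exact: cmeasB (CLspace_cmeas fC) (CLspace_cmeas Cg).
move=> f; rewrite /Lclosure eqxx => fM.
have fC : CLspace m +oo%E f by case: fM.
(* Projection gives closeness in L^2 only, and [r] may exceed 2; the multipliers carry it from the
   exponent 2 to [r]. *)
split => //; apply: Mcl; apply: (@Lclosure_transfer _ 2) => //.
  exact: (CLspace_lower r0 (ltry r) fC).
move=> e e0; have [||||g [Mg Cg] h] := weak_star_norm_closure _ _ _ _ fM e0.
- by split => //; exact: ess_bounded_CLspace.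
- by move=> g h [Mg Cg] [Mh Ch]; split; [exact: MD|exact: CLspaceD].
- by move=> c g [Mg Cg]; split; [exact: MZ|exact: (CLspaceM _ (cstB c) Cg)].
- by move=> g [_ /CLspace_infty].
by exists g; split => //; exact/CLspace_infty.
Qed.

(** Multiplication by an essentially bounded function is continuous for [pint], which handles
    scalars and elements of [A] at once. *)
Lemma invariant_closure (r : R) q N : 0 < r -> (r%:E < q)%E ->
  closed_invariant_subspace m A q N ->
  closed_invariant_subspace m A r%:E (norm_closure m r%:E N).
Proof.
move=> r0 rq [NC [N0 ND NZ] NA _].
have Nm g : N g -> cmeas (g : Borel X -> R[i]).
  by move=> Ng; exact: CLspace_cmeas (NC _ Ng).
have r0' : (0 < r%:E)%E by rewrite lte_fin.
have p3 : 0 < 3 `^ r :> R by exact: powR_gt0.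
have pint_eq u v : (forall x, u x = v x) -> pint m r u = pint m r v.
  by move=> uv; congr (pint m r _); apply/funext.
have multB a f : ess_bounded m (a : Borel X -> R[i]) ->
    (forall g, N g -> N (a \* g)) -> norm_closure m r%:E N f ->
    norm_closure m r%:E N (a \* f).
  move=> aB Na /norm_closureP - /(_ r0)[fC H]; apply/(norm_closureP _ _ r0).
  split; first exact: CLspaceM.
  move=> e e0; have [ma [c ac]] := aB.
  have c0 : 0 < `|c| `^ r + 1 by rewrite ltr_wpDl// powR_ge0.
  have [g Ng hg] := H _ (divr_gt0 e0 c0); exists (a \* g); first exact: Na.
  rewrite (pint_eq _ (fun x => a x * (f x - g x))); last by move=> x; rewrite mulrBr.
  have mfg := cmeasB (CLspace_cmeas fC) (Nm _ Ng).
  apply: le_lt_trans (pint_bounded r0 ma mfg ac) _.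
  apply: (@le_lt_trans _ _ ((`|c| `^ r + 1)%:E * pint m r (fun x => f x - g x)%R)%E).
    by rewrite lee_wpmul2r ?pint_ge0// lee_fin lerDl.
  apply: (@lt_le_trans _ _ ((`|c| `^ r + 1)%:E * (e / (`|c| `^ r + 1))%:E)%E).
    by rewrite lte_pmul2l// lte_fin.
  by rewrite -EFinM lee_fin mulrC divfK// gt_eqF.
split.
- by move=> f [].
- split.
  + apply/(norm_closureP _ _ r0); split.
      by apply: CLspace_lower rq (NC _ N0).
    by move=> e e0; exists (cst 0) => //; rewrite pintB pint0.
  + move=> f g /norm_closureP - /(_ r0)[fC Hf] /norm_closureP - /(_ r0)[gC Hg].
    apply/(norm_closureP _ _ r0); split; first exact: CLspaceD.
    move=> e e0; have e1 : 0 < e / 3 `^ r / 2 by rewrite !divr_gt0.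
    have [f' Nf' hf] := Hf _ e1; have [g' Ng' hg] := Hg _ e1.
    exists (f' \+ g'); first exact: ND.
    rewrite (pint_eq _ (fun x => (f x - f' x) + (g x - g' x))); last first.
      by move=> x; rewrite /= opprD addrACA.
    have mff := cmeasB (CLspace_cmeas fC) (Nm _ Nf').
    have mgg := cmeasB (CLspace_cmeas gC) (Nm _ Ng').
    exact: le_lt_trans (pintD m r0 mff mgg) (lte_scaled_sum p3 hf hg).
  + move=> c f fN; apply: (multB (cst c)) => // [|g Ng]; last exact: NZ.
    by split; [exact: cmeas_cst|exists (nrm c); exact: nearW].
- move=> a f Aa fN; apply: multB => //; first exact: alg_ess_bounded.
  by move=> g Ng; exact: NA.
move=> f; rewrite Lclosure_fin => /norm_closureP - /(_ r0)[fC H].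
apply/(norm_closureP _ _ r0); split => // e e0.
have e1 : 0 < e / 3 `^ r / 2 by rewrite !divr_gt0.
have [g /norm_closureP - /(_ r0)[gC Hg] fg] := H _ e1.
have [h Nh gh] := Hg _ e1; exists h => //.
have mf := CLspace_cmeas fC; have mg := CLspace_cmeas gC.
exact: le_lt_trans (pint_tri m r0 mf mg (Nm _ Nh)) (lte_scaled_sum p3 fg gh).
Qed.

(** The transfer back to L^q needs bounded approximants taken from [N]. If q = oo all elements of
    [N] are bounded; otherwise bounded elements are dense in [N] for the exponent [q], hence also
    for the smaller exponent [r]. *)
Lemma invariant_closure_restrict (r : R) q N : 0 < r -> (r%:E < q)%E ->
  closed_invariant_subspace m A q N ->
  norm_closure m r%:E N `&` CLspace m q = N.
Proof.
move=> r0 rq NI; have [NC [N0 ND NZ] NA Ncl] := NI.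
have q0 : (0 < q)%E by apply: lt_trans rq; rewrite lte_fin.
apply/seteqP; split => [f [fN fC]|f Nf]; last first.
  split; last exact: NC.
  apply/(norm_closureP _ _ r0); split; first exact: CLspace_lower rq (NC _ Nf).
  by move=> e e0; exists f => //; rewrite pintB pint0.
apply: Ncl; apply: (@Lclosure_transfer _ r) => // e e0.
have /norm_closureP - /(_ r0)[fCr Hf] := fN.
case: q q0 rq NI NC fC => [r'||//] q0 rq NI NC fC; last first.
  by have [g Ng h] := Hf _ e0; exists g; split => //; exact/CLspace_infty/NC.
have p3 : 0 < 3 `^ r :> R by exact: powR_gt0.
have e1 : 0 < e / 3 `^ r / 2 by rewrite !divr_gt0.
have [g Ng fg] := Hf _ e1.
have [e' e'0 He'] := pint_small_lower m1 r0 (rq : r < r') e1.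
have [h [Nh hB gh]] := invariant_bounded_dense q0 NI Ng e'0.
have mf := CLspace_cmeas fC; have mg := CLspace_cmeas (NC _ Ng).
have mh : cmeas (h : Borel X -> R[i]) by case: hB.
have gh' := He' _ (cmeasB mg mh) gh.
exists h; split; [exact: Nh|exact: hB|].
exact: le_lt_trans (pint_tri m r0 mf mg mh) (lte_scaled_sum p3 fg gh').
Qed.

End InvariantSubspaces.
End LpSpaces.

Theorem theorem3p1 (R : realType) (X : ptopologicalType)
    (A : set (X -> R[i])) (phi : (X -> R[i]) -> R[i])
    (m : {finite_measure set (Borel X) -> \bar R}) (p q : \bar R) :
  compact [set: X] -> hausdorff_space X ->
  uniform_algebra A -> multiplicative_functional A phi ->
  finite_dimensional (representing_measures A phi) ->
  core_measure A phi m ->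
  (0 < p)%E -> (p < q)%E ->
  exists Phi : set (X -> R[i]) -> set (X -> R[i]),
    set_bij [set Mp | closed_invariant_subspace m A p Mp]
            [set Mq | closed_invariant_subspace m A q Mq] Phi /\
    forall Mp, closed_invariant_subspace m A p Mp ->
      Phi Mp = Mp `&` CLspace m q /\ Mp = Lclosure m p (Phi Mp).
Proof.
move=> Xc Xh uA mphi fd core p0 pq.
have [C AC] := uniform_algebra_dominating Xc Xh uA mphi fd core.
have m1 := alg_mass AC.
(* [p = +oo] is excluded by [p < q], so only [q] may be infinite. *)
case: p p0 pq => [r|_|//]; last by rewrite ltNge leey.
move=> r0 rq.
(* Intersection is injective because the closure in L^p recovers [M], and onto because the closure
   of [N] is a preimage of [N]. *)
exists (fun M => M `&` CLspace m q); split; last first.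
  by move=> M MI; split => //; exact: (invariant_restrict_dense m1 AC r0 rq).
split.
- by move=> M MI; exact: (invariant_restrict m1 AC r0 rq).
- move=> M N /set_mem MI /set_mem NI MN.
  rewrite (invariant_restrict_dense m1 AC r0 rq MI) MN.
  by rewrite -(invariant_restrict_dense m1 AC r0 rq NI).
- move=> N NI; exists (norm_closure m r%:E N).
    exact: (invariant_closure m1 AC r0 rq).
  exact: (invariant_closure_restrict m1 AC r0 rq).
Qed.
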